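(* Let $\chi$ be a Dirichlet character modulo $q$, let $c>0$ be real, and let $s\in\mathbb{C}$ with $\Re(s)>1$. For every $x\in\mathbb{R}$ with $|x|\le 2c/q$, $$s\sum_{n=1}^{\infty}\frac{\chi(n)}{n^{s+1}}\cos\frac{n\pi x}{c}+\frac{\pi x}{c}\sum_{n=1}^{\infty}\frac{\chi(n)}{n^s}\sin\frac{n\pi x}{c}=\sum_{k=0}^{\infty}(-1)^k\frac{s-2k}{(2k)!}\left(\frac{\pi x}{c}\right)^{2k}L(s+1-2k,\chi),$$ where, if $s=2k$ for some $k$, the product $(s-2k)L(s+1-2k,\chi)$ is understood as $\lim_{w\to0}w\,L(1+w,\chi)$.
   Context: $L(s,\chi)$ is the Dirichlet $L$-function: the meromorphic continuation to $\mathbb{C}$ of $\sum_{n\ge1}\chi(n)n^{-s}$ ($\Re(s)>1$), whose only possible pole is a simple pole at $s=1$. *)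

(* Defs.v *)
From Stdlib Require Export Reals ZArith Znumtheory ClassicalEpsilon.
From Coquelicot Require Export Coquelicot.

Open Scope C_scope.

Record Dirichlet_character (q : nat) (chi : Z -> C) : Prop := {
  chi_periodic : forall a : Z, chi (a + Z.of_nat q)%Z = chi a;
  chi_mult : forall a b : Z, chi (a * b)%Z = chi a * chi b;
  chi_support : forall a : Z, chi a <> 0 <-> rel_prime a (Z.of_nat q)
}.

Definition Cexp (z : C) : C :=
  ((exp (Re z) * cos (Im z))%R, (exp (Re z) * sin (Im z))%R).

(* Complex power [n ^ s]; meaningful for [1 <= n]. *)
Definition nat_cpow (n : nat) (s : C) : C := Cexp (s * RtoC (ln (INR n))).

(* [F] has the value [G 1 <> 0] as its residue; the value [F 1] is irrelevant. *)
Definition simple_pole_at_1 (F : C -> C) : Prop :=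
  exists G : C -> C,
    (forall z : C, ex_derive G z) /\ G 1 <> 0 /\
    (forall z : C, z <> 1 -> F z = G z / (z - 1)).

(* [ex_derive] is complex differentiability here (scalars [C_AbsRing]), so the
   second clause says that [F] is holomorphic on [C \ {1}]. *)
Record Dirichlet_continuation (chi : Z -> C) (F : C -> C) : Prop := {
  continuation_series : forall s : C, (1 < Re s)%R ->
    is_series
      (fun n : nat => chi (Z.of_nat (S n)) / nat_cpow (S n) s : C_NormedModule)
      (F s);
  continuation_holomorphic : forall s : C, s <> 1 -> ex_derive F s;
  continuation_at_1 : ex_derive F (RtoC 1) \/ simple_pole_at_1 F
}.

(* For a Dirichlet character the continuation exists and is unique away from
   [1]; at [1] it is determined when it is holomorphic there, and unspecified
   when it has a pole. *)
Definition Dirichlet_L (chi : Z -> C) : C -> C :=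
  epsilon (inhabits (fun _ : C => RtoC 0)) (Dirichlet_continuation chi).

(* Main.v *)
(* Write th = PI x / c, so that q |th| <= 2 PI, put kappa y = PI / (2 cosh^2 (PI y))
   and, for h holomorphic on the right half-plane,
     T_b h = int_R kappa y * h (b + i q y) dy.
   Integrating h times PI / (2 sin^2) over a vertical strip gives
   T_(b+q) h - T_b h = q h'(b + q/2), the sin^(-2) having a double pole at the
   centre of the strip; hence, if T_b h -> 0 as b -> oo,
     - sum_(n >= 1) chi n * h' n
       = sum_(1 <= r <= q) chi r * (- h' r + T_(r + q/2) h / q).
   For h z = z^(-w) the right-hand side E w is entire in w and the left-hand side
   is w L (w + 1, chi), so that E (z - 1) / (z - 1) is the continuation of L.  For
   h z = z^(-s) cos (th z) the left-hand side is the left-hand side of the theorem.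
   Expanding the cosine, and exchanging sum and integral by the domination
   kappa y * e^(q |th| |y|) |b + i q y|^(-Re s) = O (|y|^(-Re s)), the right-hand
   side becomes sum_k (-1)^k th^(2k) / (2k)! E (s - 2k).

   Uniqueness of the continuation: an entire f vanishing for Re z > b vanishes for
   Re z >= b - 1/3, by the mean value property of f (w) e^(N ((w-z) + (w-z)^2/2))
   on the unit circle around z, as N -> oo. *)

(* The left-hand side of the theorem has its shape because s z^(-s-1) cos (th z) + th z^(-s) sin (th
   z) is the derivative of - z^(-s) cos (th z); the factor s - 2k likewise comes from
   differentiating z^(-(s-2k)). Working with w L (w + 1) instead of L removes the pole, so a
   degenerate term s = 2k is just the value of [E] at 0. The kernel sin^(-2) is preferred to a
   cotangent because it is real, positive and equal on both edges of the strip, and decays in both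
   vertical directions. Only the first Taylor polynomial of h at the centre matters: subtracting it
   leaves a removable singularity, so Goursat's theorem on rectangles is the only contour theorem
   involved. The obstacle is the endpoint q |th| = 2 PI, where the decay of [kappa] and the growth
   of the cosine cancel exactly: integrability has to come from z^(-s), which is what Re s > 1 pays
   for. Analyticity in w is obtained by expanding z^(-w) to third order under the integral.
   [Dirichlet_L] is a choice among continuations, so existence and uniqueness both have to be
   proved. *)
Require Import Defs.
From Stdlib Require Import Lra Lia Psatz Classical.

Open Scope C_scope.

(** * Complex differentiability *)

(* The uniform structure of [Cmod]; Coquelicot's default one on [C] is the product
   structure of [R * R], for which its algebraic continuity lemmas do not apply. *)
Notation CU := (AbsRing_UniformSpace C_AbsRing).
Notation contC f x := (@continuous _ (AbsRing_UniformSpace C_AbsRing) f x).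
Notation contCC f z := (@continuous (AbsRing_UniformSpace C_AbsRing) (AbsRing_UniformSpace C_AbsRing) f z).
Notation is_seriesC a l := (@is_series C_AbsRing C_NormedModule a l).

(** Goals coming from Coquelicot structures state their equality at a carrier that is only
    convertible to [C]; restating it at [C] lets [ring] and [field] recognise the field. *)
Ltac cring := cbv beta; match goal with |- @eq _ ?a ?b => change (@eq C a b) end; ring.
Ltac cfield := cbv beta; match goal with |- @eq _ ?a ?b => change (@eq C a b) end; field.

Lemma Cmod_triangle_minus (a b : C) : (Cmod (a - b) <= Cmod a + Cmod b)%R.
Proof.
  unfold Cminus. eapply Rle_trans; [apply Cmod_triangle|]. rewrite Cmod_opp; lra.
Qed.

Lemma Cmod_ge_minus (a b : C) : (Cmod a - Cmod b <= Cmod (a - b))%R.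
Proof.
  pose proof (Cmod_triangle (a - b) b) as H.
  replace (a - b + b) with a in H by ring. lra.
Qed.

Lemma im_le_Cmod (c : C) : (Rabs (Im c) <= Cmod c)%R.
Proof.
  pose proof (Rmax_Cmod c). pose proof (Rmax_r (Rabs (fst c)) (Rabs (snd c))).
  unfold Im. lra.
Qed.

Lemma Re_minus_le (a b : C) : (Rabs (Re a - Re b) <= Cmod (a - b)%C)%R.
Proof. unfold Rminus. rewrite <- re_opp, <- re_plus. apply re_le_Cmod. Qed.

Lemma Im_minus_le (a b : C) : (Rabs (Im a - Im b) <= Cmod (a - b)%C)%R.
Proof. unfold Rminus. rewrite <- im_opp, <- im_plus. apply im_le_Cmod. Qed.

Lemma Cmod_le_re_im (c : C) : (Cmod c <= Rabs (Re c) + Rabs (Im c))%R.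
Proof.
  replace c with (RtoC (Re c) + RtoC (Im c) * Ci) at 1
    by (destruct c; unfold RtoC, Ci, Cmult, Cplus; simpl; f_equal; ring).
  eapply Rle_trans; [apply Cmod_triangle|].
  rewrite Cmod_mult, Cmod_Ci, !Cmod_R; lra.
Qed.

Lemma contC_eps (U : UniformSpace) (f : U -> C) (x : U) :
  contC f x <->
  forall eps : posreal, locally x (fun u => (Cmod (f u - f x) < eps)%R).
Proof.
  split.
  - intros H eps. apply (H (fun v => (Cmod (v - f x) < eps)%R)).
    exists eps. intros y Hy. exact Hy.
  - intros H P [eps HP]. unfold filtermap.
    destruct (H eps) as [d Hd]. exists d. intros u Hu. apply HP, (Hd u Hu).
Qed.

Lemma contC_re (U : UniformSpace) (f : U -> C) (x : U) :
  contC f x -> continuous (fun u => Re (f u)) x.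
Proof.
  intros H P [eps HP]. rewrite contC_eps in H.
  destruct (H eps) as [d Hd]. exists d. intros u Hu. apply HP.
  eapply Rle_lt_trans; [apply Re_minus_le|apply (Hd u Hu)].
Qed.

Lemma contC_im (U : UniformSpace) (f : U -> C) (x : U) :
  contC f x -> continuous (fun u => Im (f u)) x.
Proof.
  intros H P [eps HP]. rewrite contC_eps in H.
  destruct (H eps) as [d Hd]. exists d. intros u Hu. apply HP.
  eapply Rle_lt_trans; [apply Im_minus_le|apply (Hd u Hu)].
Qed.

Lemma contC_pair (U : UniformSpace) (f : U -> C) (x : U) :
  continuous (fun u => Re (f u)) x -> continuous (fun u => Im (f u)) x ->
  contC f x.
Proof.
  intros H1 H2. apply contC_eps. intros eps.
  assert (He : (0 < eps / 2)%R) by (destruct eps; simpl; lra).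
  assert (K1 : locally x (fun u => (Rabs (Re (f u) - Re (f x)) < eps / 2)%R)).
  { apply (H1 (fun v => (Rabs (v - Re (f x)) < eps / 2)%R)).
    exists (mkposreal _ He). intros y Hy. exact Hy. }
  assert (K2 : locally x (fun u => (Rabs (Im (f u) - Im (f x)) < eps / 2)%R)).
  { apply (H2 (fun v => (Rabs (v - Im (f x)) < eps / 2)%R)).
    exists (mkposreal _ He). intros y Hy. exact Hy. }
  generalize (filter_and _ _ K1 K2). apply filter_imp. intros u [L1 L2].
  eapply Rle_lt_trans; [apply Cmod_le_re_im|].
  unfold Cminus. rewrite re_plus, im_plus, re_opp, im_opp.
  change (Rabs (Re (f u) - Re (f x)) + Rabs (Im (f u) - Im (f x)) < eps)%R. lra.
Qed.

Lemma contC_const (U : UniformSpace) (a : C) (x : U) : contC (fun _ : U => a) x.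
Proof. exact (continuous_const (U := U) (V := CU) a x). Qed.

Lemma contC_id (z : C) : contCC (fun w => w) z.
Proof. exact (continuous_id (U := CU) z). Qed.

Lemma contC_plus (U : UniformSpace) (f g : U -> C) (x : U) :
  contC f x -> contC g x -> contC (fun u => f u + g u ) x.
Proof. exact (continuous_plus (V := AbsRing_NormedModule C_AbsRing) f g x). Qed.

Lemma contC_minus (U : UniformSpace) (f g : U -> C) (x : U) :
  contC f x -> contC g x -> contC (fun u => f u - g u ) x.
Proof. exact (continuous_minus (V := AbsRing_NormedModule C_AbsRing) f g x). Qed.

Lemma contC_opp (U : UniformSpace) (f : U -> C) (x : U) :
  contC f x -> contC (fun u => - f u ) x.
Proof. exact (continuous_opp (V := AbsRing_NormedModule C_AbsRing) f x). Qed.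

Lemma contC_mult (U : UniformSpace) (f g : U -> C) (x : U) :
  contC f x -> contC g x -> contC (fun u => f u * g u ) x.
Proof. exact (continuous_mult (K := C_AbsRing) f g x). Qed.

Lemma contC_inv (U : UniformSpace) (f : U -> C) (x : U) :
  contC f x -> f x <> RtoC 0 -> contC (fun u => / f u ) x.
Proof.
  intros H H0. apply Cmod_gt_0 in H0. apply contC_eps. intros eps.
  rewrite contC_eps in H.
  set (m := Cmod (f x)) in *.
  assert (Hm2 : (0 < m / 2)%R) by lra.
  (* Near [x] the modulus of [f u] stays above [m / 2], so the inverses differ by at most
     [Cmod (f u - f x) / (m / 2 * m)]; the tolerance cancels this denominator. *)
  assert (He : (0 < eps * (m / 2 * m))%R).
  { apply Rmult_lt_0_compat; [apply cond_pos|]. apply Rmult_lt_0_compat; lra. }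
  generalize (filter_and _ _ (H (mkposreal _ Hm2)) (H (mkposreal _ He))).
  apply filter_imp. simpl. intros u [L1 L2].
  assert (Hu : (m / 2 < Cmod (f u))%R).
  { pose proof (Cmod_ge_minus (f x) (f x - f u)) as K.
    replace (f x - (f x - f u)) with (f u) in K by ring.
    rewrite <- Copp_minus_distr, Cmod_opp in K. fold m in K. lra. }
  assert (N1 : f u <> 0) by (apply Cmod_gt_0; lra).
  assert (N2 : f x <> 0) by (apply Cmod_gt_0; exact H0).
  replace (/ f u - / f x) with (- ((f u - f x) / (f u * f x)))
    by (field; split; assumption).
  rewrite Cmod_opp, Cmod_div by (apply Cmult_neq_0; assumption).
  rewrite Cmod_mult. fold m.
  assert (P : (0 < Cmod (f u) * m)%R) by (apply Rmult_lt_0_compat; lra).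
  apply (Rmult_lt_reg_r (Cmod (f u) * m)); [exact P|].
  unfold Rdiv. rewrite Rmult_assoc, Rinv_l, Rmult_1_r by lra.
  eapply Rlt_le_trans; [exact L2|].
  apply Rmult_le_compat_l; [apply Rlt_le, cond_pos|].
  apply Rmult_le_compat_r; lra.
Qed.

(* Caratheodory's form: the chain, product and quotient rules become algebra. *)
Definition cderiv (f : C -> C) (z l : C) : Prop :=
  exists phi : C -> C,
    contCC phi z /\ phi z = l /\
    locally (T := CU) z (fun w => f w - f z = phi w * (w - z)).

Lemma cderiv_continuous (f : C -> C) (z l : C) :
  cderiv f z l -> contCC f z.
Proof.
  intros (phi & H & _ & E).
  apply (continuous_ext_loc (T := CU) (U := CU) _ (fun w => phi w * (w - z) + f z)).
  - generalize E; apply filter_imp. intros w Hw. rewrite <- Hw. cring.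
  - apply (contC_plus CU); [|apply (contC_const CU)].
    apply (contC_mult CU); [exact H|].
    apply (contC_minus CU); [apply contC_id|apply (contC_const CU)].
Qed.

Lemma contC_comp (f g : C -> C) (z : C) :
  contCC f z -> contCC g (f z) -> contCC (fun w => g (f w)) z.
Proof. exact (continuous_comp (U := CU) (V := CU) (W := CU) f g z). Qed.

Lemma cderiv_ext (f g : C -> C) (z l : C) :
  (forall w, f w = g w) -> cderiv f z l -> cderiv g z l.
Proof.
  intros H (phi & H1 & H2 & E). exists phi; repeat split; auto.
  generalize E; apply filter_imp. intros w; rewrite !H; auto.
Qed.

Lemma cderiv_ext_loc (f g : C -> C) (z l : C) :
  locally (T := CU) z (fun w => f w = g w) -> cderiv f z l -> cderiv g z l.
Proof.
  intros H (phi & H1 & H2 & E). exists phi; repeat split; auto.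
  assert (Hz := locally_singleton _ _ H).
  generalize (filter_and _ _ H E); apply filter_imp.
  intros w [K1 K2]; rewrite <- Hz, <- K1; auto.
Qed.

Lemma cderiv_eq (f : C -> C) (z l l' : C) : l = l' -> cderiv f z l -> cderiv f z l'.
Proof. intros ->; auto. Qed.

Lemma cderiv_const (a z : C) : cderiv (fun _ => a) z 0.
Proof.
  exists (fun _ => 0); repeat split; [apply (contC_const CU)|].
  apply filter_forall. intros; cring.
Qed.

Lemma cderiv_id (z : C) : cderiv (fun w => w) z 1.
Proof.
  exists (fun _ => 1); repeat split; [apply (contC_const CU)|].
  apply filter_forall. intros; cring.
Qed.

Lemma cderiv_plus (f g : C -> C) (z l m : C) :
  cderiv f z l -> cderiv g z m -> cderiv (fun w => f w + g w) z (l + m).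
Proof.
  intros (p & H1 & H2 & E) (p' & H1' & H2' & E').
  exists (fun w => p w + p' w); repeat split;
    [apply (contC_plus CU); auto|rewrite H2, H2'; auto|].
  generalize (filter_and _ _ E E'); apply filter_imp. intros w [K K'].
  replace (f w + g w - (f z + g z)) with (f w - f z + (g w - g z)) by cring.
  rewrite K, K'; cring.
Qed.

Lemma cderiv_mult (f g : C -> C) (z l m : C) :
  cderiv f z l -> cderiv g z m ->
  cderiv (fun w => f w * g w) z (l * g z + f z * m).
Proof.
  intros F (p' & H1' & H2' & E').
  assert (G : cderiv g z m) by (exists p'; auto).
  destruct F as (p & H1 & H2 & E).
  exists (fun w => p w * g w + f z * p' w); repeat split.
  - apply (contC_plus CU); apply (contC_mult CU); auto.
    + apply (cderiv_continuous g z m G).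
    + apply (contC_const CU).
  - rewrite H2, H2'; auto.
  - generalize (filter_and _ _ E E'); apply filter_imp. intros w [K K'].
    replace (f w * g w - f z * g z) with ((f w - f z) * g w + f z * (g w - g z)) by cring.
    rewrite K, K'; cring.
Qed.

Lemma cderiv_scal (a : C) (f : C -> C) (z l : C) :
  cderiv f z l -> cderiv (fun w => a * f w) z (a * l).
Proof.
  intros H. generalize (cderiv_mult _ _ _ _ _ (cderiv_const a z) H).
  apply cderiv_eq; cring.
Qed.

Lemma cderiv_opp (f : C -> C) (z l : C) :
  cderiv f z l -> cderiv (fun w => - f w) z (- l).
Proof.
  intros H. apply (cderiv_ext (fun w => - (1) * f w)); [intros; cring|].
  generalize (cderiv_scal (-(1)) _ _ _ H). apply cderiv_eq; cring.
Qed.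

Lemma cderiv_minus (f g : C -> C) (z l m : C) :
  cderiv f z l -> cderiv g z m -> cderiv (fun w => f w - g w) z (l - m).
Proof. intros; apply cderiv_plus; [|apply cderiv_opp]; auto. Qed.

Lemma cderiv_comp (f g : C -> C) (z l m : C) :
  cderiv f (g z) l -> cderiv g z m -> cderiv (fun w => f (g w)) z (l * m).
Proof.
  intros (p & H1 & H2 & E) G. pose proof (cderiv_continuous _ _ _ G) as CG.
  destruct G as (p' & H1' & H2' & E').
  exists (fun w => p (g w) * p' w); repeat split.
  - apply (contC_mult CU); auto.
    apply (continuous_comp (U := CU) (V := CU) (W := CU) g p); auto.
  - rewrite H2, H2'; auto.
  - assert (E0 : locally (T := CU) z (fun w => f (g w) - f (g z) = p (g w) * (g w - g z)))
      by exact (CG _ E).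
    generalize (filter_and _ _ E0 E'); apply filter_imp. intros w [K K'].
    rewrite K, K'; cring.
Qed.

Lemma cderiv_inv (f : C -> C) (z l : C) :
  cderiv f z l -> f z <> 0 -> cderiv (fun w => / f w) z (- l / (f z * f z)).
Proof.
  intros F H0. pose proof (cderiv_continuous _ _ _ F) as CF.
  destruct F as (p & H1 & H2 & E).
  assert (NZ : locally (T := CU) z (fun w => f w <> 0)).
  { apply Cmod_gt_0 in H0. rewrite contC_eps in CF.
    generalize (CF (mkposreal _ H0)). apply filter_imp. simpl.
    intros w Hw Habs. rewrite Habs in Hw. replace (0 - f z) with (- f z) in Hw by cring.
    rewrite Cmod_opp in Hw. lra. }
  exists (fun w => - p w * / (f w * f z)); repeat split.
  - apply (contC_mult CU); [apply (contC_opp CU); auto|].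
    apply (contC_inv CU (fun w => f w * f z)); [|apply Cmult_neq_0; auto].
    apply (contC_mult CU); [auto|apply (contC_const CU)].
  - rewrite H2; auto.
  - generalize (filter_and _ _ NZ E); apply filter_imp. intros w [K1 K2].
    replace (/ f w - / f z) with (- (f w - f z) / (f w * f z)) by (cfield; auto).
    rewrite K2; cfield; auto.
Qed.

Lemma cderiv_pow (f : C -> C) (z l : C) :
  cderiv f z l -> cderiv (fun w => f w * f w) z (2 * f z * l).
Proof.
  intros H. generalize (cderiv_mult _ _ _ _ _ H H). apply cderiv_eq; cring.
Qed.

Lemma cderiv_eps (f : C -> C) (z l : C) :
  cderiv f z l -> forall eps : posreal, exists d : posreal, forall w : C,
    (Cmod (w - z) < d)%R -> (Cmod (f w - f z - l * (w - z)) <= eps * Cmod (w - z))%R.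
Proof.
  intros (p & H1 & H2 & E) eps. rewrite contC_eps in H1.
  destruct (filter_and _ _ (H1 eps) E) as [d Hd]. exists d. intros w Hw.
  destruct (Hd w Hw) as [K1 K2]. rewrite K2, <- H2.
  replace (p w * (w - z) - p z * (w - z)) with ((p w - p z) * (w - z)) by cring.
  rewrite Cmod_mult. apply Rmult_le_compat_r; [apply Cmod_ge_0|lra].
Qed.

Lemma eps_cderiv (f : C -> C) (z l : C) :
  (forall eps : posreal, exists d : posreal, forall w : C,
    (Cmod (w - z) < d)%R -> (Cmod (f w - f z - l * (w - z)) <= eps * Cmod (w - z))%R) ->
  cderiv f z l.
Proof.
  (* The Caratheodory slope is the difference quotient, completed by [l] at [z] itself. *)
  intros H. exists (fun w => if Ceq_dec w z then l else (f w - f z) / (w - z)).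
  repeat split.
  - apply contC_eps. intros eps. destruct (Ceq_dec z z) as [_|]; [|congruence].
    assert (He : (0 < eps / 2)%R) by (destruct eps; simpl; lra).
    destruct (H (mkposreal _ He)) as [d Hd]. exists d. intros w Hw.
    destruct (Ceq_dec w z) as [Ew|Nw].
    + replace (l - l) with (RtoC 0) by cring. rewrite Cmod_0. apply cond_pos.
    + assert (N : w - z <> 0) by (apply Cminus_eq_contra; auto).
      replace ((f w - f z) / (w - z) - l) with ((f w - f z - l * (w - z)) / (w - z))
        by (cfield; auto).
      rewrite Cmod_div by auto. apply Cmod_gt_0 in N.
      apply (Rmult_lt_reg_r (Cmod (w - z))); [auto|].
      unfold Rdiv. rewrite Rmult_assoc, Rinv_l, Rmult_1_r by lra.
      specialize (Hd w Hw). simpl in Hd.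
      assert (0 < eps * Cmod (w - z))%R
        by (apply Rmult_lt_0_compat; [apply cond_pos|auto]).
      lra.
  - destruct (Ceq_dec z z); congruence.
  - apply filter_forall. intros w. destruct (Ceq_dec w z) as [->|Nw]; [cring|].
    cfield. apply Cminus_eq_contra; auto.
Qed.

(** Bridge to the filter-based derivative in which [Dirichlet_continuation] is phrased. *)
Lemma is_derive_cderiv (f : C -> C) (z l : C) :
  @is_derive C_AbsRing C_NormedModule f z l <-> cderiv f z l.
Proof.
  split.
  - intros [_ H]. apply eps_cderiv. intros eps.
    destruct (H z (fun P HP => HP) eps) as [d Hd].
    exists d. intros w Hw. specialize (Hd w Hw).
    change (Cmod (f w + - f z + - ((w + - z) * l)) <= eps * Cmod (w + - z))%R in Hd.
    replace (f w - f z - l * (w - z)) with (f w + - f z + - ((w + - z) * l)) by cring.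
    exact Hd.
  - intros H. split; [apply is_linear_scal_l|].
    intros x Hx.
    assert (x = z) as ->.
    { symmetry. apply (is_filter_lim_locally_unique (K := C_AbsRing) (V := AbsRing_NormedModule C_AbsRing)). exact Hx. }
    intros eps. destruct (cderiv_eps _ _ _ H eps) as [d Hd].
    exists d. intros w Hw. specialize (Hd w Hw).
    change (Cmod (f w + - f z + - ((w + - z) * l)) <= eps * Cmod (w + - z))%R.
    replace (f w + - f z + - ((w + - z) * l)) with (f w - f z - l * (w - z)) by cring.
    exact Hd.
Qed.

(** * Integrals of complex functions of a real variable *)

Lemma ex_derive_cont (f : R -> R) (x : R) : ex_derive f x -> continuous f x.
Proof. apply (ex_derive_continuous (V := R_NormedModule)). Qed.

Definition ex_CInt (f : R -> C) (a b : R) : Prop :=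
  ex_RInt (fun t => Re (f t)) a b /\ ex_RInt (fun t => Im (f t)) a b.

Definition CInt (f : R -> C) (a b : R) : C :=
  (RInt (fun t => Re (f t)) a b, RInt (fun t => Im (f t)) a b).

Lemma ex_CInt_continuous (f : R -> C) (a b : R) :
  (a <= b)%R -> (forall t, (a <= t <= b)%R -> contC f t) -> ex_CInt f a b.
Proof.
  intros Hab H.
  split; apply (ex_RInt_continuous (V := R_CompleteNormedModule)); intros t Ht;
    rewrite Rmin_left, Rmax_right in Ht by auto;
    [apply contC_re|apply contC_im]; auto.
Qed.

Lemma ex_CInt_plus (f g : R -> C) (a b : R) :
  ex_CInt f a b -> ex_CInt g a b -> ex_CInt (fun t => f t + g t) a b.
Proof.
  intros [F1 F2] [G1 G2].
  split; [apply (ex_RInt_plus (V := R_NormedModule)) with (1 := F1) (2 := G1)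
         |apply (ex_RInt_plus (V := R_NormedModule)) with (1 := F2) (2 := G2)].
Qed.

Lemma CInt_plus (f g : R -> C) (a b : R) :
  ex_CInt f a b -> ex_CInt g a b ->
  CInt (fun t => f t + g t) a b = CInt f a b + CInt g a b.
Proof.
  intros [F1 F2] [G1 G2]. unfold CInt, Cplus; simpl. f_equal.
  - apply (RInt_plus (V := R_CompleteNormedModule) _ _ _ _ F1 G1).
  - apply (RInt_plus (V := R_CompleteNormedModule) _ _ _ _ F2 G2).
Qed.

Lemma ex_CInt_ext (f g : R -> C) (a b : R) :
  (a <= b)%R -> (forall t, (a < t < b)%R -> f t = g t) -> ex_CInt f a b -> ex_CInt g a b.
Proof.
  intros Hab H [F1 F2].
  split; [apply ex_RInt_ext with (2 := F1)|apply ex_RInt_ext with (2 := F2)];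
    intros t Ht; rewrite Rmin_left, Rmax_right in Ht by auto; rewrite H; auto.
Qed.

Lemma CInt_ext (f g : R -> C) (a b : R) :
  (a <= b)%R -> (forall t, (a < t < b)%R -> f t = g t) -> CInt f a b = CInt g a b.
Proof.
  intros Hab H. unfold CInt. f_equal; apply RInt_ext; intros t Ht;
    rewrite Rmin_left, Rmax_right in Ht by auto; rewrite H; auto.
Qed.

Lemma ex_CInt_scal (k : C) (f : R -> C) (a b : R) :
  ex_CInt f a b -> ex_CInt (fun t => k * f t) a b.
Proof.
  intros [F1 F2]. split.
  - apply (ex_RInt_ext (fun t => minus (scal (Re k) (Re (f t))) (scal (Im k) (Im (f t))))).
    + intros t _. rewrite re_mult. reflexivity.
    + apply (ex_RInt_minus (V := R_NormedModule)); apply (ex_RInt_scal (V := R_NormedModule)); auto.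
  - apply (ex_RInt_ext (fun t => plus (scal (Re k) (Im (f t))) (scal (Im k) (Re (f t))))).
    + intros t _. rewrite im_mult. reflexivity.
    + apply (ex_RInt_plus (V := R_NormedModule)); apply (ex_RInt_scal (V := R_NormedModule)); auto.
Qed.

Lemma CInt_scal (k : C) (f : R -> C) (a b : R) :
  ex_CInt f a b -> CInt (fun t => k * f t) a b = k * CInt f a b.
Proof.
  intros [F1 F2]. unfold CInt, Cmult; simpl. fold (Re k) (Im k). f_equal.
  - rewrite (RInt_minus (V := R_CompleteNormedModule)
      (fun t => scal (Re k) (Re (f t))) (fun t => scal (Im k) (Im (f t))))
      by (apply (ex_RInt_scal (V := R_NormedModule)); auto).
    rewrite !(RInt_scal (V := R_CompleteNormedModule)) by auto. reflexivity.
  - rewrite (RInt_plus (V := R_CompleteNormedModule)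
      (fun t => scal (Re k) (Im (f t))) (fun t => scal (Im k) (Re (f t))))
      by (apply (ex_RInt_scal (V := R_NormedModule)); auto).
    rewrite !(RInt_scal (V := R_CompleteNormedModule)) by auto. reflexivity.
Qed.

Lemma ex_CInt_minus (f g : R -> C) (a b : R) :
  (a <= b)%R ->
  ex_CInt f a b -> ex_CInt g a b -> ex_CInt (fun t => f t - g t) a b.
Proof.
  intros Hab F G. apply (ex_CInt_ext (fun t => f t + - (1) * g t)); auto.
  - intros; ring.
  - apply ex_CInt_plus; [|apply ex_CInt_scal]; auto.
Qed.

Lemma CInt_minus (f g : R -> C) (a b : R) :
  (a <= b)%R -> ex_CInt f a b -> ex_CInt g a b ->
  CInt (fun t => f t - g t) a b = CInt f a b - CInt g a b.
Proof.
  intros Hab F G.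
  rewrite (CInt_ext _ (fun t => f t + - (1) * g t)) by (auto; intros; ring).
  rewrite CInt_plus, CInt_scal by (auto; apply ex_CInt_scal; auto). ring.
Qed.

Lemma ex_CInt_const (k : C) (a b : R) : ex_CInt (fun _ => k) a b.
Proof. split; apply (ex_RInt_const (V := R_NormedModule)). Qed.

Lemma CInt_const (k : C) (a b : R) : CInt (fun _ => k) a b = RtoC (b - a) * k.
Proof.
  unfold CInt. rewrite !(RInt_const (V := R_CompleteNormedModule)).
  destruct k as [k1 k2]; unfold RtoC, Cmult, scal; simpl. unfold mult; simpl. f_equal; ring.
Qed.

Lemma CInt_Chasles (f : R -> C) (a b c : R) :
  ex_CInt f a b -> ex_CInt f b c -> CInt f a b + CInt f b c = CInt f a c.
Proof.
  intros [F1 F2] [G1 G2]. unfold CInt, Cplus; simpl. f_equal.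
  - apply (RInt_Chasles (V := R_CompleteNormedModule) _ _ _ _ F1 G1).
  - apply (RInt_Chasles (V := R_CompleteNormedModule) _ _ _ _ F2 G2).
Qed.

(** Real and imaginary parts are integrated and bounded separately, whence the factor 2 instead of
    1; it reappears in most explicit constants below. *)
Lemma Cmod_CInt_le (f : R -> C) (g : R -> R) (a b : R) :
  (a <= b)%R -> ex_CInt f a b -> ex_RInt g a b ->
  (forall t, (a < t < b)%R -> (Cmod (f t) <= g t)%R) ->
  (Cmod (CInt f a b) <= 2 * RInt g a b)%R.
Proof.
  intros Hab [F1 F2] G H.
  assert (K1 : (Rabs (Re (CInt f a b)) <= RInt g a b)%R).
  { eapply Rle_trans; [apply (abs_RInt_le (fun t => Re (f t))); auto|].
    apply RInt_le; auto; [apply (ex_RInt_norm _ _ _ F1)|].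
    intros t Ht. eapply Rle_trans; [apply re_le_Cmod|auto]. }
  assert (K2 : (Rabs (Im (CInt f a b)) <= RInt g a b)%R).
  { eapply Rle_trans; [apply (abs_RInt_le (fun t => Im (f t))); auto|].
    apply RInt_le; auto; [apply (ex_RInt_norm _ _ _ F2)|].
    intros t Ht. eapply Rle_trans; [apply im_le_Cmod|auto]. }
  pose proof (Cmod_le_re_im (CInt f a b)). lra.
Qed.

Lemma Cmod_CInt_le_const (f : R -> C) (M a b : R) :
  (a <= b)%R -> ex_CInt f a b ->
  (forall t, (a < t < b)%R -> (Cmod (f t) <= M)%R) ->
  (Cmod (CInt f a b) <= 2 * M * (b - a))%R.
Proof.
  intros Hab F H.
  eapply Rle_trans; [apply (Cmod_CInt_le f (fun _ => M)); auto; apply (ex_RInt_const (V := R_NormedModule))|].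
  rewrite (RInt_const (V := R_CompleteNormedModule)).
  unfold scal; simpl; unfold mult; simpl. lra.
Qed.

Lemma CInt_derive (f : R -> C) (f' : R -> C) (a b : R) :
  (a <= b)%R ->
  (forall t, (a <= t <= b)%R -> is_derive (fun u => Re (f u)) t (Re (f' t))) ->
  (forall t, (a <= t <= b)%R -> is_derive (fun u => Im (f u)) t (Im (f' t))) ->
  (forall t, (a <= t <= b)%R -> contC f' t) ->
  CInt f' a b = f b - f a.
Proof.
  intros Hab H1 H2 H3. unfold CInt.
  assert (E1 : RInt (fun t => Re (f' t)) a b = minus (Re (f b)) (Re (f a))).
  { apply is_RInt_unique, (is_RInt_derive (fun u => Re (f u))).
    - intros t Ht. rewrite Rmin_left, Rmax_right in Ht by auto. auto.
    - intros t Ht. rewrite Rmin_left, Rmax_right in Ht by auto. apply contC_re; auto. }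
  assert (E2 : RInt (fun t => Im (f' t)) a b = minus (Im (f b)) (Im (f a))).
  { apply is_RInt_unique, (is_RInt_derive (fun u => Im (f u))).
    - intros t Ht. rewrite Rmin_left, Rmax_right in Ht by auto. auto.
    - intros t Ht. rewrite Rmin_left, Rmax_right in Ht by auto. apply contC_im; auto. }
  rewrite E1, E2. reflexivity.
Qed.

Lemma CInt_affine (k l : C) (a b : R) : (a <= b)%R ->
  CInt (fun t => k + RtoC t * l) a b = RtoC (b - a) * k + RtoC ((b ^ 2 - a ^ 2) / 2) * l.
Proof.
  intros Hab. rewrite (CInt_derive (fun t => RtoC t * k + RtoC (t ^ 2 / 2) * l)); auto;
    try (intros t _; destruct k as [k1 k2], l as [l1 l2]; simpl; auto_derive; auto; field).
  - unfold Rdiv. rewrite !RtoC_mult, !RtoC_minus. ring.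
  - intros t _. apply contC_plus; [apply contC_const|]. apply contC_mult; [|apply contC_const].
    apply contC_pair; simpl; [apply continuous_id|apply continuous_const].
Qed.

(** * The complex exponential and its Taylor remainders *)

Lemma Cexp_0 : Cexp 0 = 1.
Proof. unfold Cexp; simpl. rewrite exp_0, cos_0, sin_0. unfold RtoC; f_equal; ring. Qed.

Lemma Cexp_plus (z w : C) : Cexp (z + w) = Cexp z * Cexp w.
Proof.
  unfold Cexp, Cmult; simpl. fold (Re z) (Im z) (Re w) (Im w).
  rewrite exp_plus, cos_plus, sin_plus. f_equal; ring.
Qed.

Lemma Cmod_pair (a b : R) : Cmod (a, b) = sqrt (a ^ 2 + b ^ 2).
Proof. reflexivity. Qed.

Lemma Cmod_Cexp (z : C) : Cmod (Cexp z) = exp (Re z).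
Proof.
  unfold Cexp. rewrite Cmod_pair.
  replace ((exp (Re z) * cos (Im z)) ^ 2 + (exp (Re z) * sin (Im z)) ^ 2)%R
    with (exp (Re z) ^ 2)%R.
  - apply sqrt_pow2, Rlt_le, exp_pos.
  - generalize (sin2_cos2 (Im z)). unfold Rsqr. intros H.
    transitivity (exp (Re z) ^ 2 * (sin (Im z) * sin (Im z) + cos (Im z) * cos (Im z)))%R;
      [rewrite H; ring|ring].
Qed.

Lemma Cexp_neq_0 (z : C) : Cexp z <> 0.
Proof. apply Cmod_gt_0. rewrite Cmod_Cexp. apply exp_pos. Qed.

Lemma Cexp_opp (z : C) : Cexp (- z) = / Cexp z.
Proof.
  assert (H : Cexp z * Cexp (- z) = 1).
  { rewrite <- Cexp_plus. replace (z + - z) with (RtoC 0) by ring. apply Cexp_0. }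
  pose proof (Cexp_neq_0 z).
  transitivity (/ Cexp z * (Cexp z * Cexp (- z))); [field; auto|rewrite H; ring].
Qed.

Lemma Cexp_Ci (t : R) : Cexp (RtoC t * Ci) = (cos t, sin t).
Proof.
  unfold Cexp. replace (RtoC t * Ci) with (0, t)%R
    by (unfold RtoC, Ci, Cmult; simpl; f_equal; ring).
  simpl. rewrite exp_0. f_equal; ring.
Qed.

Lemma Cexp_INR_mult (n : nat) (z : C) : Cexp (RtoC (INR n) * z) = (Cexp z ^ n)%C.
Proof.
  induction n as [|n IH].
  - simpl. replace (RtoC 0 * z) with (RtoC 0) by ring. apply Cexp_0.
  - rewrite S_INR, RtoC_plus. replace ((RtoC (INR n) + 1) * z) with (z + RtoC (INR n) * z) by ring.
    rewrite Cexp_plus, IH, Cpow_S. reflexivity.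
Qed.

(** The exponential minus its first [n] Taylor terms. Peeling off one term at a time makes
    differentiation along a ray lower the index by one, which drives both the estimate and the
    differentiability of [Cexp]. *)
Fixpoint exp_rem (n : nat) (z : C) : C :=
  match n with
  | O => Cexp z
  | S m => exp_rem m z - z ^ m / RtoC (INR (fact m))
  end.

Lemma RtoC_fact_neq_0 (n : nat) : RtoC (INR (fact n)) <> 0.
Proof. intros H. apply RtoC_inj in H. apply (INR_fact_neq_0 n H). Qed.

Lemma exp_rem_0 (n : nat) : exp_rem (S n) 0 = 0.
Proof.
  induction n as [|n IH].
  - simpl. rewrite Cexp_0. field; apply C1_nz.
  - change (exp_rem (S (S n)) 0) with (exp_rem (S n) 0 - 0 ^ (S n) / RtoC (INR (fact (S n)))).
    rewrite IH, Cpow_S. field. apply RtoC_fact_neq_0.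
Qed.

Definition is_derive_C (f : R -> C) (t : R) (l : C) : Prop :=
  is_derive (fun u => Re (f u)) t (Re l) /\ is_derive (fun u => Im (f u)) t (Im l).

Lemma is_derive_C_minus_scal (f : R -> C) (g : R -> R) (t g' : R) (l k : C) :
  is_derive_C f t l -> is_derive g t g' ->
  is_derive_C (fun u => f u - RtoC (g u) * k) t (l - RtoC g' * k).
Proof.
  intros [F1 F2] G. unfold Cminus. split.
  - apply (is_derive_ext (fun u => Re (f u) - g u * Re k)%R).
    + intros u. rewrite re_plus, re_opp, re_scal_l. reflexivity.
    + rewrite re_plus, re_opp, re_scal_l. apply (is_derive_minus (V := R_NormedModule)); auto.
      apply (is_derive_scal_l (V := R_NormedModule) g), G.
  - apply (is_derive_ext (fun u => Im (f u) - g u * Im k)%R).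
    + intros u. rewrite im_plus, im_opp, im_scal_l. reflexivity.
    + rewrite im_plus, im_opp, im_scal_l. apply (is_derive_minus (V := R_NormedModule)); auto.
      apply (is_derive_scal_l (V := R_NormedModule) g), G.
Qed.

Lemma is_derive_C_ext (f g : R -> C) (t : R) (l : C) :
  (forall u, f u = g u) -> is_derive_C f t l -> is_derive_C g t l.
Proof.
  intros H [F1 F2]. split; [apply is_derive_ext with (2 := F1)|apply is_derive_ext with (2 := F2)];
    intros u; rewrite H; auto.
Qed.

Lemma is_derive_pow_nat (n : nat) (t : R) : is_derive (fun u => u ^ S n)%R t (INR (S n) * t ^ n)%R.
Proof.
  replace (INR (S n) * t ^ n)%R with (INR (S n) * 1 * t ^ pred (S n))%R by (simpl pred; ring).
  apply (is_derive_pow (fun u : R => u)). apply (is_derive_id (K := R_AbsRing)).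
Qed.

Lemma is_derive_exp_rem (n : nat) (z : C) (t : R) :
  is_derive_C (fun u : R => exp_rem (S n) (RtoC u * z)) t (z * exp_rem n (RtoC t * z)).
Proof.
  assert (B : is_derive_C (fun u : R => Cexp (RtoC u * z)) t (z * Cexp (RtoC t * z))).
  { assert (F : forall u, RtoC u * z = ((u * Re z)%R, (u * Im z)%R))
      by (intros u; destruct z; unfold RtoC, Cmult; simpl; f_equal; ring).
    unfold is_derive_C. rewrite re_mult, im_mult, (F t). split.
    - apply (is_derive_ext (fun u => exp (u * Re z) * cos (u * Im z))%R).
      + intros u. rewrite (F u). reflexivity.
      + unfold Cexp; simpl. auto_derive; auto. ring.
    - apply (is_derive_ext (fun u => exp (u * Re z) * sin (u * Im z))%R).
      + intros u. rewrite (F u). reflexivity.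
      + unfold Cexp; simpl. auto_derive; auto. ring. }
  (* Each monomial is split into a real power of [u] and a constant, the form that
     [is_derive_C_minus_scal] differentiates. *)
  assert (M : forall m (u : R), (RtoC u * z) ^ m / RtoC (INR (fact m)) = RtoC (u ^ m) * (z ^ m / RtoC (INR (fact m)))).
  { intros m u. rewrite Cpow_mult_l, RtoC_pow. field. apply RtoC_fact_neq_0. }
  induction n as [|n IH].
  - replace (z * exp_rem 0 (RtoC t * z)) with (z * Cexp (RtoC t * z) - RtoC 0 * 1) by (simpl; ring).
    apply (is_derive_C_ext (fun u => Cexp (RtoC u * z) - RtoC 1 * 1)).
    + intros u. simpl. field.
    + apply (is_derive_C_minus_scal _ (fun _ => 1%R)); auto. apply (is_derive_const (V := R_NormedModule)).
  - apply (is_derive_C_ext (fun u => exp_rem (S n) (RtoC u * z)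
      - RtoC (u ^ S n) * (z ^ (S n) / RtoC (INR (fact (S n)))))).
    + intros u. rewrite <- M. reflexivity.
    + replace (z * exp_rem (S n) (RtoC t * z)) with (z * exp_rem n (RtoC t * z)
        - RtoC (INR (S n) * t ^ n) * (z ^ (S n) / RtoC (INR (fact (S n))))).
      * apply (is_derive_C_minus_scal _ (fun u => u ^ S n)%R); auto using is_derive_pow_nat.
      * simpl exp_rem. rewrite M, Cpow_S, fact_simpl, mult_INR, !RtoC_mult. field.
        split; [apply RtoC_fact_neq_0|]. intro H; apply RtoC_inj in H. revert H; apply not_0_INR; lia.
Qed.

Lemma continuous_exp_rem (n : nat) (z : C) (t : R) : contC (fun u : R => exp_rem n (RtoC u * z)) t.
Proof.
  destruct n as [|n].
  - apply contC_pair; simpl; apply ex_derive_cont;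
    destruct z as [x y]; unfold Cexp, RtoC, Cmult, Re, Im; simpl; auto_derive; auto.
  - destruct (is_derive_exp_rem n z t) as [D1 D2].
    apply contC_pair; apply ex_derive_cont; eexists; eassumption.
Qed.

(** Integrate [is_derive_exp_rem] repeatedly along the ray from 0 to [z]. Every integration costs
    the factor 2 of [Cmod_CInt_le], hence [2 * Cmod z] in place of [Cmod z]; the factorial still
    wins. *)
Lemma Cmod_exp_rem_le (n : nat) (z : C) :
  (Cmod (exp_rem n z) <= (2 * Cmod z) ^ n / INR (fact n) * exp (Cmod z))%R.
Proof.
  assert (G : forall n (t : R), (0 <= t <= 1)%R ->
    (Cmod (exp_rem n (RtoC t * z)) <= (2 * Cmod z) ^ n * t ^ n / INR (fact n) * exp (Cmod z))%R).
  { clear n. induction n as [|n IH]; intros t Ht.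
    - simpl. rewrite Cmod_Cexp. unfold Rdiv; rewrite Rinv_1, !Rmult_1_l.
      assert (Re (RtoC t * z) <= Cmod z)%R.
      { rewrite re_scal_l. pose proof (re_le_Cmod z). pose proof (Rle_abs (Re z)). pose proof (Cmod_ge_0 z). nra. }
      destruct H as [H|H]; [left; apply exp_increasing; auto|rewrite H; lra].
    - assert (E : CInt (fun u => z * exp_rem n (RtoC u * z)) 0 t = exp_rem (S n) (RtoC t * z)).
      { rewrite (CInt_derive (fun u => exp_rem (S n) (RtoC u * z))).
        - replace (RtoC 0 * z) with (RtoC 0) by ring. rewrite exp_rem_0. ring.
        - lra.
        - intros u _. apply is_derive_exp_rem.
        - intros u _. apply is_derive_exp_rem.
        - intros u _. apply contC_mult; [apply contC_const|apply continuous_exp_rem]. }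
      rewrite <- E.
      set (K := (Cmod z * ((2 * Cmod z) ^ n / INR (fact n) * exp (Cmod z)))%R).
      assert (R1 : is_RInt (fun u => K * u ^ n)%R 0 t (minus (K * (t ^ S n / INR (S n))) (K * (0 ^ S n / INR (S n))))%R).
      { apply (is_RInt_derive (fun u => K * (u ^ S n / INR (S n)))%R).
        - intros u _.
          replace (K * u ^ n)%R with (K * ((INR (S n) * u ^ n) * / INR (S n)))%R
            by (field; apply not_0_INR; lia).
          apply (is_derive_scal (fun u => u ^ S n / INR (S n))%R).
          apply (is_derive_scal_l (V := R_NormedModule) (fun u => u ^ S n)%R), is_derive_pow_nat.
        - intros u _. apply ex_derive_cont. auto_derive; auto. }
      eapply Rle_trans.
      { apply (Cmod_CInt_le _ (fun u => K * u ^ n)%R).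
        - lra.
        - apply ex_CInt_continuous; [lra|]. intros u _.
          apply contC_mult; [apply contC_const|apply continuous_exp_rem].
        - eexists; apply R1.
        - intros u Hu. rewrite Cmod_mult. unfold K. rewrite Rmult_assoc.
          apply Rmult_le_compat_l; [apply Cmod_ge_0|].
          eapply Rle_trans; [apply IH; lra|]. right. field. apply INR_fact_neq_0. }
      rewrite (is_RInt_unique _ _ _ _ R1).
      change (2 * (K * (t ^ S n / INR (S n)) - K * (0 ^ S n / INR (S n))) <=
        (2 * Cmod z) ^ S n * t ^ S n / INR (fact (S n)) * exp (Cmod z))%R.
      unfold K. right. rewrite fact_simpl, mult_INR, (pow_ne_zero (S n)) by lia.
      rewrite <- !tech_pow_Rmult. field.
      split; (apply INR_fact_neq_0 || (apply not_0_INR; discriminate)). }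
  specialize (G n 1%R). replace (RtoC 1 * z) with z in G by ring.
  rewrite pow1, Rmult_1_r in G. apply G; lra.
Qed.

(** * Goursat's theorem on rectangles *)

Lemma exp_le (x y : R) : (x <= y)%R -> (exp x <= exp y)%R.
Proof. intros [H| ->]; [left; apply exp_increasing; auto|lra]. Qed.

(** With v = w - z, the error of the linear approximation is [Cexp z * exp_rem 2 v], which is at
    most a constant times |v|^2 for |v| <= 1; the constant is [K] below. *)
Lemma cderiv_Cexp (z : C) : cderiv Cexp z (Cexp z).
Proof.
  apply eps_cderiv. intros eps.
  set (K := (2 * exp (Re z) * exp 1)%R).
  assert (HK : (0 < K)%R).
  { unfold K. pose proof (exp_pos (Re z)). pose proof (exp_pos 1). nra. }
  assert (He : (0 < Rmin 1 (eps / K))%R).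
  { apply Rmin_glb_lt; [lra|]. apply Rdiv_lt_0_compat; [apply cond_pos|auto]. }
  exists (mkposreal _ He). simpl. intros w Hw.
  pose proof (Rmin_l 1 (eps / K)) as L1. pose proof (Rmin_r 1 (eps / K)) as L2.
  set (v := w - z) in *.
  replace (Cexp w - Cexp z - Cexp z * v) with (Cexp z * exp_rem 2 v).
  - rewrite Cmod_mult, Cmod_Cexp.
    pose proof (Cmod_exp_rem_le 2 v) as B. pose proof (Cmod_ge_0 v) as Hv.
    assert (E1 : (exp (Cmod v) <= exp 1)%R) by (apply exp_le; lra).
    assert (E2 : (Cmod v * K <= eps)%R).
    { apply Rlt_le. apply (Rmult_lt_reg_r (/ K)); [apply Rinv_0_lt_compat; auto|].
      rewrite Rmult_assoc, Rinv_r, Rmult_1_r by lra. unfold Rdiv in L2. lra. }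
    simpl in B. replace ((2 * Cmod v * (2 * Cmod v * 1)) / (1 + 1))%R with (2 * Cmod v * Cmod v)%R in B by field.
    pose proof (exp_pos (Re z)) as P1.
    apply Rle_trans with (exp (Re z) * (2 * Cmod v * Cmod v * exp 1))%R.
    + apply Rmult_le_compat_l; [lra|]. eapply Rle_trans; [apply B|].
      apply Rmult_le_compat_l; [nra|auto].
    + unfold K in E2. replace (exp (Re z) * (2 * Cmod v * Cmod v * exp 1))%R
        with (Cmod v * (2 * exp (Re z) * exp 1) * Cmod v)%R by ring.
      apply Rmult_le_compat_r; auto.
  - replace w with (z + v) by (unfold v; ring).
    rewrite Cexp_plus. simpl. field.
Qed.

Lemma continuous_Cexp (z : C) : contCC Cexp z.
Proof. apply (cderiv_continuous _ _ _ (cderiv_Cexp z)). Qed.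

(** The supremum of the left ends works, because every left end lies below every right end. *)
Lemma nested_intervals (x h : nat -> R) :
  (forall n, 0 <= h n)%R -> (forall n, x n <= x (S n))%R ->
  (forall n, x (S n) + h (S n) <= x n + h n)%R ->
  exists X, forall n, (x n <= X <= x n + h n)%R.
Proof.
  intros Hh H1 H2.
  assert (M1 : forall n m, (n <= m)%nat -> (x n <= x m)%R).
  { intros n m Hnm; induction Hnm; [lra|]. specialize (H1 m); lra. }
  assert (M2 : forall n m, (n <= m)%nat -> (x m + h m <= x n + h n)%R).
  { intros n m Hnm; induction Hnm; [lra|]. specialize (H2 m); lra. }
  assert (B : forall n m, (x m <= x n + h n)%R).
  { intros n m. destruct (Nat.le_ge_cases n m) as [L|L].
    - specialize (M2 _ _ L). specialize (Hh m). lra.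
    - specialize (M1 _ _ L). specialize (Hh n). lra. }
  destruct (completeness (fun r => exists n, r = x n)) as [X [U L]].
  - exists (x O + h O)%R. intros r [n ->]. apply B.
  - exists (x O), O; auto.
  - exists X. intros n. split; [apply U; exists n; auto|].
    apply L. intros r [m ->]. apply B.
Qed.

(** If [P] fails on the unit square, it fails on a quarter of it, then on a quarter of that one, and
    so on. The failing squares are nested and shrink to a point, where the local hypothesis
    contradicts the failure. *)
Lemma square_bisection (P : R -> R -> R -> Prop) :
  (forall x y h, (0 <= x -> 0 <= y -> 0 < h -> x + h <= 1 -> y + h <= 1 ->
     P x y (h / 2) -> P (x + h / 2) y (h / 2) -> P x (y + h / 2) (h / 2) ->
     P (x + h / 2) (y + h / 2) (h / 2) -> P x y h)%R) ->
  (forall X Y, (0 <= X <= 1 -> 0 <= Y <= 1 -> exists d, 0 < d /\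
     forall x y h, 0 <= x -> 0 <= y -> 0 < h < d -> x + h <= 1 -> y + h <= 1 ->
       x <= X <= x + h -> y <= Y <= y + h -> P x y h)%R) ->
  P 0%R 0%R 1%R.
Proof.
  intros Hadd Hloc. apply NNPP. intros Hn.
  (* Here [h] is already the halved side. Three quarters are tested and the first failing one is
     taken; if all three pass, the fourth is returned untested, and it must fail since otherwise the
     parent square would satisfy [P]. *)
  set (next := fun (p : R * R) (h : R) =>
    let '(x, y) := p in
    if excluded_middle_informative (P x y h) then
      if excluded_middle_informative (P (x + h)%R y h) then
        if excluded_middle_informative (P x (y + h)%R h) then ((x + h)%R, (y + h)%R)
        else (x, (y + h)%R)
      else ((x + h)%R, y)
    else (x, y)).
  set (p := fix p n := match n with O => (0, 0)%R | S m => next (p m) (/ 2 ^ S m)%R end).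
  assert (Hh : forall n, (/ 2 ^ n > 0)%R) by (intros; apply Rinv_0_lt_compat, pow_lt; lra).
  assert (Hs : forall n, (/ 2 ^ n / 2 = / 2 ^ S n)%R).
  { intros; simpl. field. apply pow_nonzero; lra. }
  assert (Inv : forall n, (0 <= fst (p n) /\ 0 <= snd (p n) /\ fst (p n) + / 2 ^ n <= 1 /\
    snd (p n) + / 2 ^ n <= 1)%R /\ ~ P (fst (p n)) (snd (p n)) (/ 2 ^ n)%R /\
    (fst (p n) <= fst (p (S n)) /\ fst (p (S n)) + / 2 ^ S n <= fst (p n) + / 2 ^ n /\
     snd (p n) <= snd (p (S n)) /\ snd (p (S n)) + / 2 ^ S n <= snd (p n) + / 2 ^ n)%R).
  { assert (St : forall n,  (fst (p n) <= fst (p (S n)) /\ fst (p (S n)) + / 2 ^ S n <= fst (p n) + / 2 ^ n /\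
     snd (p n) <= snd (p (S n)) /\ snd (p (S n)) + / 2 ^ S n <= snd (p n) + / 2 ^ n)%R).
    { intros n. change (p (S n)) with (next (p n) (/ 2 ^ S n)%R).
      rewrite <- !Hs. pose proof (Hh n). destruct (p n) as [x y]; unfold next.
      repeat destruct excluded_middle_informative; simpl; lra. }
    induction n as [|n (I1 & I2 & _)].
    - split; [simpl; lra|split; [|apply St]]. simpl. rewrite Rinv_1. auto.
    - specialize (St n) as S1. split; [lra|split; [|apply St]].
      intros HP. apply I2. clear St S1.
      change (p (S n)) with (next (p n) (/ 2 ^ S n)%R) in HP.
      pose proof (Hh n) as Hn'. rewrite <- Hs in HP.
      destruct (p n) as [x y]; unfold next in HP; simpl fst in *; simpl snd in *.
      repeat destruct excluded_middle_informative; simpl in HP; try contradiction.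
      apply Hadd; try lra; auto. }
  destruct (nested_intervals (fun n => fst (p n)) (fun n => / 2 ^ n)%R) as [X HX];
    try (intros n; specialize (Inv n); specialize (Hh n); lra).
  destruct (nested_intervals (fun n => snd (p n)) (fun n => / 2 ^ n)%R) as [Y HY];
    try (intros n; specialize (Inv n); specialize (Hh n); lra).
  destruct (Hloc X Y) as (d & Hd & K).
  { specialize (HX O); specialize (Inv O); simpl in *; lra. }
  { specialize (HY O); specialize (Inv O); simpl in *; lra. }
  destruct (pow_lt_1_zero (/ 2)) with (y := d) as [N HN]; auto.
  { rewrite Rabs_pos_eq; lra. }
  specialize (HN N (Nat.le_refl N)). rewrite pow_inv, Rabs_pos_eq in HN by (left; apply Hh).
  specialize (Inv N) as (I1 & I2 & _). apply I2. specialize (Hh N).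
  apply K; try lra; auto.
Qed.

Definition rect_int (f : C -> C) (a b c d : R) : C :=
  CInt (fun x => f (x, c)) a b - CInt (fun x => f (x, d)) a b
  + Ci * (CInt (fun y => f (b, y)) c d - CInt (fun y => f (a, y)) c d).

Definition cont_rect (f : C -> C) (a b c d : R) : Prop :=
  forall x y, (a <= x <= b)%R -> (c <= y <= d)%R -> contCC f (x, y).

Lemma contC_horizontal (f : C -> C) (x y : R) :
  contCC f (x, y) -> contC (fun t : R => f (t, y)) x.
Proof.
  intros H. apply (continuous_comp (V := CU) (W := CU) (fun t : R => (t, y)) f); auto.
  apply contC_pair; simpl; [apply continuous_id|apply continuous_const].
Qed.

Lemma contC_vertical (f : C -> C) (x y : R) :
  contCC f (x, y) -> contC (fun t : R => f (x, t)) y.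
Proof.
  intros H. apply (continuous_comp (V := CU) (W := CU) (fun t : R => (x, t)) f); auto.
  apply contC_pair; simpl; [apply continuous_const|apply continuous_id].
Qed.

(** Continuity is asked on the sides only, because the strip integrand is singular inside its
    rectangle. *)
Definition cont_boundary (f : C -> C) (a b c d : R) : Prop :=
  forall x y, (a <= x <= b)%R -> (c <= y <= d)%R -> (x = a \/ x = b \/ y = c \/ y = d) ->
  contCC f (x, y).

Lemma cont_rect_boundary (f : C -> C) (a b c d : R) :
  cont_rect f a b c d -> cont_boundary f a b c d.
Proof. intros H x y Hx Hy _. apply H; auto. Qed.

Lemma ex_CInt_horizontal (f : C -> C) (a b c d y u v : R) :
  cont_boundary f a b c d -> (c <= d)%R -> (y = c \/ y = d) ->
  (a <= u)%R -> (u <= v)%R -> (v <= b)%R -> ex_CInt (fun x => f (x, y)) u v.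
Proof.
  intros H Hcd Hy ? ? ?. apply ex_CInt_continuous; auto. intros t Ht.
  apply contC_horizontal. apply H; [lra|destruct Hy; lra|tauto].
Qed.

Lemma ex_CInt_vertical (f : C -> C) (a b c d x u v : R) :
  cont_boundary f a b c d -> (a <= b)%R -> (x = a \/ x = b) ->
  (c <= u)%R -> (u <= v)%R -> (v <= d)%R -> ex_CInt (fun y => f (x, y)) u v.
Proof.
  intros H Hab Hx ? ? ?. apply ex_CInt_continuous; auto. intros t Ht.
  apply contC_vertical. apply H; [destruct Hx; lra|lra|tauto].
Qed.

(** The common side of the two pieces cancels algebraically, so nothing is asked of [f] there; only
    the two outer sides that are cut in two have to be integrable. *)
Lemma rect_int_split_h (f : C -> C) (a m b c d : R) :
  cont_boundary f a b c d -> (a <= m <= b)%R -> (c <= d)%R ->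
  rect_int f a b c d = rect_int f a m c d + rect_int f m b c d.
Proof.
  intros H Hm Hcd. unfold rect_int.
  rewrite <- (CInt_Chasles (fun x => f (x, c)) a m b) by
    (apply (ex_CInt_horizontal f a b c d); auto; lra).
  rewrite <- (CInt_Chasles (fun x => f (x, d)) a m b) by
    (apply (ex_CInt_horizontal f a b c d); auto; lra).
  ring.
Qed.

Lemma rect_int_split_v (f : C -> C) (a b c m d : R) :
  cont_boundary f a b c d -> (c <= m <= d)%R -> (a <= b)%R ->
  rect_int f a b c d = rect_int f a b c m + rect_int f a b m d.
Proof.
  intros H Hm Hcd. unfold rect_int.
  rewrite <- (CInt_Chasles (fun y => f (a, y)) c m d) by
    (apply (ex_CInt_vertical f a b c d); auto; lra).
  rewrite <- (CInt_Chasles (fun y => f (b, y)) c m d) by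
    (apply (ex_CInt_vertical f a b c d); auto; lra).
  ring.
Qed.

Lemma cont_rect_sub (f : C -> C) (a b c d a' b' c' d' : R) :
  cont_rect f a b c d -> (a <= a' -> b' <= b -> c <= c' -> d' <= d -> cont_rect f a' b' c' d')%R.
Proof. intros H ? ? ? ? x y Hx Hy. apply H; lra. Qed.

Lemma rect_int_minus (f g : C -> C) (a b c d : R) :
  (a <= b)%R -> (c <= d)%R -> cont_boundary f a b c d -> cont_boundary g a b c d ->
  rect_int (fun z => f z - g z) a b c d = rect_int f a b c d - rect_int g a b c d.
Proof.
  intros Hab Hcd F G. unfold rect_int.
  assert (EH : forall k y, cont_boundary k a b c d -> (y = c \/ y = d) -> ex_CInt (fun x => k (x, y)) a b)
    by (intros k y K Hy; apply (ex_CInt_horizontal k a b c d); auto; lra).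
  assert (EV : forall k x, cont_boundary k a b c d -> (x = a \/ x = b) -> ex_CInt (fun y => k (x, y)) c d)
    by (intros k x K Hx; apply (ex_CInt_vertical k a b c d); auto; lra).
  rewrite (CInt_minus (fun x => f (x, c)) (fun x => g (x, c))) by (try apply EH; auto).
  rewrite (CInt_minus (fun x => f (x, d)) (fun x => g (x, d))) by (try apply EH; auto).
  rewrite (CInt_minus (fun y => f (b, y)) (fun y => g (b, y))) by (try apply EV; auto).
  rewrite (CInt_minus (fun y => f (a, y)) (fun y => g (a, y))) by (try apply EV; auto).
  ring.
Qed.

Lemma Cmod_rect_int_le (f : C -> C) (M a b c d : R) :
  (a <= b)%R -> (c <= d)%R -> cont_boundary f a b c d ->
  (forall x y, (a <= x <= b)%R -> (c <= y <= d)%R -> (x = a \/ x = b \/ y = c \/ y = d) ->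
    (Cmod (f (x, y)) <= M)%R) ->
  (Cmod (rect_int f a b c d) <= 4 * M * ((b - a) + (d - c)))%R.
Proof.
  intros Hab Hcd F H. unfold rect_int.
  pose proof (Cmod_CInt_le_const (fun x => f (x, c)) M a b Hab) as K1.
  pose proof (Cmod_CInt_le_const (fun x => f (x, d)) M a b Hab) as K2.
  pose proof (Cmod_CInt_le_const (fun y => f (a, y)) M c d Hcd) as K3.
  pose proof (Cmod_CInt_le_const (fun y => f (b, y)) M c d Hcd) as K4.
  assert (E1 : ex_CInt (fun x => f (x, c)) a b) by (apply (ex_CInt_horizontal _ a b c d); auto; lra).
  assert (E2 : ex_CInt (fun x => f (x, d)) a b) by (apply (ex_CInt_horizontal _ a b c d); auto; lra).
  assert (E3 : ex_CInt (fun y => f (a, y)) c d) by (apply (ex_CInt_vertical _ a b c d); auto; lra).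
  assert (E4 : ex_CInt (fun y => f (b, y)) c d) by (apply (ex_CInt_vertical _ a b c d); auto; lra).
  specialize (K1 E1 ltac:(intros; apply H; auto; lra)).
  specialize (K2 E2 ltac:(intros; apply H; auto; lra)).
  specialize (K3 E3 ltac:(intros; apply H; auto; lra)).
  specialize (K4 E4 ltac:(intros; apply H; auto; lra)).
  eapply Rle_trans; [apply Cmod_triangle|]. rewrite Cmod_mult, Cmod_Ci.
  pose proof (Cmod_triangle_minus (CInt (fun x : R => f (x, c)) a b) (CInt (fun x : R => f (x, d)) a b)).
  pose proof (Cmod_triangle_minus (CInt (fun x : R => f (b, x)) c d) (CInt (fun x : R => f (a, x)) c d)).
  lra.
Qed.

Lemma continuous_affine (k l z : C) : contCC (fun w => k + l * w) z.
Proof.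
  apply (contC_plus CU); [apply (contC_const CU)|].
  apply (contC_mult CU); [apply (contC_const CU)|apply contC_id].
Qed.

Lemma rect_int_affine (k l : C) (a b c d : R) :
  (a <= b)%R -> (c <= d)%R -> rect_int (fun w => k + l * w) a b c d = 0.
Proof.
  intros Hab Hcd. unfold rect_int.
  assert (H : forall y, CInt (fun x => k + l * (x, y)) a b =
    RtoC (b - a) * (k + l * (RtoC y * Ci)) + RtoC ((b ^ 2 - a ^ 2) / 2) * l).
  { intros y. rewrite <- CInt_affine by auto. apply CInt_ext; auto. intros t _.
    replace (t, y) with (RtoC t + RtoC y * Ci); [ring|].
    unfold RtoC, Ci, Cplus, Cmult; simpl; f_equal; ring. }
  assert (V : forall x, CInt (fun y => k + l * (x, y)) c d =
    RtoC (d - c) * (k + l * RtoC x) + RtoC ((d ^ 2 - c ^ 2) / 2) * (l * Ci)).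
  { intros x. rewrite <- CInt_affine by auto. apply CInt_ext; auto. intros t _.
    replace (x, t) with (RtoC x + RtoC t * Ci); [ring|].
    unfold RtoC, Ci, Cplus, Cmult; simpl; f_equal; ring. }
  rewrite !H, !V, !RtoC_minus. ring.
Qed.

(** For fixed eps, the bound 4 eps (W + H)^2 h^2 on the piece of relative side [h] is inherited from
    quarters, since 4 (h/2)^2 = h^2. On small pieces around a point it holds because the linear
    approximation there is within eps h (W + H) of [f] and has integral zero. Bisection carries it
    to the whole rectangle, and eps is arbitrary. *)
Theorem goursat (f : C -> C) (a b c d : R) :
  (a <= b)%R -> (c <= d)%R ->
  (forall x y, (a <= x <= b)%R -> (c <= y <= d)%R -> exists l, cderiv f (x, y) l) ->
  rect_int f a b c d = 0.
Proof.
  intros Hab Hcd D.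
  assert (F : cont_rect f a b c d).
  { intros x y Hx Hy. destruct (D x y Hx Hy) as [l Hl]. eapply cderiv_continuous, Hl. }
  set (W := (b - a)%R). set (H := (d - c)%R).
  assert (HW : (0 <= W)%R) by (unfold W; lra).
  assert (HH : (0 <= H)%R) by (unfold H; lra).
  (* Pieces are addressed by their position in the unit square, as [square_bisection] requires. *)
  set (Q := fun x y h => rect_int f (a + x * W) (a + (x + h) * W) (c + y * H) (c + (y + h) * H)).
  assert (Main : forall eps, (0 < eps)%R -> (Cmod (rect_int f a b c d) <= 4 * eps * ((W + H) * (W + H)))%R).
  { intros eps Heps.
    assert (G : (Cmod (Q 0 0 1) <= 4 * eps * ((W + H) * (W + H)) * 1 ^ 2)%R).
    { apply (square_bisection (fun x y h => (Cmod (Q x y h) <= 4 * eps * ((W + H) * (W + H)) * h ^ 2)%R)).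
      - intros x y h Hx Hy Hh Hx1 Hy1 A1 A2 A3 A4.
        assert (E : Q x y h = Q x y (h / 2)%R + Q (x + h / 2)%R y (h / 2)%R + (Q x (y + h / 2)%R (h / 2)%R
          + Q (x + h / 2)%R (y + h / 2)%R (h / 2)%R)).
        { unfold Q. replace (x + h / 2 + h / 2)%R with (x + h)%R by field.
          replace (y + h / 2 + h / 2)%R with (y + h)%R by field.
          assert (0 <= x * W)%R by nra. assert (0 <= y * H)%R by nra.
          assert ((x + h) * W <= 1 * W)%R by (apply Rmult_le_compat_r; lra).
          assert ((y + h) * H <= 1 * H)%R by (apply Rmult_le_compat_r; lra).
          assert (x * W <= (x + h / 2) * W)%R by (apply Rmult_le_compat_r; lra).
          assert (y * H <= (y + h / 2) * H)%R by (apply Rmult_le_compat_r; lra).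
          assert ((x + h / 2) * W <= (x + h) * W)%R by (apply Rmult_le_compat_r; lra).
          assert ((y + h / 2) * H <= (y + h) * H)%R by (apply Rmult_le_compat_r; lra).
          unfold W, H in *.
          rewrite (rect_int_split_v f _ _ _ (c + (y + h / 2) * (d - c))%R); try lra;
            [|apply cont_rect_boundary, (cont_rect_sub _ _ _ _ _ _ _ _ _ F); lra].
          rewrite (rect_int_split_h f _ (a + (x + h / 2) * (b - a))%R _ (c + y * (d - c))%R); try lra;
            [|apply cont_rect_boundary, (cont_rect_sub _ _ _ _ _ _ _ _ _ F); lra].
          rewrite (rect_int_split_h f _ (a + (x + h / 2) * (b - a))%R _ (c + (y + h / 2) * (d - c))%R); try lra;
            [|apply cont_rect_boundary, (cont_rect_sub _ _ _ _ _ _ _ _ _ F); lra].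
          reflexivity. }
        rewrite E.
        eapply Rle_trans; [apply Cmod_triangle|].
        pose proof (Cmod_triangle (Q x y (h / 2)%R) (Q (x + h / 2)%R y (h / 2)%R)).
        pose proof (Cmod_triangle (Q x (y + h / 2)%R (h / 2)%R) (Q (x + h / 2)%R (y + h / 2)%R (h / 2)%R)).
        lra.
      - intros X Y HX HY.
        assert (BX : (a <= a + X * W <= b)%R) by (unfold W in *; nra).
        assert (BY : (c <= c + Y * H <= d)%R) by (unfold H in *; nra).
        destruct (D _ _ BX BY) as [l Hl].
        destruct (cderiv_eps _ _ _ Hl (mkposreal _ Heps)) as [del Hdel]. simpl in Hdel.
        (* The added 1 keeps the denominator positive when the rectangle is reduced to a point. *)
        exists (del / (W + H + 1))%R. split; [apply Rdiv_lt_0_compat; [apply cond_pos|lra]|].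
        intros x y h Hx Hy [Hh Hhd] Hx1 Hy1 Xx Yy.
        assert (Hsm : (h * (W + H) < del)%R).
        { apply (Rmult_lt_compat_r (W + H + 1)) in Hhd; [|lra].
          unfold Rdiv in Hhd. rewrite Rmult_assoc, Rinv_l, Rmult_1_r in Hhd by lra. nra. }
        set (z0 := ((a + X * W)%R, (c + Y * H)%R) : C) in *.
        assert (0 <= x * W)%R by nra. assert (0 <= y * H)%R by nra.
        assert ((x + h) * W <= 1 * W)%R by (apply Rmult_le_compat_r; lra).
        assert ((y + h) * H <= 1 * H)%R by (apply Rmult_le_compat_r; lra).
        assert (x * W <= (x + h) * W)%R by (apply Rmult_le_compat_r; lra).
        assert (y * H <= (y + h) * H)%R by (apply Rmult_le_compat_r; lra).
        assert (FS : cont_rect f (a + x * W) (a + (x + h) * W) (c + y * H) (c + (y + h) * H)).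
        { apply (cont_rect_sub _ _ _ _ _ _ _ _ _ F); unfold W, H in *; lra. }
        assert (AF : cont_rect (fun w => (f z0 - l * z0) + l * w)
            (a + x * W) (a + (x + h) * W) (c + y * H) (c + (y + h) * H)).
        { intros u v _ _. apply continuous_affine. }
        (* The affine approximation of [f] at [z0] can be subtracted freely, by
           [rect_int_affine]. *)
        assert (E : Q x y h = rect_int (fun w => f w - ((f z0 - l * z0) + l * w))
           (a + x * W) (a + (x + h) * W) (c + y * H) (c + (y + h) * H)).
        { rewrite rect_int_minus by (auto using cont_rect_boundary; lra).
          rewrite rect_int_affine by lra. unfold Q. ring. }
        rewrite E.
        eapply Rle_trans.
        { apply (Cmod_rect_int_le _ (eps * (h * (W + H)))%R); try lra.
          - intros u v Hu Hv _. apply (contC_minus CU); [apply FS; auto|apply AF; auto].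
          - intros u v Hu Hv _.
            assert (HC : (Cmod ((u, v) - z0) <= h * (W + H))%R).
            { eapply Rle_trans; [apply Cmod_le_re_im|]. unfold z0; simpl.
              assert (x * W <= X * W)%R by (apply Rmult_le_compat_r; lra).
              assert (X * W <= (x + h) * W)%R by (apply Rmult_le_compat_r; lra).
              assert (y * H <= Y * H)%R by (apply Rmult_le_compat_r; lra).
              assert (Y * H <= (y + h) * H)%R by (apply Rmult_le_compat_r; lra).
              assert (Rabs (u + - (a + X * W)) <= h * W)%R by (apply Rabs_le; lra).
              assert (Rabs (v + - (c + Y * H)) <= h * H)%R by (apply Rabs_le; lra). lra. }
            replace (f (u, v) - (f z0 - l * z0 + l * (u, v)))
              with (f (u, v) - f z0 - l * ((u, v) - z0)) by ring.
            eapply Rle_trans; [apply Hdel; lra|].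
            apply Rmult_le_compat_l; lra. }
        right. unfold W, H. ring. }
    unfold Q in G. replace (a + 0 * W)%R with a in G by ring. replace (c + 0 * H)%R with c in G by ring.
    replace (a + (0 + 1) * W)%R with b in G by (unfold W; ring).
    replace (c + (0 + 1) * H)%R with d in G by (unfold H; ring). lra. }
  apply Cmod_eq_0.
  assert (Hz : (Cmod (rect_int f a b c d) <= 0)%R); [|pose proof (Cmod_ge_0 (rect_int f a b c d)); lra].
  apply le_epsilon. intros eps Heps. rewrite Rplus_0_l.
  set (K := (4 * ((W + H) * (W + H)))%R).
  assert (HK : (0 <= K)%R) by (unfold K; nra).
  assert (He : (0 < eps / (K + 1))%R) by (apply Rdiv_lt_0_compat; lra).
  specialize (Main _ He).
  replace (4 * (eps / (K + 1)) * ((W + H) * (W + H)))%R with (eps * (K / (K + 1)))%R in Main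
    by (unfold K; field; unfold K in HK; lra).
  assert (K / (K + 1) <= 1)%R.
  { apply (Rmult_le_reg_r (K + 1)); [lra|]. unfold Rdiv. rewrite Rmult_assoc, Rinv_l by lra. lra. }
  assert (eps * (K / (K + 1)) <= eps * 1)%R by (apply Rmult_le_compat_l; lra). lra.
Qed.

(** * Unique continuation from a half-plane *)

Lemma Cmod_le_eps_0 (z : C) (K : R) :
  (forall eps, (0 < eps)%R -> (Cmod z <= K * eps)%R) -> z = 0.
Proof.
  intros H. apply Cmod_eq_0. pose proof (Cmod_ge_0 z) as Hz.
  destruct (Rle_lt_or_eq_dec _ _ Hz) as [P|E]; [|auto].
  destruct (Rle_dec K 0) as [L|L].
  - specialize (H 1%R Rlt_0_1). lra.
  - assert (Q : (0 < Cmod z / (2 * K))%R) by (apply Rdiv_lt_0_compat; lra).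
    specialize (H _ Q). replace (K * (Cmod z / (2 * K)))%R with (Cmod z / 2)%R in H by (field; lra). lra.
Qed.

(* Goursat's theorem for [f (z + e^w)] on [[-U, 0] x [0, 2 PI]], where the two
   horizontal sides cancel; then [U -> oo]. *)
Lemma mean_value (f : C -> C) (z : C) :
  (forall w, exists l, cderiv f w l) ->
  CInt (fun t => f (z + Cexp (0, t))) 0 (2 * PI) = RtoC (2 * PI) * f z.
Proof.
  intros D. pose proof PI_RGT_0 as Hpi.
  set (g := fun w => f (z + Cexp w)).
  assert (Dg : forall w, exists l, cderiv g w l).
  { intros w. destruct (D (z + Cexp w)) as [l Hl]. eexists.
    apply (cderiv_comp f (fun w => z + Cexp w)); [exact Hl|].
    apply cderiv_plus; [apply cderiv_const|apply cderiv_Cexp]. }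
  assert (Cg : forall w, contCC g w).
  { intros w; destruct (Dg w) as [l Hl]; exact (cderiv_continuous _ _ _ Hl). }
  assert (E : forall U, (0 <= U)%R -> CInt (fun t => g (0, t)%R) 0 (2 * PI) = CInt (fun t => g ((- U)%R, t)) 0 (2 * PI)).
  { intros U HU.
    assert (G := goursat g (- U) 0 0 (2 * PI) ltac:(lra) ltac:(lra) (fun x y _ _ => Dg (x, y))).
    unfold rect_int in G.
    rewrite (CInt_ext (fun x => g (x, (2 * PI)%R)) (fun x => g (x, 0%R))) in G; [|lra|].
    - replace (CInt (fun t => g (0, t)%R) 0 (2 * PI)) with
        (CInt (fun t => g ((- U)%R, t)) 0 (2 * PI) + / Ci *
          (Ci * (CInt (fun y : R => g (0%R, y)) 0 (2 * PI) - CInt (fun y : R => g ((- U)%R, y)) 0 (2 * PI))))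
        by (field; apply Ci_nz).
      replace (Ci * (CInt (fun y : R => g (0%R, y)) 0 (2 * PI) - CInt (fun y : R => g ((- U)%R, y)) 0 (2 * PI)))
        with (RtoC 0); [ring|]. rewrite <- G. ring.
    - intros t _. unfold g. f_equal. f_equal. unfold Cexp; simpl.
      rewrite cos_2PI, sin_2PI, cos_0, sin_0. reflexivity. }
  enough (Z : CInt (fun t => f (z + Cexp (0, t))) 0 (2 * PI) - RtoC (2 * PI) * f z = 0).
  { rewrite <- (Cplus_0_l (RtoC (2 * PI) * f z)), <- Z. ring. }
  apply (Cmod_le_eps_0 _ (4 * PI)). intros eps Heps.
  destruct (D z) as [l Hl]. apply cderiv_continuous in Hl. rewrite contC_eps in Hl.
  destruct (Hl (mkposreal _ Heps)) as [d Hd]. simpl in Hd.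
  (* Chosen so that the circle of radius e^(-U) around [z] lies where [f] is within eps of [f z];
     the maximum with 0 keeps the rectangle correctly oriented. *)
  set (U := Rmax 0 (- ln (d / 2))).
  assert (HU : (0 <= U)%R) by apply Rmax_l.
  assert (HU2 : (exp (- U) < d)%R).
  { assert (P : (0 < d / 2)%R) by (destruct d; simpl; lra).
    apply Rle_lt_trans with (d / 2)%R; [|destruct d; simpl in *; lra].
    rewrite <- (exp_ln (d / 2)) by auto. apply exp_le.
    pose proof (Rmax_r 0 (- ln (d / 2))). fold U in H. lra. }
  change (fun t : R => f (z + Cexp (0%R, t))) with (fun t => g (0, t)%R).
  rewrite (E U HU).
  assert (CI : forall u, ex_CInt (fun t => g (u, t)) 0 (2 * PI)).
  { intros u. apply ex_CInt_continuous; [lra|]. intros t _. apply contC_vertical, Cg. }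
  replace (RtoC (2 * PI) * f z) with (CInt (fun _ => f z) 0 (2 * PI))
    by (rewrite CInt_const; f_equal; f_equal; ring).
  rewrite <- CInt_minus by (auto using ex_CInt_const; lra).
  eapply Rle_trans; [apply (Cmod_CInt_le_const _ eps)|right; ring].
  - lra.
  - apply ex_CInt_minus; auto using ex_CInt_const; lra.
  - intros t _. apply Rlt_le. unfold g. apply Hd.
    change (Cmod (z + Cexp ((- U)%R, t) - z) < d)%R.
    replace (z + Cexp ((- U)%R, t) - z) with (Cexp ((- U)%R, t)) by ring.
    rewrite Cmod_Cexp. exact HU2.
Qed.

Lemma contC_circle (f : C -> C) (z : C) (t : R) :
  contCC f (z + Cexp (0%R, t)) -> contC (fun t : R => f (z + Cexp (0%R, t))) t.
Proof.
  intros H. apply (contC_vertical (fun w => f (z + Cexp w))).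
  apply (contC_comp (fun w => z + Cexp w) f); auto.
  apply (contC_plus CU); [apply (contC_const CU)|apply continuous_Cexp].
Qed.

(* On the part of the unit circle around [z] where [f] may be nonzero one has
   [cos t <= 1/3], hence [Re (e^{it} + e^{2it}/2) = cos t + (cos t)^2 - 1/2 <= -1/18];
   the mean value property of [f (w) exp (N ((w-z) + (w-z)^2/2))] then gives
   [f z = O(exp (-N/18))]. *)
Lemma vanishing_step (f : C -> C) (b : R) :
  (forall w, exists l, cderiv f w l) -> (forall w, (b < Re w)%R -> f w = 0) ->
  forall z, (b - 1 / 3 <= Re z)%R -> f z = 0.
Proof.
  intros D V z Hz. pose proof PI_RGT_0 as Hpi.
  assert (Cc : forall t, contC (fun t : R => f (z + Cexp (0%R, t))) t).
  { intros t. apply contC_circle. destruct (D (z + Cexp (0%R, t))) as [l Hl]. eapply cderiv_continuous, Hl. }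
  (* A Riemann integrable function is bounded: this gives the bound on [f] over the unit circle, one
     component at a time. *)
  destruct (ex_RInt_ub _ _ _ (proj1 (ex_CInt_continuous _ 0 (2 * PI) ltac:(lra) (fun t _ => Cc t)))) as [M1 HM1].
  destruct (ex_RInt_ub _ _ _ (proj2 (ex_CInt_continuous _ 0 (2 * PI) ltac:(lra) (fun t _ => Cc t)))) as [M2 HM2].
  set (M := (M1 + M2)%R).
  assert (HM : forall t : R, (0 <= t <= 2 * PI)%R -> (Cmod (f (z + Cexp (0%R, t))%C) <= M)%R).
  { intros t Ht. eapply Rle_trans; [apply Cmod_le_re_im|]. unfold M.
    rewrite Rmin_left, Rmax_right in HM1, HM2 by lra.
    apply Rplus_le_compat; [apply (HM1 t Ht)|apply (HM2 t Ht)]. }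
  assert (M0 : (0 <= M)%R).
  { specialize (HM 0%R ltac:(lra)). pose proof (Cmod_ge_0 (f (z + Cexp (0%R, 0%R))%C)). lra. }
  assert (B : forall N : nat, (Cmod (RtoC (2 * PI) * f z) <= 2 * (M * exp (- (INR N / 18))) * (2 * PI))%R).
  { intros N.
    set (g := fun w => f w * Cexp (RtoC (INR N) * ((w - z) + RtoC (/ 2) * ((w - z) * (w - z))))).
    assert (Dg : forall w, exists l, cderiv g w l).
    { intros w. destruct (D w) as [l Hl]. eexists. unfold g.
      apply cderiv_mult; [apply Hl|].
      apply (cderiv_comp Cexp); [apply cderiv_Cexp|].
      apply cderiv_scal. apply cderiv_plus.
      - apply cderiv_minus; [apply cderiv_id|apply cderiv_const].
      - apply cderiv_scal. apply cderiv_pow. apply cderiv_minus; [apply cderiv_id|apply cderiv_const]. }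
    assert (Eg : g z = f z).
    { unfold g. replace (RtoC (INR N) * (z - z + RtoC (/ 2) * ((z - z) * (z - z)))) with (RtoC 0) by ring.
      rewrite Cexp_0. ring. }
    rewrite <- Eg, <- mean_value by auto.
    replace (2 * PI)%R with (2 * PI - 0)%R at 2 by ring.
    apply Cmod_CInt_le_const.
    - lra.
    - apply ex_CInt_continuous; [lra|]. intros t _.
      apply contC_circle. destruct (Dg (z + Cexp (0%R, t))) as [l Hl]. eapply cderiv_continuous, Hl.
    - intros t Ht. unfold g.
      replace (z + Cexp (0%R, t) - z) with (Cexp (0%R, t)) by ring.
      assert (Ec : Cexp (0%R, t) = (cos t, sin t)).
      { unfold Cexp; simpl. rewrite exp_0. f_equal; ring. }
      destruct (Rlt_dec b (Re (z + Cexp (0%R, t)))) as [L|L].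
      + rewrite V by auto. rewrite Cmult_0_l, Cmod_0.
        apply Rmult_le_pos; [auto|left; apply exp_pos].
      + rewrite Cmod_mult, Cmod_Cexp.
        apply Rmult_le_compat; [apply Cmod_ge_0|left; apply exp_pos|apply HM; lra|].
        apply exp_le. rewrite re_scal_l. rewrite re_plus, re_scal_l, re_mult, Ec. simpl.
        rewrite re_plus, Ec in L. simpl in L.
        pose proof (COS_bound t). pose proof (sin2_cos2 t) as S2. unfold Rsqr in S2.
        replace (- (INR N / 18))%R with (INR N * (- (1 / 18)))%R by field.
        (* With C = cos t, where -1 <= C <= 1/3, the product (C + 1) (C - 1/3) <= 0 gives C + C^2 -
           1/2 <= C/3 - 1/6 <= -1/18. *)
        apply Rmult_le_compat_l; [apply pos_INR|]. nra. }
  assert (P : (0 < 2 * PI)%R) by lra.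
  apply (Cmod_le_eps_0 _ (2 * M)). intros eps Heps.
  destruct (nfloor_ex (18 / eps)) as [N [_ HN]]; [left; apply Rdiv_lt_0_compat; lra|].
  specialize (B (S N)). rewrite Cmod_mult, Cmod_R, Rabs_pos_eq in B by lra.
  assert (Hf : (Cmod (f z) <= 2 * (M * exp (- (INR (S N) / 18))))%R) by nra.
  eapply Rle_trans; [apply Hf|]. rewrite Rmult_assoc.
  apply Rmult_le_compat_l; [lra|]. apply Rmult_le_compat_l; [auto|].
  rewrite exp_Ropp. rewrite S_INR in *.
  assert (Q : (/ eps <= exp ((INR N + 1) / 18))%R).
  { eapply Rle_trans; [|apply exp_ineq1_le].
    assert (18 / eps = 18 * / eps)%R by reflexivity. lra. }
  rewrite <- (Rinv_inv eps). apply Rinv_le_contravar; [apply Rinv_0_lt_compat; auto|auto].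
Qed.

Theorem entire_vanishing (f : C -> C) (b : R) :
  (forall w, exists l, cderiv f w l) -> (forall w, (b < Re w)%R -> f w = 0) ->
  forall z, f z = 0.
Proof.
  intros D V z.
  assert (I : forall n w, (b - INR n / 3 < Re w)%R -> f w = 0).
  { induction n as [|n IH]; intros w Hw.
    - apply V. simpl in Hw. lra.
    - apply (vanishing_step f (b - INR n / 3)); auto. rewrite S_INR in Hw. lra. }
  destruct (nfloor_ex (Rmax 0 (3 * (b - Re z)))) as [n [_ Hn]]; [apply Rmax_l|].
  pose proof (Rmax_r 0 (3 * (b - Re z))).
  apply (I (S n)). rewrite S_INR. lra.
Qed.

(** * A residue computation in a vertical strip *)

Definition csin (z : C) : C := (Cexp (Ci * z) - Cexp (- (Ci * z))) / (2 * Ci).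
Definition ccos (z : C) : C := (Cexp (Ci * z) + Cexp (- (Ci * z))) / 2.

Lemma C2_nz : RtoC 2 <> 0.
Proof. intros H; apply RtoC_inj in H; lra. Qed.

Ltac cnz := repeat split; auto using Ci_nz, C2_nz.

Lemma cderiv_exp_Ci (z : C) :
  cderiv (fun w => Cexp (Ci * w)) z (Cexp (Ci * z) * Ci).
Proof.
  apply (cderiv_comp Cexp (fun w => Ci * w)); [apply cderiv_Cexp|].
  generalize (cderiv_scal Ci _ _ _ (cderiv_id z)). apply cderiv_eq; ring.
Qed.

Lemma cderiv_exp_opp_Ci (z : C) :
  cderiv (fun w => Cexp (- (Ci * w))) z (Cexp (- (Ci * z)) * - Ci).
Proof.
  apply (cderiv_comp Cexp (fun w => - (Ci * w))); [apply cderiv_Cexp|].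
  generalize (cderiv_opp _ _ _ (cderiv_scal Ci _ _ _ (cderiv_id z))). apply cderiv_eq; ring.
Qed.

Lemma cderiv_csin (z : C) : cderiv csin z (ccos z).
Proof.
  apply (cderiv_ext (fun w => / (2 * Ci) * (Cexp (Ci * w) - Cexp (- (Ci * w))))).
  - intros w. unfold csin. field; cnz.
  - generalize (cderiv_scal (/ (2 * Ci)) _ _ _ (cderiv_minus _ _ _ _ _ (cderiv_exp_Ci z) (cderiv_exp_opp_Ci z))).
    apply cderiv_eq. unfold ccos. field; cnz.
Qed.

Lemma Ci_sq : Ci * Ci = - (1).
Proof. unfold Ci, Cmult, Copp, RtoC; simpl; f_equal; ring. Qed.

Lemma cderiv_ccos (z : C) : cderiv ccos z (- csin z).
Proof.
  apply (cderiv_ext (fun w => / 2 * (Cexp (Ci * w) + Cexp (- (Ci * w))))).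
  - intros w. unfold ccos. field; cnz.
  - generalize (cderiv_scal (/ 2) _ _ _ (cderiv_plus _ _ _ _ _ (cderiv_exp_Ci z) (cderiv_exp_opp_Ci z))).
    apply cderiv_eq. unfold csin.
    transitivity ((Cexp (Ci * z) - Cexp (- (Ci * z))) * ((Ci * Ci) / (2 * Ci))).
    + field; cnz.
    + rewrite Ci_sq. field; cnz.
Qed.

Lemma csin_0 : csin 0 = 0.
Proof.
  unfold csin. replace (Ci * 0) with (RtoC 0) by ring. replace (- 0) with (RtoC 0) by ring.
  field; cnz.
Qed.

Lemma ccos_0 : ccos 0 = 1.
Proof.
  unfold ccos. replace (Ci * 0) with (RtoC 0) by ring. replace (- 0) with (RtoC 0) by ring.
  rewrite Cexp_0. field; cnz.
Qed.

Lemma Cmod_exp_Ci (z : C) : Cmod (Cexp (Ci * z)) = exp (- Im z).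
Proof. rewrite Cmod_Cexp. f_equal. destruct z; simpl; ring. Qed.

Lemma Cmod_exp_opp_Ci (z : C) : Cmod (Cexp (- (Ci * z))) = exp (Im z).
Proof. rewrite Cmod_Cexp. f_equal. destruct z; simpl; ring. Qed.

(** At a zero the two exponentials e^(iz) and e^(-iz) agree; comparing their moduli forces z to be
    real, and the real sine vanishes in (-PI, PI) only at 0. *)
Lemma csin_neq_0 (z : C) : (- PI < Re z < PI)%R -> z <> 0 -> csin z <> 0.
Proof.
  intros Hz N E. apply N.
  assert (E1 : Cexp (Ci * z) = Cexp (- (Ci * z))).
  { rewrite <- (Cplus_0_r (Cexp (- (Ci * z)))).
    replace (RtoC 0) with (2 * Ci * csin z) by (rewrite E; ring).
    unfold csin. field; cnz. }
  assert (E2 : Im z = 0%R).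
  { assert (exp (- Im z) = exp (Im z)).
    { rewrite <- Cmod_exp_Ci, E1, Cmod_exp_opp_Ci. reflexivity. }
    apply exp_inv in H. lra. }
  destruct z as [x y]. simpl in *. subst y.
  assert (E3 : snd (Cexp (Ci * (x, 0%R))) = snd (Cexp (- (Ci * (x, 0%R))))) by (rewrite E1; auto).
  unfold Cexp, Ci, Cmult, Copp in E3. simpl in E3.
  replace (0 * 0 + 1 * x)%R with x in E3 by ring.
  replace (0 * x - 1 * 0)%R with 0%R in E3 by ring.
  rewrite sin_neg, Ropp_0, exp_0 in E3.
  assert (Sx : sin x = 0%R) by lra.
  destruct (Rtotal_order x 0) as [L|[->|L]]; [|reflexivity|].
  - assert (0 < sin (- x))%R by (apply sin_gt_0; lra). rewrite sin_neg in H. lra.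
  - assert (0 < sin x)%R by (apply sin_gt_0; lra). lra.
Qed.

(** One of the two exponentials dominates: as e^|y| >= 2, the smaller one is at most half of the
    larger, and the denominator 2i contributes the other factor 2. *)
Lemma Cmod_csin_ge (z : C) :
  (1 <= Rabs (Im z))%R -> (exp (Rabs (Im z)) / 4 <= Cmod (csin z))%R.
Proof.
  intros H. unfold csin.
  rewrite Cmod_div by (apply Cmult_neq_0; [apply C2_nz|apply Ci_nz]).
  rewrite Cmod_mult, Cmod_Ci, Cmod_R, (Rabs_pos_eq 2), Rmult_1_r by lra.
  enough (exp (Rabs (Im z)) / 2 <= Cmod (Cexp (Ci * z) - Cexp (- (Ci * z))))%R by lra.
  assert (B : (exp (- Rabs (Im z)) <= exp (Rabs (Im z)) / 2)%R).
  { rewrite exp_Ropp. assert (2 <= exp (Rabs (Im z)))%R.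
    { eapply Rle_trans; [|apply exp_ineq1_le]. lra. }
    assert (/ exp (Rabs (Im z)) <= / 2)%R by (apply Rinv_le_contravar; lra). lra. }
  pose proof (Cmod_ge_minus (Cexp (Ci * z)) (Cexp (- (Ci * z)))) as K1.
  pose proof (Cmod_ge_minus (Cexp (- (Ci * z))) (Cexp (Ci * z))) as K2.
  rewrite <- Copp_minus_distr, Cmod_opp in K2.
  rewrite Cmod_exp_Ci, Cmod_exp_opp_Ci in K1, K2.
  revert B H. unfold Rabs. destruct (Rcase_abs (Im z)); intros.
  - rewrite Ropp_involutive in B. lra.
  - lra.
Qed.

(** This is PI / (2 sin^2 (PI z)) on the lines Re z = 1/2 and Re z = -1/2. Being the derivative of
    tanh (PI y) / 2, it has total mass 1. *)
Definition kappa (y : R) : R := (PI / (2 * cosh (PI * y) ^ 2))%R.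

Lemma cosh_pos (x : R) : (0 < cosh x)%R.
Proof. unfold cosh. pose proof (exp_pos x). pose proof (exp_pos (- x)). lra. Qed.

Lemma kappa_pos (y : R) : (0 < kappa y)%R.
Proof.
  unfold kappa. apply Rdiv_lt_0_compat; [apply PI_RGT_0|].
  apply Rmult_lt_0_compat; [lra|]. apply pow_lt, cosh_pos.
Qed.

Lemma is_derive_tanh (y : R) :
  is_derive (fun y => / 2 * (sinh (PI * y) / cosh (PI * y)))%R y (kappa y).
Proof.
  pose proof (cosh_pos (PI * y)) as H. unfold kappa, sinh, cosh in *.
  assert (E : (exp (- (PI * y)) = / exp (PI * y))%R) by apply exp_Ropp.
  pose proof (exp_pos (PI * y)) as P.
  assert (N : (exp (PI * y) + / exp (PI * y) <> 0)%R) by (rewrite E in H; lra).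
  auto_derive; [lra|]. rewrite E. clear E H. set (A := exp (PI * y)) in *.
  field. nra.
Qed.

Lemma continuous_kappa (y : R) : continuous kappa y.
Proof.
  apply ex_derive_cont. unfold kappa, cosh. auto_derive.
  pose proof (exp_pos (PI * y)). pose proof (exp_pos (- (PI * y))).
  intros E. assert (0 < (exp (PI * y) + exp (- (PI * y))) / 2)%R by lra. nra.
Qed.

Lemma kappa_even (y : R) : kappa (- y) = kappa y.
Proof.
  unfold kappa, cosh. replace (PI * - y)%R with (- (PI * y))%R by ring.
  rewrite Ropp_involutive, (Rplus_comm (exp (- (PI * y)))). reflexivity.
Qed.

Lemma kappa_Rabs (y : R) : kappa (Rabs y) = kappa y.
Proof. unfold Rabs; destruct (Rcase_abs y); auto using kappa_even. Qed.

Lemma cosh_exp_bounds (u : R) : (0 <= u)%R -> (exp u / 2 <= cosh u <= exp u)%R.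
Proof.
  intros Hu. unfold cosh. pose proof (exp_pos (- u)).
  assert (exp (- u) <= exp u)%R by (apply exp_le; lra). lra.
Qed.

Lemma exp_sq (u : R) : (exp u ^ 2 = exp (2 * u))%R.
Proof. simpl. rewrite Rmult_1_r, <- exp_plus. f_equal; ring. Qed.

Lemma kappa_le (y : R) : (kappa y <= 2 * PI * exp (- (2 * PI * Rabs y)))%R.
Proof.
  rewrite <- kappa_Rabs. pose proof PI_RGT_0. pose proof (Rabs_pos y).
  set (u := Rabs y) in *. destruct (cosh_exp_bounds (PI * u)) as [L _]; [nra|].
  pose proof (exp_pos (PI * u)).
  replace (2 * PI * exp (- (2 * PI * u)))%R with (PI / (2 * (exp (PI * u) / 2) ^ 2))%R.
  - unfold kappa, Rdiv. apply Rmult_le_compat_l; [lra|]. apply Rinv_le_contravar.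
    + assert (0 < (exp (PI * u) * / 2) ^ 2)%R by (apply pow_lt; lra). lra.
    + apply Rmult_le_compat_l; [lra|]. apply pow_incr. unfold Rdiv in L. lra.
  - rewrite exp_Ropp. replace (2 * PI * u)%R with (2 * (PI * u))%R by ring.
    rewrite <- exp_sq. field. lra.
Qed.

(** The lower bound converts a hypothesis on the weighted function [kappa y * h] into control of [h]
    itself on the horizontal sides of a tall rectangle. *)
Lemma kappa_ge (y : R) : (PI / 2 * exp (- (2 * PI * Rabs y)) <= kappa y)%R.
Proof.
  rewrite <- kappa_Rabs. pose proof PI_RGT_0. pose proof (Rabs_pos y).
  set (u := Rabs y) in *. destruct (cosh_exp_bounds (PI * u)) as [L1 L]; [nra|].
  pose proof (exp_pos (PI * u)).
  replace (PI / 2 * exp (- (2 * PI * u)))%R with (PI / (2 * exp (PI * u) ^ 2))%R.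
  - unfold kappa, Rdiv. apply Rmult_le_compat_l; [lra|]. apply Rinv_le_contravar.
    + assert (0 < cosh (PI * u) ^ 2)%R by (apply pow_lt; lra). lra.
    + apply Rmult_le_compat_l; [lra|]. apply pow_incr. lra.
  - rewrite exp_Ropp. replace (2 * PI * u)%R with (2 * (PI * u))%R by ring.
    rewrite <- exp_sq. field. lra.
Qed.

Lemma csin_half (y : R) :
  csin (RtoC PI * ((/ 2)%R, y)) = RtoC (cosh (PI * y)) /\
  csin (RtoC PI * ((- / 2)%R, y)) = RtoC (- cosh (PI * y)).
Proof.
  assert (H : forall u, Ci * (RtoC PI * (u, y)) = ((- (PI * y))%R, (PI * u)%R)).
  { intros u. unfold Ci, RtoC, Cmult; simpl. f_equal; ring. }
  unfold csin. rewrite !H.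
  replace (PI * - / 2)%R with (- (PI / 2))%R by field.
  replace (PI * / 2)%R with (PI / 2)%R by field.
  unfold Cexp, Copp; simpl. rewrite !Ropp_involutive, cos_neg, sin_neg, cos_PI2, sin_PI2.
  split.
  - replace (((exp (- (PI * y)) * 0)%R, (exp (- (PI * y)) * 1)%R) - ((exp (PI * y) * 0)%R, (exp (PI * y) * - (1))%R))
      with (RtoC (2 * cosh (PI * y)) * Ci)
      by (unfold cosh, RtoC, Ci, Cmult, Cminus, Cplus, Copp; simpl; f_equal; field).
    rewrite RtoC_mult. field; cnz.
  - replace (((exp (- (PI * y)) * 0)%R, (exp (- (PI * y)) * - (1))%R) - ((exp (PI * y) * 0)%R, (exp (PI * y) * 1)%R))
      with (RtoC (2 * - cosh (PI * y)) * Ci)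
      by (unfold cosh, RtoC, Ci, Cmult, Cminus, Cplus, Copp; simpl; f_equal; field).
    rewrite RtoC_mult. field; cnz.
Qed.

Definition strip_kernel (z : C) : C :=
  RtoC (PI / 2) * / (csin (RtoC PI * z) * csin (RtoC PI * z)).

Lemma strip_kernel_half (y : R) :
  strip_kernel ((/ 2)%R, y) = RtoC (kappa y) /\ strip_kernel ((- / 2)%R, y) = RtoC (kappa y).
Proof.
  unfold strip_kernel, kappa. destruct (csin_half y) as [-> ->].
  pose proof (cosh_pos (PI * y)).
  rewrite <- !RtoC_mult, <- !RtoC_inv, <- !RtoC_mult by nra.
  split; f_equal; field; lra.
Qed.

Lemma cderiv_strip_kernel (z : C) :
  (- 1 < Re z < 1)%R -> z <> 0 -> exists l, cderiv strip_kernel z l.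
Proof.
  intros Hz N. pose proof PI_RGT_0.
  assert (S : csin (RtoC PI * z) <> 0).
  { apply csin_neq_0.
    - rewrite re_scal_l. nra.
    - apply Cmult_neq_0; auto. intros E; apply RtoC_inj in E; lra. }
  eexists. unfold strip_kernel. apply cderiv_scal. apply cderiv_inv; [|apply Cmult_neq_0; auto].
  apply cderiv_pow. apply (cderiv_comp csin (fun w => RtoC PI * w)); [apply cderiv_csin|].
  apply cderiv_scal, cderiv_id.
Qed.

(** The constant is 2 * 4^2: PI / 2 is at most 2, and [Cmod_csin_ge] is squared. *)
Lemma Cmod_strip_kernel_far (z : C) :
  (1 <= Rabs (Im z))%R -> (Cmod (strip_kernel z) <= 32 * exp (- (2 * PI * Rabs (Im z))))%R.
Proof.
  intros Hz. pose proof PI_RGT_0. pose proof PI_4. pose proof PI2_1.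
  assert (E : Rabs (Im (RtoC PI * z)) = (PI * Rabs (Im z))%R).
  { rewrite im_scal_l, Rabs_mult, (Rabs_pos_eq PI); lra. }
  pose proof (Cmod_csin_ge (RtoC PI * z)) as B. rewrite E in B.
  assert (H1u : (1 <= PI * Rabs (Im z))%R) by nra. specialize (B H1u).
  set (u := Rabs (Im z)) in *. pose proof (exp_pos (PI * u)).
  unfold strip_kernel. rewrite Cmod_mult, Cmod_R, Rabs_pos_eq by lra.
  assert (csin (RtoC PI * z) <> 0) by (apply Cmod_gt_0; lra).
  rewrite Cmod_inv by (apply Cmult_neq_0; auto). rewrite Cmod_mult.
  replace (32 * exp (- (2 * PI * u)))%R with (2 * / ((exp (PI * u) / 4) ^ 2))%R.
  - apply Rmult_le_compat; try lra.
    + left; apply Rinv_0_lt_compat. nra.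
    + apply Rinv_le_contravar; [apply pow_lt; lra|]. simpl. rewrite Rmult_1_r.
      apply Rmult_le_compat; lra.
  - rewrite exp_Ropp. replace (2 * PI * u)%R with (2 * (PI * u))%R by ring.
    rewrite <- exp_sq. field. lra.
Qed.

(** The derivative of sin (PI z) at 0 is PI, so near 0 its modulus is at least (PI - 1) |z| >= |z|,
    while PI / 2 <= 2. *)
Lemma Cmod_strip_kernel_near :
  exists d, (0 < d)%R /\ forall z : C, z <> 0 -> (Cmod z < d)%R ->
    (Cmod (strip_kernel z) <= 2 / (Cmod z ^ 2))%R.
Proof.
  pose proof PI_RGT_0. pose proof PI_4. pose proof PI2_1.
  assert (D : cderiv (fun w => csin (RtoC PI * w)) 0 (ccos (RtoC PI * 0) * (RtoC PI * 1))).
  { apply (cderiv_comp csin (fun w => RtoC PI * w)); [apply cderiv_csin|].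
    apply cderiv_scal, cderiv_id. }
  destruct (cderiv_eps _ _ _ D (mkposreal 1 Rlt_0_1)) as [d Hd]. simpl in Hd.
  exists d. split; [apply cond_pos|]. intros z Nz Hz.
  replace (RtoC PI * 0) with (RtoC 0) in Hd by ring.
  rewrite csin_0, ccos_0 in Hd. specialize (Hd z).
  replace (z - 0) with z in Hd by ring. specialize (Hd Hz).
  pose proof (Cmod_ge_minus (RtoC PI * z) (1 * (RtoC PI * 1) * z - (csin (RtoC PI * z) - 0))) as K.
  replace (RtoC PI * z - (1 * (RtoC PI * 1) * z - (csin (RtoC PI * z) - 0)))
    with (csin (RtoC PI * z)) in K by ring.
  rewrite <- (Copp_minus_distr (csin (RtoC PI * z) - 0)), Cmod_opp, Cmod_mult, Cmod_R, Rabs_pos_eq in K by lra.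
  apply Cmod_gt_0 in Nz.
  assert (L : (Cmod z <= Cmod (csin (RtoC PI * z)))%R) by nra.
  assert (csin (RtoC PI * z) <> 0) by (apply Cmod_gt_0; lra).
  unfold strip_kernel. rewrite Cmod_mult, Cmod_R, Rabs_pos_eq by lra.
  rewrite Cmod_inv by (apply Cmult_neq_0; auto). rewrite Cmod_mult.
  apply Rmult_le_compat; try lra.
  - left; apply Rinv_0_lt_compat. nra.
  - apply Rinv_le_contravar; [apply pow_lt; lra|]. simpl. rewrite Rmult_1_r.
    apply Rmult_le_compat; lra.
Qed.

(** Four cuts isolate a square of half-side [e] around 0, and Goursat's theorem disposes of the four
    outer pieces. On the boundary of the small square |f| <= eps / e, so its integral is at most 16
    eps. *)
Lemma rect_int_removable (f : C -> C) (b d : R) :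
  (0 < b)%R -> (0 < d)%R ->
  (forall x y, (- b <= x <= b)%R -> (- d <= y <= d)%R -> (x, y) <> RtoC 0 -> exists l, cderiv f (x, y) l) ->
  (forall eps, (0 < eps)%R -> exists r, (0 < r)%R /\ forall z : C, z <> 0 -> (Cmod z < r)%R ->
     (Cmod z * Cmod (f z) <= eps)%R) ->
  rect_int f (- b) b (- d) d = 0.
Proof.
  intros Hb Hd D S.
  assert (F : forall x y, (- b <= x <= b)%R -> (- d <= y <= d)%R -> (x <> 0 \/ y <> 0)%R -> contCC f (x, y)).
  { intros x y Hx Hy N. destruct (D x y Hx Hy) as [l Hl]; [|eapply cderiv_continuous, Hl].
    intros E; unfold RtoC in E; injection E; lra. }
  apply (Cmod_le_eps_0 _ 16). intros eps Heps.
  destruct (S eps Heps) as (r & Hr & K).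
  (* Points of the small square have modulus at most 2 e, which [r / 3] keeps below [r]. *)
  set (e := Rmin (Rmin b d) (r / 3)).
  assert (He : (0 < e)%R) by (unfold e; repeat apply Rmin_glb_lt; lra).
  assert (Eb : (e <= b)%R) by (unfold e; eapply Rle_trans; [apply Rmin_l|apply Rmin_l]).
  assert (Ed : (e <= d)%R) by (unfold e; eapply Rle_trans; [apply Rmin_l|apply Rmin_r]).
  assert (Er : (e <= r / 3)%R) by (unfold e; apply Rmin_r).
  assert (N0 : forall x y, (x <> 0 \/ y <> 0)%R -> (x, y) <> RtoC 0).
  { intros x y N E; unfold RtoC in E; injection E; lra. }
  rewrite (rect_int_split_v f (- b) b (- d) (- e) d); try lra;
    [|intros x y Hx Hy Q; apply F; lra].
  rewrite (goursat f (- b) b (- d) (- e)) by (try lra; intros; apply D; try lra; apply N0; lra).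
  rewrite (rect_int_split_v f (- b) b (- e) e d); try lra;
    [|intros x y Hx Hy Q; apply F; lra].
  rewrite (goursat f (- b) b e d) by (try lra; intros; apply D; try lra; apply N0; lra).
  rewrite (rect_int_split_h f (- b) (- e) b (- e) e); try lra;
    [|intros x y Hx Hy Q; apply F; lra].
  rewrite (goursat f (- b) (- e) (- e) e) by (try lra; intros; apply D; try lra; apply N0; lra).
  rewrite (rect_int_split_h f (- e) e b (- e) e); try lra;
    [|intros x y Hx Hy Q; apply F; lra].
  rewrite (goursat f e b (- e) e) by (try lra; intros; apply D; try lra; apply N0; lra).
  replace (0 + (0 + (rect_int f (- e) e (- e) e + 0) + 0)) with (rect_int f (- e) e (- e) e) by ring.
  eapply Rle_trans.
  { apply (Cmod_rect_int_le f (eps / e)%R); try lra.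
    - intros x y Hx Hy Q; apply F; lra.
    - intros x y Hx Hy Q.
      assert (L : (e <= Cmod (x, y))%R).
      { pose proof (Rmax_Cmod (x, y)) as M. simpl in M.
        pose proof (Rmax_l (Rabs x) (Rabs y)). pose proof (Rmax_r (Rabs x) (Rabs y)).
        pose proof (Rle_abs x). pose proof (Rle_abs y).
        pose proof (Rle_abs (- x)) as Q1. pose proof (Rle_abs (- y)) as Q2. rewrite Rabs_Ropp in Q1, Q2.
        destruct Q as [Q|[Q|[Q|Q]]]; lra. }
      assert (U : (Cmod (x, y) < r)%R).
      { eapply Rle_lt_trans; [apply Cmod_le_re_im|]. simpl.
        assert (Rabs x <= e)%R by (apply Rabs_le; lra).
        assert (Rabs y <= e)%R by (apply Rabs_le; lra). lra. }
      specialize (K (x, y)).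
      assert (NN : (x, y) <> RtoC 0) by (apply Cmod_gt_0; lra).
      specialize (K NN U). apply (Rmult_le_reg_l e); [auto|].
      replace (e * (eps / e))%R with eps by (field; lra).
      eapply Rle_trans; [|apply K]. apply Rmult_le_compat_r; [apply Cmod_ge_0|auto]. }
  right. field. lra.
Qed.

Lemma continuous_kappa_C (y : R) : contC (fun t : R => RtoC (kappa t)) y.
Proof.
  apply contC_pair; simpl; [apply continuous_kappa|apply continuous_const].
Qed.

Lemma CInt_kappa (Y : R) : (0 <= Y)%R ->
  (Cmod (CInt (fun y => RtoC (kappa y)) (- Y) Y - 1) <= 2 * exp (- (2 * PI * Y)))%R.
Proof.
  intros HY. pose proof PI_RGT_0.
  rewrite (CInt_derive (fun y => RtoC (/ 2 * (sinh (PI * y) / cosh (PI * y)))%R)).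
  - rewrite <- !RtoC_minus, Cmod_R.
    replace (PI * - Y)%R with (- (PI * Y))%R by ring.
    unfold sinh, cosh. rewrite Ropp_involutive, !exp_Ropp.
    replace (2 * PI * Y)%R with (2 * (PI * Y))%R by ring. rewrite <- exp_sq.
    pose proof (exp_pos (PI * Y)) as P. set (A := exp (PI * Y)) in *.
    pose proof (Rinv_0_lt_compat _ P).
    replace (/ 2 * ((A - / A) / 2 / ((A + / A) / 2)) - / 2 * ((/ A - A) / 2 / ((/ A + A) / 2)) - 1)%R
      with (- (2 / (A ^ 2 + 1)))%R by (field; repeat split; nra).
    rewrite Rabs_Ropp, Rabs_pos_eq by (left; apply Rdiv_lt_0_compat; nra).
    apply Rmult_le_compat_l; [lra|]. apply Rinv_le_contravar; nra.
  - lra.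
  - intros t _. simpl. apply is_derive_tanh.
  - intros t _. simpl. apply (is_derive_const (V := R_NormedModule)).
  - intros t _. apply continuous_kappa_C.
Qed.

(* Integrating [(H z - H 0 - H' 0 z) PI / (2 sin^2 (PI z))] around a rectangle
   of width one: the vertical sides carry the weight [kappa]. *)
Lemma strip_step (H : C -> C) (dH : C) (Y m : R) :
  (1 <= Y)%R ->
  (forall x y, (- / 2 <= x <= / 2)%R -> (- Y <= y <= Y)%R -> exists l, cderiv H (x, y) l) ->
  cderiv H 0 dH ->
  (forall x, (- / 2 <= x <= / 2)%R ->
     (Cmod (H (x, Y)) * exp (- (2 * PI * Y)) <= m)%R /\
     (Cmod (H (x, (- Y)%R)) * exp (- (2 * PI * Y)) <= m)%R) ->
  (Cmod (CInt (fun y => RtoC (kappa y) * (H ((/ 2)%R, y) - H ((- / 2)%R, y))) (- Y) Y - dH)%C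
   <= 130 * (m + (Cmod (H 0) + Cmod dH) / (1 + Y)))%R.
Proof.
  intros HY DH D0 Hm. pose proof PI_RGT_0 as Hpi.
  set (Ht := fun z => H z - (H 0 + dH * z)).
  set (Phi := fun z => Ht z * strip_kernel z).
  assert (DHt : forall x y, (- / 2 <= x <= / 2)%R -> (- Y <= y <= Y)%R -> exists l, cderiv Ht (x, y) l).
  { intros x y Hx Hy. destruct (DH x y Hx Hy) as [l Hl]. eexists. unfold Ht.
    apply cderiv_minus; [apply Hl|]. apply cderiv_plus; [apply cderiv_const|apply cderiv_scal, cderiv_id]. }
  assert (DPhi : forall x y, (- / 2 <= x <= / 2)%R -> (- Y <= y <= Y)%R -> (x, y) <> RtoC 0 -> exists l, cderiv Phi (x, y) l).
  { intros x y Hx Hy N. destruct (DHt x y Hx Hy) as [l Hl].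
    destruct (cderiv_strip_kernel (x, y)) as [k Hk]; [simpl; lra|auto|].
    eexists. apply cderiv_mult; eassumption. }
  assert (Z : rect_int Phi (- / 2) (/ 2) (- Y) Y = 0).
  { apply rect_int_removable; try lra; auto.
    intros eps Heps. destruct Cmod_strip_kernel_near as (d & Hd & K).
    assert (He2 : (0 < eps / 2)%R) by lra.
    destruct (cderiv_eps _ _ _ D0 (mkposreal _ He2)) as [d' Hd']. simpl in Hd'.
    exists (Rmin d d'). split; [apply Rmin_glb_lt; [auto|apply cond_pos]|].
    intros z Nz Hz. pose proof (Rmin_l d d'). pose proof (Rmin_r d d').
    specialize (K z Nz ltac:(lra)). specialize (Hd' z).
    replace (z - 0) with z in Hd' by ring. specialize (Hd' ltac:(lra)).
    unfold Phi. rewrite Cmod_mult.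
    replace (Ht z) with (H z - H 0 - dH * z) by (unfold Ht; ring).
    apply Cmod_gt_0 in Nz.
    apply Rle_trans with (Cmod z * ((eps / 2 * Cmod z) * (2 / Cmod z ^ 2)))%R.
    - apply Rmult_le_compat_l; [lra|]. apply Rmult_le_compat; auto using Cmod_ge_0.
    - right. field. lra. }
  assert (CPhi : cont_boundary Phi (- / 2) (/ 2) (- Y) Y).
  { intros x y Hx Hy Q. destruct (DPhi x y Hx Hy) as [l Hl]; [|eapply cderiv_continuous, Hl].
    intros E; unfold RtoC in E; injection E; lra. }
  set (E2 := exp (- (2 * PI * Y))) in *.
  assert (HE2 : (0 < E2)%R) by apply exp_pos.
  (* On the horizontal sides the subtracted term [dH * z] grows like 1 + Y; the decay of the kernel
     beats even the square of this. *)
  assert (HE3 : ((1 + Y) * E2 <= / (1 + Y))%R).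
  { assert (B : ((1 + Y) * (1 + Y) <= exp (2 * PI * Y))%R).
    { replace (2 * PI * Y)%R with (Y + (2 * PI - 1) * Y)%R by ring. rewrite exp_plus.
      pose proof PI2_1. pose proof (exp_ineq1_le Y).
      pose proof (exp_ineq1_le ((2 * PI - 1) * Y)).
      apply Rmult_le_compat; nra. }
    unfold E2. rewrite exp_Ropp. apply (Rmult_le_reg_r (1 + Y)); [lra|].
    rewrite Rinv_l by lra. apply (Rmult_le_reg_r (exp (2 * PI * Y))); [apply exp_pos|].
    replace ((1 + Y) * / exp (2 * PI * Y) * (1 + Y) * exp (2 * PI * Y))%R with ((1 + Y) * (1 + Y))%R
      by (field; apply Rgt_not_eq, exp_pos). lra. }
  assert (HE4 : (E2 <= / (1 + Y))%R) by nra.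
  assert (P1 : (0 < / (1 + Y))%R) by (apply Rinv_0_lt_compat; lra).
  set (q := (/ (1 + Y))%R) in *.
  pose proof (Cmod_ge_0 (H 0)) as N1. pose proof (Cmod_ge_0 dH) as N2.
  set (B := (32 * (m + (Cmod (H 0) + Cmod dH) * q))%R).
  assert (Edge : forall y, (y = Y \/ y = - Y)%R ->
    (Cmod (CInt (fun x => Phi (x, y)) (- / 2) (/ 2)) <= 2 * B)%R).
  { intros y Hy. assert (Ay : Rabs y = Y) by (destruct Hy as [->| ->]; [|rewrite Rabs_Ropp]; apply Rabs_pos_eq; lra).
    replace (2 * B)%R with (2 * B * (/ 2 - - / 2))%R by field.
    apply Cmod_CInt_le_const; [lra| |].
    - apply (ex_CInt_horizontal _ (- / 2) (/ 2) (- Y) Y); auto; lra.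
    - intros x Hx. unfold Phi. rewrite Cmod_mult.
      pose proof (Cmod_strip_kernel_far (x, y)) as K. simpl Im in K. rewrite Ay in K. fold E2 in K.
      specialize (K HY).
      assert (HHm : (Cmod (H (x, y)) * E2 <= m)%R).
      { destruct (Hm x ltac:(lra)) as [M1 M2]. destruct Hy as [->| ->]; auto. }
      assert (Cxy : (Cmod (x, y) <= 1 + Y)%R).
      { eapply Rle_trans; [apply Cmod_le_re_im|]. simpl. rewrite Ay.
        assert (Rabs x <= 1)%R by (apply Rabs_le; lra). lra. }
      assert (T : (Cmod (Ht (x, y)) <= Cmod (H (x, y)) + (Cmod (H 0) + Cmod dH * (1 + Y)))%R).
      { unfold Ht. eapply Rle_trans; [apply Cmod_triangle_minus|]. apply Rplus_le_compat_l.
        eapply Rle_trans; [apply Cmod_triangle|]. apply Rplus_le_compat_l. rewrite Cmod_mult.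
        apply Rmult_le_compat_l; auto. }
      apply Rle_trans with ((Cmod (H (x, y)) + (Cmod (H 0) + Cmod dH * (1 + Y))) * (32 * E2))%R.
      + apply Rmult_le_compat; auto using Cmod_ge_0.
      + unfold B. nra. }
  assert (Sides : CInt (fun y => Phi ((/ 2)%R, y)) (- Y) Y - CInt (fun y => Phi ((- / 2)%R, y)) (- Y) Y
    = Ci * (CInt (fun x => Phi (x, (- Y)%R)) (- / 2) (/ 2) - CInt (fun x => Phi (x, Y)) (- / 2) (/ 2))).
  { unfold rect_int in Z.
    replace (CInt (fun x => Phi (x, (- Y)%R)) (- / 2) (/ 2) - CInt (fun x => Phi (x, Y)) (- / 2) (/ 2))
      with (- (Ci * (CInt (fun y => Phi ((/ 2)%R, y)) (- Y) Y - CInt (fun y => Phi ((- / 2)%R, y)) (- Y) Y)))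
      by (rewrite <- (Cplus_0_r (- (Ci * _))), <- Z; ring).
    match goal with |- ?a = _ => transitivity (- (Ci * Ci) * a); [rewrite Ci_sq; ring|ring] end. }
  assert (EV : forall x, (x = - / 2 \/ x = / 2)%R -> ex_CInt (fun y => Phi (x, y)) (- Y) Y).
  { intros x Hx. apply (ex_CInt_vertical _ (- / 2) (/ 2) (- Y) Y); auto; lra. }
  assert (EK : ex_CInt (fun y => RtoC (kappa y)) (- Y) Y).
  { apply ex_CInt_continuous; [lra|]. intros; apply continuous_kappa_C. }
  (* This is where the derivative appears: the subtracted affine function changes by exactly [dH]
     across the strip of width one, and [kappa] has mass nearly 1. *)
  assert (Eq : CInt (fun y => RtoC (kappa y) * (H ((/ 2)%R, y) - H ((- / 2)%R, y))) (- Y) Y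
    = CInt (fun y => Phi ((/ 2)%R, y)) (- Y) Y - CInt (fun y => Phi ((- / 2)%R, y)) (- Y) Y
      + dH * CInt (fun y => RtoC (kappa y)) (- Y) Y).
  { rewrite <- CInt_scal by auto.
    rewrite <- (CInt_minus (fun y => Phi ((/ 2)%R, y)) (fun y => Phi ((- / 2)%R, y))) by (auto; lra).
    rewrite <- CInt_plus.
    - apply CInt_ext; [lra|]. intros t _. unfold Phi.
      destruct (strip_kernel_half t) as [-> ->]. unfold Ht.
      replace ((/ 2)%R, t) with (RtoC 1 + ((- / 2)%R, t)) at 3
        by (unfold RtoC, Cplus; simpl; f_equal; field).
      ring.
    - apply ex_CInt_minus; auto; lra.
    - apply ex_CInt_scal; auto. }
  rewrite Eq, Sides.
  replace (Ci * (CInt (fun x => Phi (x, (- Y)%R)) (- / 2) (/ 2) - CInt (fun x => Phi (x, Y)) (- / 2) (/ 2)) +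
      dH * CInt (fun y => RtoC (kappa y)) (- Y) Y - dH)
    with (Ci * (CInt (fun x => Phi (x, (- Y)%R)) (- / 2) (/ 2) - CInt (fun x => Phi (x, Y)) (- / 2) (/ 2)) +
      dH * (CInt (fun y => RtoC (kappa y)) (- Y) Y - 1)) by ring.
  eapply Rle_trans; [apply Cmod_triangle|]. rewrite !Cmod_mult, Cmod_Ci.
  pose proof (Cmod_triangle_minus (CInt (fun x => Phi (x, (- Y)%R)) (- / 2) (/ 2)) (CInt (fun x => Phi (x, Y)) (- / 2) (/ 2))) as T.
  pose proof (Edge Y (or_introl eq_refl)) as T1. pose proof (Edge (- Y)%R (or_intror eq_refl)) as T2.
  pose proof (CInt_kappa Y ltac:(lra)) as T3. fold E2 in T3.
  assert (T4 : (Cmod dH * Cmod (CInt (fun y => RtoC (kappa y)) (- Y) Y - 1)%C <= Cmod dH * (2 * q))%R)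
    by (apply Rmult_le_compat_l; lra).
  unfold Rdiv. fold q. unfold B in *.
  assert (M0 : (0 <= m)%R).
  { destruct (Hm 0%R ltac:(lra)) as [M1 _]. eapply Rle_trans; [|apply M1].
    apply Rmult_le_pos; [apply Cmod_ge_0|lra]. }
  (* The constant 130 is 128 + 2: each horizontal side contributes at most 2 B, that is 64 times the
     bracket, and the missing mass of [kappa] contributes [2 * q] times [Cmod dH]. *)
  nra.
Qed.

(** * Dominated integrals over the real line *)

Definition integrable_bound (d : R -> R) (M : R) : Prop :=
  (forall t, continuous d t) /\ (forall t, (0 <= d t)%R) /\
  forall N : nat, (RInt d (- INR N) (INR N) <= M)%R.

Notation SInt f N := (CInt f (- INR N) (INR N)).

(** The integral over the real line, taken as a limit over [-N, N] with N an integer and defined for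
    every integrand; its meaning comes from [TInt_correct] under domination. *)
Definition TInt (f : R -> C) : C :=
  (real (Lim_seq (fun N => Re (SInt f N))),
   real (Lim_seq (fun N => Im (SInt f N)))).

Definition is_TInt (f : R -> C) (l : C) : Prop :=
  forall eps, (0 < eps)%R -> exists N0 : nat, forall N, (N0 <= N)%nat ->
    (Cmod (SInt f N - l)%C <= eps)%R.

Lemma is_TInt_unique (f : R -> C) (l : C) : is_TInt f l -> TInt f = l.
Proof.
  intros H.
  assert (L : forall p : C -> R, (forall a b : C, (Rabs (p a - p b) <= Cmod (a - b)%C)%R) ->
    is_lim_seq (fun N => p (SInt f N)) (p l)).
  { intros p Hp. apply is_lim_seq_spec. intros eps.
    assert (He : (0 < eps / 2)%R) by (destruct eps; simpl; lra).
    destruct (H _ He) as [N0 HN]. exists N0. intros N Hn.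
    eapply Rle_lt_trans; [apply Hp|]. specialize (HN N Hn). destruct eps; simpl in *; lra. }
  unfold TInt. destruct l as [l1 l2].
  rewrite (is_lim_seq_unique _ _ (L Re Re_minus_le)).
  rewrite (is_lim_seq_unique _ _ (L Im Im_minus_le)).
  reflexivity.
Qed.

Lemma ex_RInt_cont (d : R -> R) (a b : R) : (forall t, continuous d t) -> ex_RInt d a b.
Proof. intros H. apply (ex_RInt_continuous (V := R_CompleteNormedModule)). auto. Qed.

Lemma CInt_tail (f : R -> C) (d : R -> R) (a b : R) :
  (0 <= a <= b)%R -> (forall t, continuous d t) ->
  (forall t, contC f t) -> (forall t, (Cmod (f t) <= d t)%R) ->
  (Cmod (CInt f (- b) b - CInt f (- a) a)%C <= 2 * (RInt d (- b) b - RInt d (- a) a))%R.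
Proof.
  intros Hab Hd Hf Hfd.
  assert (E : forall u v, (u <= v)%R -> ex_CInt f u v) by (intros; apply ex_CInt_continuous; auto).
  rewrite <- (CInt_Chasles f (- b) (- a) b) by (apply E; lra).
  rewrite <- (CInt_Chasles f (- a) a b) by (apply E; lra).
  rewrite <- (RInt_Chasles d (- b) (- a) b) by (apply ex_RInt_cont; auto).
  rewrite <- (RInt_Chasles d (- a) a b) by (apply ex_RInt_cont; auto).
  replace (CInt f (- b) (- a) + (CInt f (- a) a + CInt f a b) - CInt f (- a) a)
    with (CInt f (- b) (- a) + CInt f a b) by ring.
  eapply Rle_trans; [apply Cmod_triangle|].
  pose proof (Cmod_CInt_le f d (- b) (- a) ltac:(lra) (E (- b)%R (- a)%R ltac:(lra)) (ex_RInt_cont _ _ _ Hd) (fun t _ => Hfd t)).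
  pose proof (Cmod_CInt_le f d a b ltac:(lra) (E a b ltac:(lra)) (ex_RInt_cont _ _ _ Hd) (fun t _ => Hfd t)).
  unfold plus; simpl. lra.
Qed.

Lemma dom_cauchy (d : R -> R) (M : R) :
  integrable_bound d M ->
  forall eps, (0 < eps)%R -> exists N0 : nat, forall N N', (N0 <= N)%nat -> (N0 <= N')%nat ->
    (Rabs (RInt d (- INR N') (INR N') - RInt d (- INR N) (INR N)) < eps)%R.
Proof.
  intros (Hd & Hp & HM) eps Heps.
  assert (L : ex_finite_lim_seq (fun N => RInt d (- INR N) (INR N))).
  { apply (ex_finite_lim_seq_incr _ M); auto. intros n.
    pose proof (pos_INR n). rewrite S_INR.
    rewrite <- (RInt_Chasles d (- (INR n + 1)) (- INR n) (INR n + 1)) by (apply ex_RInt_cont; auto).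
    rewrite <- (RInt_Chasles d (- INR n) (INR n) (INR n + 1)) by (apply ex_RInt_cont; auto).
    pose proof (RInt_ge_0 d (- (INR n + 1)) (- INR n) ltac:(lra) (ex_RInt_cont _ _ _ Hd) (fun t _ => Hp t)).
    pose proof (RInt_ge_0 d (INR n) (INR n + 1) ltac:(lra) (ex_RInt_cont _ _ _ Hd) (fun t _ => Hp t)).
    unfold plus; simpl. lra. }
  apply ex_lim_seq_cauchy_corr in L.
  destruct (L (mkposreal _ Heps)) as [N0 HN]. exists N0. intros N N' H1 H2.
  apply (HN N' N H2 H1).
Qed.

(** The threshold depends on the majorant alone and serves every [f] below it. This uniformity,
    obtained from the Cauchy property of the integrals of [d], is what dominated convergence rests
    on. *)
Lemma TInt_tail (d : R -> R) (M : R) :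
  integrable_bound d M ->
  forall eps, (0 < eps)%R -> exists N0 : nat, forall f : R -> C,
    (forall t, contC f t) -> (forall t, (Cmod (f t) <= d t)%R) ->
    forall N, (N0 <= N)%nat -> (Cmod (SInt f N - TInt f)%C <= eps)%R.
Proof.
  intros HD eps Heps. pose proof HD as (Hd & Hp & HM).
  assert (Diff : forall f : R -> C, (forall t, contC f t) -> (forall t, (Cmod (f t) <= d t)%R) ->
    forall N N', (Cmod (SInt f N' - SInt f N)%C <=
      2 * Rabs (RInt d (- INR N') (INR N') - RInt d (- INR N) (INR N)))%R).
  { intros f Hf Hfd.
    assert (W : forall N N', (N <= N')%nat -> (Cmod (SInt f N' - SInt f N)%C <=
      2 * Rabs (RInt d (- INR N') (INR N') - RInt d (- INR N) (INR N)))%R).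
    { intros N N' L. apply le_INR in L. pose proof (pos_INR N).
      eapply Rle_trans; [apply (CInt_tail f d); auto|].
      pose proof (Rle_abs (RInt d (- INR N') (INR N') - RInt d (- INR N) (INR N))). lra. }
    intros N N'. destruct (Nat.le_ge_cases N N') as [L|L]; [auto|].
    rewrite <- Copp_minus_distr, Cmod_opp, Rabs_minus_sym. auto. }
  assert (Ex : forall f : R -> C, (forall t, contC f t) -> (forall t, (Cmod (f t) <= d t)%R) ->
    exists l, is_TInt f l).
  { intros f Hf Hfd.
    assert (L : forall p : C -> R, (forall a b : C, (Rabs (p a - p b) <= Cmod (a - b)%C)%R) ->
      ex_finite_lim_seq (fun N => p (SInt f N))).
    { intros p Hpp. apply ex_lim_seq_cauchy_corr. intros e.
      assert (He : (0 < e / 2)%R) by (destruct e; simpl; lra).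
      destruct (dom_cauchy d M HD _ He) as [N0 HN]. exists N0. intros n m Hn Hm.
      eapply Rle_lt_trans; [apply Hpp|]. eapply Rle_lt_trans; [apply Diff; auto|].
      specialize (HN m n Hm Hn). lra. }
    destruct (L Re Re_minus_le) as [l1 H1].
    destruct (L Im Im_minus_le) as [l2 H2].
    exists (l1, l2). intros e He. apply is_lim_seq_spec in H1, H2.
    assert (He2 : (0 < e / 2)%R) by lra.
    destruct (H1 (mkposreal _ He2)) as [n1 K1]. destruct (H2 (mkposreal _ He2)) as [n2 K2].
    exists (Nat.max n1 n2). intros N HN. eapply Rle_trans; [apply Cmod_le_re_im|].
    unfold Cminus. rewrite re_plus, im_plus, re_opp, im_opp. simpl in *.
    specialize (K1 N ltac:(lia)). specialize (K2 N ltac:(lia)).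
    unfold Rminus in *. lra. }
  assert (He4 : (0 < eps / 4)%R) by lra.
  destruct (dom_cauchy d M HD _ He4) as [N0 HN]. exists N0. intros f Hf Hfd N Hn.
  destruct (Ex f Hf Hfd) as [l Hl]. rewrite (is_TInt_unique _ _ Hl).
  destruct (Hl (eps / 2)%R ltac:(lra)) as [N1 HN1].
  set (N' := Nat.max N0 N1).
  specialize (HN1 N' ltac:(lia)). specialize (HN N' N ltac:(lia) Hn).
  specialize (Diff f Hf Hfd N' N).
  replace (SInt f N - l) with
    ((SInt f N - SInt f N') + (SInt f N' - l)) by ring.
  eapply Rle_trans; [apply Cmod_triangle|]. lra.
Qed.

Definition dominated (d : R -> R) (f : R -> C) : Prop :=
  (forall t, contC f t) /\ exists K, (0 <= K)%R /\ forall t, (Cmod (f t) <= K * d t)%R.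

Lemma integrable_bound_scal (d : R -> R) (M K : R) :
  (0 <= K)%R -> integrable_bound d M -> integrable_bound (fun t => K * d t)%R (K * M).
Proof.
  intros HK (Hd & Hp & HM). split; [|split].
  - intros t. apply (continuous_scal_r (V := R_NormedModule) K d t), Hd.
  - intros t. apply Rmult_le_pos; auto.
  - intros N. rewrite (RInt_scal (V := R_CompleteNormedModule) d) by (apply ex_RInt_cont; auto).
    apply Rmult_le_compat_l; auto.
Qed.

Section Dominated.
Context (d : R -> R) (M : R) (HD : integrable_bound d M).

Lemma TInt_correct (f : R -> C) : dominated d f -> is_TInt f (TInt f).
Proof.
  intros (Hf & K & HK & Hfd) eps Heps.
  destruct (TInt_tail _ _ (integrable_bound_scal d M K HK HD) eps Heps) as [N0 HN].
  exists N0. intros N Hn. apply HN; auto.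
Qed.

Lemma Cmod_TInt_le (f : R -> C) (K : R) :
  (0 <= K)%R -> (forall t, contC f t) -> (forall t, (Cmod (f t) <= K * d t)%R) ->
  (Cmod (TInt f) <= 2 * (K * M))%R.
Proof.
  intros HK Hf Hfd. apply le_epsilon. intros eps Heps.
  destruct (TInt_correct f ltac:(split; eauto) eps Heps) as [N HN].
  specialize (HN N (Nat.le_refl _)).
  destruct (integrable_bound_scal d M K HK HD) as (Hd & _ & HM). specialize (HM N).
  pose proof (pos_INR N).
  assert (B : (Cmod (SInt f N) <= 2 * RInt (fun t => K * d t)%R (- INR N) (INR N))%R).
  { apply Cmod_CInt_le; [lra|apply ex_CInt_continuous; auto; lra|apply ex_RInt_cont; auto|auto]. }
  pose proof (Cmod_ge_minus (TInt f) (TInt f - SInt f N)) as T.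
  replace (TInt f - (TInt f - SInt f N)) with (SInt f N) in T by ring.
  rewrite <- (Copp_minus_distr (SInt f N)), Cmod_opp in T. lra.
Qed.

Lemma dominated_plus (f g : R -> C) :
  dominated d f -> dominated d g -> dominated d (fun t => f t + g t).
Proof.
  intros (Hf & K & HK & Hfd) (Hg & L & HL & Hgd). split.
  - intros t. apply contC_plus; auto.
  - exists (K + L)%R. split; [lra|]. intros t. eapply Rle_trans; [apply Cmod_triangle|].
    specialize (Hfd t). specialize (Hgd t). lra.
Qed.

Lemma dominated_scal (k : C) (f : R -> C) :
  dominated d f -> dominated d (fun t => k * f t).
Proof.
  intros (Hf & K & HK & Hfd). split.
  - intros t. apply contC_mult; [apply contC_const|auto].
  - exists (Cmod k * K)%R. pose proof (Cmod_ge_0 k). split; [apply Rmult_le_pos; auto|].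
    intros t. rewrite Cmod_mult, Rmult_assoc. apply Rmult_le_compat_l; auto.
Qed.

Lemma ex_CInt_dominated (f : R -> C) (N : nat) : dominated d f -> ex_CInt f (- INR N) (INR N).
Proof.
  intros [Hf _]. pose proof (pos_INR N). apply ex_CInt_continuous; auto; lra.
Qed.

Lemma TInt_plus (f g : R -> C) :
  dominated d f -> dominated d g -> TInt (fun t => f t + g t) = TInt f + TInt g.
Proof.
  intros F G. apply is_TInt_unique. intros eps Heps.
  destruct (TInt_correct f F (eps / 2)%R ltac:(lra)) as [N1 H1].
  destruct (TInt_correct g G (eps / 2)%R ltac:(lra)) as [N2 H2].
  exists (Nat.max N1 N2). intros N HN.
  specialize (H1 N ltac:(lia)). specialize (H2 N ltac:(lia)).
  rewrite CInt_plus by (apply ex_CInt_dominated; auto).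
  replace (SInt f N + SInt g N - (TInt f + TInt g))
    with ((SInt f N - TInt f) + (SInt g N - TInt g)) by ring.
  eapply Rle_trans; [apply Cmod_triangle|]. lra.
Qed.

Lemma TInt_scal (k : C) (f : R -> C) :
  dominated d f -> TInt (fun t => k * f t) = k * TInt f.
Proof.
  intros F. apply is_TInt_unique. intros eps Heps. pose proof (Cmod_ge_0 k).
  assert (He : (0 < eps / (Cmod k + 1))%R) by (apply Rdiv_lt_0_compat; lra).
  destruct (TInt_correct f F _ He) as [N1 H1].
  exists N1. intros N HN. specialize (H1 N HN).
  rewrite CInt_scal by (apply ex_CInt_dominated; auto).
  replace (k * SInt f N - k * TInt f) with (k * (SInt f N - TInt f)) by ring.
  rewrite Cmod_mult.
  apply Rle_trans with ((Cmod k + 1) * (eps / (Cmod k + 1)))%R.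
  - apply Rmult_le_compat; auto using Cmod_ge_0; lra.
  - right. field. lra.
Qed.

Lemma TInt_ext (f g : R -> C) : (forall t, f t = g t) -> TInt f = TInt g.
Proof.
  intros H. assert (E : forall N : nat, SInt f N = SInt g N).
  { intros N. pose proof (pos_INR N). apply CInt_ext; auto; lra. }
  unfold TInt. f_equal; f_equal; apply Lim_seq_ext; intros N; rewrite E; auto.
Qed.

Lemma TInt_minus (f g : R -> C) :
  dominated d f -> dominated d g -> TInt (fun t => f t - g t) = TInt f - TInt g.
Proof.
  intros F G. rewrite (TInt_ext _ (fun t => f t + - (1) * g t)) by (intros; ring).
  rewrite TInt_plus, TInt_scal by (auto using dominated_scal). ring.
Qed.

(** Cut at an [N] beyond which the tails are small for all [n] at once; on [-N, N] uniform
    convergence is enough. *)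
Lemma TInt_dominated_cvg (f : nat -> R -> C) (K : R) :
  (0 <= K)%R -> (forall n t, contC (f n) t) -> (forall n t, (Cmod (f n t) <= K * d t)%R) ->
  (forall (N : nat) eps, (0 < eps)%R -> exists n0 : nat, forall n t, (n0 <= n)%nat -> (Rabs t <= INR N)%R ->
     (Cmod (f n t) <= eps)%R) ->
  forall eps, (0 < eps)%R -> exists n0 : nat, forall n, (n0 <= n)%nat -> (Cmod (TInt (f n)) <= eps)%R.
Proof.
  intros HK Hc Hb Hu eps Heps.
  destruct (TInt_tail _ _ (integrable_bound_scal d M K HK HD) (eps / 2)%R ltac:(lra)) as [N HN].
  pose proof (pos_INR N) as HNp.
  assert (He : (0 < eps / (8 * (INR N + 1)))%R) by (apply Rdiv_lt_0_compat; lra).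
  destruct (Hu N _ He) as [n0 Hn0]. exists n0. intros n Hn.
  specialize (HN (f n) (Hc n) (Hb n) N (Nat.le_refl _)).
  assert (B : (Cmod (SInt (f n) N) <= 2 * (eps / (8 * (INR N + 1))) * (INR N - - INR N))%R).
  { apply Cmod_CInt_le_const; [lra|apply ex_CInt_continuous; auto; lra|].
    intros t Ht. apply Hn0; auto. apply Rabs_le; lra. }
  assert (B2 : (2 * (eps / (8 * (INR N + 1))) * (INR N - - INR N) <= eps / 2)%R).
  { replace (2 * (eps / (8 * (INR N + 1))) * (INR N - - INR N))%R with (eps / 2 * (INR N / (INR N + 1)))%R
      by (field; lra).
    rewrite <- (Rmult_1_r (eps / 2)) at 2. apply Rmult_le_compat_l; [lra|].
    apply (Rmult_le_reg_r (INR N + 1)); [lra|]. unfold Rdiv. rewrite Rmult_assoc, Rinv_l; lra. }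
  pose proof (Cmod_ge_minus (TInt (f n)) (TInt (f n) - SInt (f n) N)) as T.
  replace (TInt (f n) - (TInt (f n) - SInt (f n) N)) with (SInt (f n) N) in T by ring.
  rewrite <- (Copp_minus_distr (SInt (f n) N)), Cmod_opp in T. lra.
Qed.

End Dominated.

(** * Power majorants and moments of the kernel *)

Definition dpow (tau y : R) : R := Rpower (1 + Rabs y) (- tau).

Lemma dpow_pos (tau y : R) : (0 < dpow tau y)%R.
Proof. apply exp_pos. Qed.

Lemma continuous_dpow (tau y : R) : continuous (dpow tau) y.
Proof.
  unfold dpow, Rpower.
  apply (continuous_comp (fun t => - tau * ln (1 + Rabs t))%R exp).
  - apply (continuous_scal_r (V := R_NormedModule) (- tau)%R (fun t => ln (1 + Rabs t))).
    apply (continuous_comp (fun t => 1 + Rabs t)%R ln).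
    + apply (continuous_plus (V := R_NormedModule) (fun _ => 1%R) Rabs); [apply continuous_const|apply continuous_Rabs].
    + apply ex_derive_cont. eexists. apply is_derive_ln.
      pose proof (Rabs_pos y). lra.
  - apply ex_derive_cont. eexists. apply is_derive_exp.
Qed.

Lemma integrable_bound_dpow (tau : R) :
  (1 < tau)%R -> integrable_bound (dpow tau) (2 / (tau - 1)).
Proof.
  intros Ht. split; [|split]; [apply continuous_dpow|intros; left; apply dpow_pos|].
  intros N. pose proof (pos_INR N) as HN.
  assert (DP : forall u, (0 < u)%R -> is_derive (fun u => Rpower u (1 - tau)) u ((1 - tau) * Rpower u (- tau))%R).
  { intros u Hu. apply is_derive_Reals. replace (- tau)%R with (1 - tau - 1)%R by ring.
    apply derivable_pt_lim_power; auto. }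
  assert (R1 : is_RInt (dpow tau) 0 (INR N) (minus (- / (tau - 1) * Rpower (1 + INR N) (1 - tau)) (- / (tau - 1) * Rpower (1 + 0) (1 - tau)))%R).
  { apply (is_RInt_ext (fun t => Rpower (1 + t) (- tau))).
    { intros t Htt. rewrite Rmin_left, Rmax_right in Htt by lra. unfold dpow. rewrite Rabs_pos_eq; lra. }
    apply (is_RInt_derive (fun t => - / (tau - 1) * Rpower (1 + t) (1 - tau))%R).
    - intros t Htt. rewrite Rmin_left, Rmax_right in Htt by lra.
      replace (Rpower (1 + t) (- tau)) with (- / (tau - 1) * (1 * ((1 - tau) * Rpower (1 + t) (- tau))))%R by (field; lra).
      apply (is_derive_scal (fun t => Rpower (1 + t) (1 - tau))).
      apply (is_derive_comp (fun u => Rpower u (1 - tau)) (fun t => 1 + t)%R); [apply DP; lra|].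
      auto_derive; auto.
    - intros t Htt. rewrite Rmin_left, Rmax_right in Htt by lra.
      apply ex_derive_cont. unfold Rpower. auto_derive. lra. }
  assert (R2 : is_RInt (dpow tau) 0 (- INR N) (opp (minus (- / (tau - 1) * Rpower (1 + INR N) (1 - tau))
    (- / (tau - 1) * Rpower (1 + 0) (1 - tau))))%R).
  { apply (is_RInt_ext (fun t => opp (opp (dpow tau (- t))))).
    { intros t _. rewrite opp_opp. unfold dpow. rewrite Rabs_Ropp. reflexivity. }
    apply (is_RInt_opp (V := R_NormedModule)), (is_RInt_comp_opp (V := R_NormedModule)).
    rewrite Ropp_0, Ropp_involutive. exact R1. }
  rewrite (is_RInt_unique _ _ _ _ (is_RInt_Chasles _ _ _ _ _ _ (is_RInt_swap _ _ _ _ R2) R1)).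
  unfold plus, minus, opp; simpl; unfold plus, opp; simpl.
  replace (1 + 0)%R with 1%R by ring.
  replace (Rpower 1 (1 - tau)) with 1%R by (unfold Rpower; rewrite ln_1, Rmult_0_r, exp_0; auto).
  pose proof (exp_pos ((1 - tau) * ln (1 + INR N))) as P1. fold (Rpower (1 + INR N) (1 - tau)) in P1.
  assert (P : (0 < / (tau - 1))%R) by (apply Rinv_0_lt_compat; lra).
  unfold Rdiv. nra.
Qed.

Lemma dpow_1_le (tau y : R) : (1 <= tau)%R -> (dpow tau y <= / (1 + Rabs y))%R.
Proof.
  intros H. unfold dpow. pose proof (Rabs_pos y).
  rewrite <- (Rpower_1 (1 + Rabs y)) at 2 by lra. rewrite <- Rpower_Ropp.
  apply Rle_Rpower; lra.
Qed.

Lemma pow_le_fact_exp (n : nat) (x : R) : (0 <= x)%R -> (x ^ n <= INR (fact n) * exp x)%R.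
Proof.
  intros Hx. pose proof (exp_ge_taylor x n Hx) as H.
  assert (K : (x ^ n / INR (fact n) <= exp x)%R).
  { eapply Rle_trans; [|apply H]. destruct n as [|n]; [simpl; lra|].
    rewrite tech5. assert (0 <= sum_f_R0 (fun k => x ^ k / INR (fact k)) n)%R; [|lra].
    apply cond_pos_sum. intros k. apply Rmult_le_pos; [apply pow_le; auto|].
    left; apply Rinv_0_lt_compat, INR_fact_lt_0. }
  pose proof (INR_fact_lt_0 n). apply (Rmult_le_compat_l (INR (fact n))) in K; [|lra].
  replace (INR (fact n) * (x ^ n / INR (fact n)))%R with (x ^ n)%R in K by (field; lra). auto.
Qed.

(** Every power of 1 + |y| is O (e^|y|) by the exponential series, and [kappa y * exp |y|] is still
    bounded since 2 PI > 1; two powers are kept aside to form [dpow 2]. *)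
Lemma kappa_moment (m : R) :
  exists K, (0 <= K)%R /\ forall y, (kappa y * Rpower (1 + Rabs y) m <= K * dpow 2 y)%R.
Proof.
  destruct (nfloor_ex (Rmax 0 (m + 2))) as [n [_ Hn]]; [apply Rmax_l|].
  pose proof (Rmax_r 0 (m + 2)) as Hm. pose proof PI_RGT_0. pose proof PI2_1.
  set (F := INR (fact (S n))).
  assert (HF : (0 < F)%R) by apply INR_fact_lt_0.
  exists (2 * PI * (F * exp 1))%R. pose proof (exp_pos 1).
  split; [apply Rmult_le_pos; [lra|apply Rmult_le_pos; lra]|].
  intros y. pose proof (Rabs_pos y) as Hy. set (u := Rabs y) in *.
  unfold dpow. fold u.
  assert (P : (Rpower (1 + u) m = Rpower (1 + u) (m + 2) * Rpower (1 + u) (- (2)))%R)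
    by (rewrite <- Rpower_plus; f_equal; ring).
  rewrite P, <- Rmult_assoc. apply Rmult_le_compat_r; [left; apply exp_pos|].
  assert (B : (Rpower (1 + u) (m + 2) <= F * (exp 1 * exp u))%R).
  { eapply Rle_trans; [apply (Rle_Rpower _ _ (INR (S n))); [lra|rewrite S_INR; lra]|].
    rewrite Rpower_pow by lra. rewrite <- exp_plus. apply pow_le_fact_exp; lra. }
  assert (B2 : (kappa y * exp u <= 2 * PI)%R).
  { eapply Rle_trans; [apply Rmult_le_compat_r; [left; apply exp_pos|apply kappa_le]|].
    fold u. rewrite Rmult_assoc, <- exp_plus.
    apply Rle_trans with (2 * PI * 1)%R; [apply Rmult_le_compat_l; [lra|]|lra].
    rewrite <- exp_0. apply exp_le. nra. }
  pose proof (kappa_pos y).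
  apply Rle_trans with (kappa y * (F * (exp 1 * exp u)))%R; [apply Rmult_le_compat_l; lra|].
  replace (kappa y * (F * (exp 1 * exp u)))%R with ((kappa y * exp u) * (F * exp 1))%R by ring.
  apply Rmult_le_compat_r; [apply Rmult_le_pos; lra|auto].
Qed.

(** Principal logarithm; the arctangent gives the argument on the right half-plane, where all the
    functions integrated below live. *)
Definition Clog (z : C) : C := (ln (Cmod z), atan (Im z / Re z)).

Lemma Cexp_Clog (z : C) : (0 < Re z)%R -> Cexp (Clog z) = z.
Proof.
  intros H. destruct z as [x y]. simpl in H.
  assert (M : Cmod (x, y) = (x * sqrt (1 + (y / x)²))%R).
  { rewrite Cmod_pair. rewrite <- (sqrt_pow2 x) at 2 by lra.
    rewrite <- sqrt_mult_alt by (simpl; nra). f_equal. unfold Rsqr. field. lra. }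
  assert (P : (0 < sqrt (1 + (y / x)²))%R).
  { apply sqrt_lt_R0. pose proof (Rle_0_sqr (y / x)). lra. }
  unfold Cexp, Clog; simpl. rewrite exp_ln by (rewrite M; nra).
  rewrite M, cos_atan, sin_atan. f_equal; field; lra.
Qed.

Lemma Im_Clog (z : C) : (Rabs (Im (Clog z)) <= PI / 2)%R.
Proof. simpl. pose proof (atan_bound (Im z / Re z)). apply Rabs_le; lra. Qed.

Lemma Clog_RtoC (x : R) : (0 < x)%R -> Clog (RtoC x) = RtoC (ln x).
Proof.
  intros H. unfold Clog. rewrite Cmod_R, Rabs_pos_eq by lra. simpl.
  replace (0 / x)%R with 0%R by (field; lra). rewrite atan_0. reflexivity.
Qed.

Lemma continuous_Cmod (z : C) : @continuous CU R_UniformSpace Cmod z.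
Proof.
  intros P [eps HP]. exists eps. intros w Hw. apply HP.
  change (Rabs (Cmod w - Cmod z) < eps)%R. change (Cmod (w - z) < eps)%R in Hw.
  eapply Rle_lt_trans; [|apply Hw].
  pose proof (Cmod_ge_minus w z). pose proof (Cmod_ge_minus z w).
  rewrite <- Copp_minus_distr, Cmod_opp in H0. apply Rabs_le. lra.
Qed.

Lemma continuous_Clog (z : C) : (0 < Re z)%R -> contCC Clog z.
Proof.
  intros H. apply (contC_pair CU); simpl.
  - apply (continuous_comp (U := CU) (V := R_UniformSpace) (W := R_UniformSpace) Cmod ln); [apply continuous_Cmod|].
    apply ex_derive_cont. eexists. apply is_derive_ln.
    pose proof (re_le_Cmod z). pose proof (Rle_abs (Re z)). lra.
  - apply (continuous_comp (U := CU) (V := R_UniformSpace) (W := R_UniformSpace) (fun w => Im w / Re w)%R atan); [|apply continuous_atan].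
    apply (continuous_mult (U := CU) (K := R_AbsRing) (fun w : CU => Im w) (fun w : CU => / Re w)%R).
    + apply (contC_im CU (fun w => w)), contC_id.
    + apply (continuous_comp (U := CU) (V := R_UniformSpace) (W := R_UniformSpace) Re Rinv).
      * apply (contC_re CU (fun w => w)), contC_id.
      * apply continuous_Rinv. lra.
Qed.

Lemma open_right_half (z : C) : (0 < Re z)%R -> locally (T := CU) z (fun w => (0 < Re w)%R).
Proof.
  intros H. exists (mkposreal _ H). intros w Hw. change (Cmod (w - z) < Re z)%R in Hw.
  pose proof (re_le_Cmod (w - z)) as K. unfold Cminus in K at 1. rewrite re_plus, re_opp in K.
  pose proof (Rle_abs (- (Re w + - Re z))) as K2. rewrite Rabs_Ropp in K2. lra.
Qed.

(* [Clog] inverts [Cexp]: invert the difference quotient of [Cexp]. *)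
Lemma cderiv_Clog (z : C) : (0 < Re z)%R -> cderiv Clog z (/ z).
Proof.
  intros H. pose proof (continuous_Clog z H) as CL.
  destruct (cderiv_Cexp (Clog z)) as (phi & H1 & H2 & E).
  rewrite Cexp_Clog in H2 by auto.
  assert (Nz : z <> 0) by (intros ->; simpl in H; lra).
  assert (CP : contCC (fun w => phi (Clog w)) z)
    by (apply (contC_comp Clog phi); auto).
  exists (fun w => / phi (Clog w)). split; [|split].
  - apply (contC_inv CU); [auto|rewrite H2; auto].
  - rewrite H2; auto.
  - assert (E0 : locally (T := CU) z (fun w => Cexp (Clog w) - Cexp (Clog z) = phi (Clog w) * (Clog w - Clog z)))
      by exact (CL _ E).
    assert (NZ : locally (T := CU) z (fun w => phi (Clog w) <> 0)).
    { rewrite contC_eps in CP. apply Cmod_gt_0 in Nz.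
      generalize (CP (mkposreal _ Nz)). apply filter_imp. intros w Hw Habs. simpl in Hw.
      rewrite Habs, H2 in Hw. replace (0 - z) with (- z) in Hw by ring. rewrite Cmod_opp in Hw. lra. }
    generalize (filter_and _ _ (filter_and _ _ E0 NZ) (open_right_half z H)). apply filter_imp.
    intros w [[K1 K2] K3]. rewrite !Cexp_Clog in K1 by auto. rewrite K1. cfield. auto.
Qed.

(** * Telescoping over residue classes *)

(** Counts [n] terms, starting from an empty sum, so that blocks of [q] terms concatenate without an
    index shift; [sum_n_csum] accounts for the extra term of [sum_n]. *)
Fixpoint csum (a : nat -> C) (n : nat) : C :=
  match n with O => 0 | S m => csum a m + a m end.

Lemma csum_ext (a b : nat -> C) (n : nat) :
  (forall i, (i < n)%nat -> a i = b i) -> csum a n = csum b n.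
Proof.
  induction n as [|n IH]; intros H; simpl; auto. rewrite IH, H; auto.
Qed.

Lemma csum_plus (a b : nat -> C) (n : nat) :
  csum (fun i => a i + b i) n = csum a n + csum b n.
Proof. induction n as [|n IH]; simpl; [ring|rewrite IH; ring]. Qed.

Lemma csum_scal (k : C) (a : nat -> C) (n : nat) :
  csum (fun i => k * a i) n = k * csum a n.
Proof. induction n as [|n IH]; simpl; [ring|rewrite IH; ring]. Qed.

Lemma csum_minus (a b : nat -> C) (n : nat) :
  csum (fun i => a i - b i) n = csum a n - csum b n.
Proof. induction n as [|n IH]; simpl; [ring|rewrite IH; ring]. Qed.

Lemma csum_add (a : nat -> C) (m n : nat) :
  csum a (m + n) = csum a m + csum (fun i => a (m + i)%nat) n.
Proof.
  induction n as [|n IH]; simpl.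
  - rewrite Nat.add_0_r. ring.
  - rewrite Nat.add_succ_r; simpl. rewrite IH. ring.
Qed.

Lemma csum_exchange (a : nat -> nat -> C) (m n : nat) :
  csum (fun i => csum (fun j => a i j) n) m = csum (fun j => csum (fun i => a i j) m) n.
Proof.
  induction m as [|m IH]; simpl.
  - induction n as [|n IHn]; simpl; [auto|rewrite <- IHn; ring].
  - rewrite IH, <- csum_plus. reflexivity.
Qed.

Lemma Cmod_csum_le (a : nat -> C) (M : R) (n : nat) :
  (forall i, (i < n)%nat -> (Cmod (a i) <= M)%R) -> (Cmod (csum a n) <= INR n * M)%R.
Proof.
  induction n as [|n IH]; intros H.
  - simpl. rewrite Cmod_0. lra.
  - rewrite S_INR. simpl csum. eapply Rle_trans; [apply Cmod_triangle|].
    specialize (IH ltac:(auto)). specialize (H n ltac:(lia)). lra.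
Qed.

Lemma finite_bound (a : nat -> C) (n : nat) :
  exists X, (0 <= X)%R /\ forall i, (i < n)%nat -> (Cmod (a i) <= X)%R.
Proof.
  induction n as [|n (X & HX & B)].
  - exists 0%R. split; [lra|]. intros; lia.
  - exists (X + Cmod (a n))%R. pose proof (Cmod_ge_0 (a n)). split; [lra|].
    intros i Hi. destruct (Nat.eq_dec i n) as [->|]; [lra|]. specialize (B i ltac:(lia)). lra.
Qed.

(** * Limits of complex sequences *)

Definition clim (u : nat -> C) (l : C) : Prop :=
  forall eps, (0 < eps)%R -> exists n0 : nat, forall n, (n0 <= n)%nat -> (Cmod (u n - l)%C <= eps)%R.

Lemma clim_ext (u v : nat -> C) (l : C) : (forall n, u n = v n) -> clim u l -> clim v l.
Proof.
  intros H U eps Heps. destruct (U eps Heps) as [n0 K]. exists n0. intros n Hn. rewrite <- H; auto.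
Qed.

Lemma clim_const (l : C) : clim (fun _ => l) l.
Proof.
  intros eps Heps. exists O. intros n _. replace (l - l) with (RtoC 0) by ring. rewrite Cmod_0; lra.
Qed.

Lemma clim_plus (u v : nat -> C) (l m : C) : clim u l -> clim v m -> clim (fun n => u n + v n) (l + m).
Proof.
  intros U V eps Heps.
  destruct (U (eps / 2)%R ltac:(lra)) as [n1 K1]. destruct (V (eps / 2)%R ltac:(lra)) as [n2 K2].
  exists (Nat.max n1 n2). intros n Hn. specialize (K1 n ltac:(lia)). specialize (K2 n ltac:(lia)).
  replace (u n + v n - (l + m)) with ((u n - l) + (v n - m)) by ring.
  eapply Rle_trans; [apply Cmod_triangle|lra].
Qed.

Lemma clim_scal (k : C) (u : nat -> C) (l : C) : clim u l -> clim (fun n => k * u n) (k * l).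
Proof.
  intros U eps Heps. pose proof (Cmod_ge_0 k).
  assert (He : (0 < eps / (Cmod k + 1))%R) by (apply Rdiv_lt_0_compat; lra).
  destruct (U _ He) as [n0 K]. exists n0. intros n Hn. specialize (K n Hn).
  replace (k * u n - k * l) with (k * (u n - l)) by ring. rewrite Cmod_mult.
  apply Rle_trans with ((Cmod k + 1) * (eps / (Cmod k + 1)))%R.
  - apply Rmult_le_compat; auto using Cmod_ge_0; lra.
  - right. field. lra.
Qed.

Lemma clim_csum (u : nat -> nat -> C) (l : nat -> C) (m : nat) :
  (forall i, (i < m)%nat -> clim (u i) (l i)) ->
  clim (fun n => csum (fun i => u i n) m) (csum l m).
Proof.
  induction m as [|m IH]; intros H; cbn [csum]; [apply clim_const|].
  apply clim_plus; auto.
Qed.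

Lemma clim_unique (u : nat -> C) (l m : C) : clim u l -> clim u m -> l = m.
Proof.
  intros U V. enough (Z : l - m = 0) by (rewrite <- (Cplus_0_l m), <- Z; ring).
  apply (Cmod_le_eps_0 _ 2). intros eps Heps.
  destruct (U eps Heps) as [n1 K1]. destruct (V eps Heps) as [n2 K2].
  specialize (K1 (Nat.max n1 n2) ltac:(lia)). specialize (K2 (Nat.max n1 n2) ltac:(lia)).
  replace (l - m) with ((u (Nat.max n1 n2) - m) - (u (Nat.max n1 n2) - l)) by ring.
  eapply Rle_trans; [apply Cmod_triangle_minus|lra].
Qed.

Lemma sum_n_csum (a : nat -> C) (n : nat) :
  sum_n (G := C_AbelianMonoid) a n = csum a (S n).
Proof.
  induction n as [|n IH].
  - rewrite sum_O. simpl. ring.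
  - rewrite sum_Sn, IH. reflexivity.
Qed.

Lemma is_series_csum (a : nat -> C) (l : C) :
  is_seriesC a l <-> clim (csum a) l.
Proof.
  split.
  - intros H eps Heps.
    destruct (proj1 (filterlim_locally_ball_norm (K := C_AbsRing) (U := C_NormedModule) _ l) H (mkposreal _ Heps)) as [N HN].
    exists (S N). intros n Hn. destruct n as [|n]; [lia|].
    specialize (HN n ltac:(lia)). rewrite <- sum_n_csum. left. exact HN.
  - intros H. apply (filterlim_locally_ball_norm (K := C_AbsRing) (U := C_NormedModule)). intros eps.
    assert (He : (0 < eps / 2)%R) by (destruct eps; simpl; lra).
    destruct (H _ He) as [N HN]. exists N. intros n Hn.
    specialize (HN (S n) ltac:(lia)). rewrite <- sum_n_csum in HN.
    change (Cmod (sum_n (G := C_AbelianMonoid) a n - l)%C < eps)%R. destruct eps; simpl in *; lra.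
Qed.

Lemma Rpower_neg_le (a b e : R) :
  (0 < a <= b)%R -> (0 <= e)%R -> (Rpower b (- e) <= Rpower a (- e))%R.
Proof.
  intros H He. rewrite !Rpower_Ropp. apply Rinv_le_contravar; [apply exp_pos|].
  apply Rle_Rpower_l; auto.
Qed.

Lemma Rpower_neg_lim (eta : R) : (0 < eta)%R ->
  forall eps, (0 < eps)%R -> exists B, (1 <= B)%R /\ forall b, (B <= b)%R -> (Rpower b (- eta) <= eps)%R.
Proof.
  intros He eps Heps. set (B0 := exp (- ln eps / eta)).
  exists (Rmax 1 B0). split; [apply Rmax_l|]. intros b Hb.
  pose proof (Rmax_l 1 B0). pose proof (Rmax_r 1 B0).
  eapply Rle_trans; [apply (Rpower_neg_le B0 b)|]; try lra.
  - split; [apply exp_pos|lra].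
  - unfold Rpower, B0. rewrite ln_exp. replace (- eta * (- ln eps / eta))%R with (ln eps) by (field; lra).
    rewrite exp_ln; lra.
Qed.

Section Telescoping.
Context (q : nat) (hq : (1 <= q)%nat).
Notation qr := (INR q).

Definition strip_weight (h : C -> C) (b y : R) : C := RtoC (kappa y) * h (b, (qr * y)%R).
Definition strip_T (h : C -> C) (b : R) : C := TInt (strip_weight h b).

(** Two separate decays are recorded: the power of [b] makes the transform tend to 0 at infinity,
    and [dpow tau] is one integrable majorant for all abscissas [b]. *)
Definition strip_bound (h : C -> C) (C0 eta tau : R) : Prop :=
  (0 <= C0)%R /\ (0 < eta)%R /\ (1 < tau)%R /\
  forall b y, (1 <= b)%R ->
    (Cmod (strip_weight h b y) <= C0 * Rpower b (- eta) * dpow tau y)%R.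

Lemma qr_ge_1 : (1 <= qr)%R.
Proof. change 1%R with (INR 1). apply le_INR; auto. Qed.

Lemma continuous_strip_weight (h : C -> C) (b y : R) :
  contCC h (b, (qr * y)%R) -> contC (fun y => strip_weight h b y) y.
Proof.
  intros H. unfold strip_weight. apply contC_mult; [apply continuous_kappa_C|].
  apply (continuous_comp (V := CU) (W := CU) (fun t : R => (b, (qr * t)%R)) h); auto.
  apply contC_pair; simpl; [apply continuous_const|].
  apply (continuous_scal_r (V := R_NormedModule) qr (fun t => t)), continuous_id.
Qed.

Context (h dh : C -> C) (C0 eta tau : R).
Context (Hh : forall z, (0 < Re z)%R -> cderiv h z (dh z)).
Context (HB : strip_bound h C0 eta tau).

Lemma dominated_strip_weight (b : R) : (1 <= b)%R -> dominated (dpow tau) (strip_weight h b).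
Proof.
  destruct HB as (H0 & H1 & H2 & H3). intros Hb. split.
  - intros t. apply continuous_strip_weight. eapply cderiv_continuous, Hh. simpl; lra.
  - exists (C0 * Rpower b (- eta))%R. split; [|intros; apply H3; auto].
    apply Rmult_le_pos; [auto|left; apply exp_pos].
Qed.

(** Rescale the strip from [b] to [b + q] to width one around its centre [p], by H z = h (p + q z).
    Then [strip_step] applies with error O (1 / N) at height [N]; the chain rule produces the factor
    q. *)
Lemma strip_T_step (b : R) : (1 <= b)%R ->
  strip_T h (b + qr) - strip_T h b = RtoC qr * dh (RtoC (b + qr / 2)).
Proof.
  intros Hb. pose proof qr_ge_1 as Hq. pose proof HB as (H0 & H1 & H2 & H3).
  pose proof (integrable_bound_dpow tau H2) as ID.
  set (p := (b + qr / 2)%R).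
  set (H := fun z => h (RtoC p + RtoC qr * z)).
  assert (DH : forall z, (- / 2 <= Re z)%R -> cderiv H z (dh (RtoC p + RtoC qr * z) * RtoC qr)).
  { intros z Hz. apply (cderiv_comp h (fun w => RtoC p + RtoC qr * w)).
    - apply Hh. rewrite re_plus, re_scal_l. simpl. unfold p. nra.
    - apply (cderiv_eq _ _ (0 + RtoC qr * 1)); [ring|].
      apply cderiv_plus; [apply cderiv_const|apply cderiv_scal, cderiv_id]. }
  assert (Hpt : forall x y, RtoC p + RtoC qr * (x, y) = ((p + qr * x)%R, (qr * y)%R)).
  { intros x y. unfold RtoC, Cplus, Cmult; simpl. f_equal; ring. }
  set (dH := dh (RtoC p) * RtoC qr).
  assert (D0 : cderiv H 0 dH).
  { generalize (DH 0). replace (RtoC p + RtoC qr * 0) with (RtoC p) by ring.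
    intros K; apply K. simpl. lra. }
  enough (Z : strip_T h (b + qr) - strip_T h b - dH = 0).
  { unfold dH in Z. rewrite <- (Cplus_0_l (RtoC qr * _)), <- Z. ring. }
  apply (Cmod_le_eps_0 _ 2). intros eps Heps.
  assert (Dm : dominated (dpow tau) (strip_weight h (b + qr))) by (apply dominated_strip_weight; lra).
  assert (Dm' : dominated (dpow tau) (strip_weight h b)) by (apply dominated_strip_weight; lra).
  unfold strip_T. rewrite <- (TInt_minus _ _ ID) by auto.
  set (f := fun t => strip_weight h (b + qr) t - strip_weight h b t).
  assert (Df : dominated (dpow tau) f).
  { unfold f. destruct (dominated_plus _ _ _ Dm (dominated_scal _ (- (1)) _ Dm')) as [F1 F2].
    split.
    - intros t. apply contC_minus; [apply Dm|apply Dm'].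
    - destruct F2 as (K & HK & F2). exists K. split; auto. intros t.
      replace (strip_weight h (b + qr) t - strip_weight h b t) with
        (strip_weight h (b + qr) t + - (1) * strip_weight h b t) by ring. auto. }
  destruct (TInt_correct _ _ ID f Df eps Heps) as [N0 HN].
  set (A := (Cmod (H 0) + Cmod dH)%R).
  assert (HA : (0 <= A)%R) by (unfold A; pose proof (Cmod_ge_0 (H 0)); pose proof (Cmod_ge_0 dH); lra).
  (* A height beyond this number brings the error of [strip_step] below eps. *)
  destruct (nfloor_ex (130 * (C0 + A) / eps)) as [N1 [_ HN1]].
  { apply Rmult_le_pos; [lra|left; apply Rinv_0_lt_compat; lra]. }
  set (N := Nat.max (S N0) (S N1)).
  specialize (HN N ltac:(lia)).
  assert (HY : (1 <= INR N)%R) by (change 1%R with (INR 1); apply le_INR; lia).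
  assert (HY1 : (INR N1 + 1 <= INR N)%R) by (rewrite <- S_INR; apply le_INR; lia).
  assert (K : (Cmod (SInt f N - dH)%C <= 130 * (C0 / (1 + INR N) + A / (1 + INR N)))%R).
  { rewrite (CInt_ext f (fun y => RtoC (kappa y) * (H ((/ 2)%R, y) - H ((- / 2)%R, y)))).
    - apply strip_step; auto.
      + intros x y Hx Hy. eexists. apply DH. simpl; lra.
      + assert (B : forall x y, (- / 2 <= x <= / 2)%R -> Rabs y = INR N ->
          (Cmod (H (x, y)) * exp (- (2 * PI * INR N)) <= C0 / (1 + INR N))%R).
        { intros x y Hx Hy. unfold H. rewrite Hpt.
          specialize (H3 (p + qr * x)%R y). unfold strip_weight in H3.
          rewrite Cmod_mult, Cmod_R in H3. pose proof (kappa_pos y) as KP.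
          rewrite (Rabs_pos_eq (kappa y)) in H3 by lra.
          assert (Hb' : (1 <= p + qr * x)%R) by (unfold p; nra). specialize (H3 Hb').
          pose proof (kappa_ge y) as KG. rewrite Hy in KG.
          pose proof PI2_1. pose proof (exp_pos (- (2 * PI * INR N))) as EP.
          assert (R1 : (Rpower (p + qr * x) (- eta) <= 1)%R).
          { replace 1%R with (Rpower 1 (- eta)) by (unfold Rpower; rewrite ln_1, Rmult_0_r, exp_0; auto).
            apply Rpower_neg_le; lra. }
          pose proof (dpow_1_le tau y ltac:(lra)) as R2. rewrite Hy in R2.
          set (c := Cmod (h ((p + qr * x)%R, (qr * y)%R))) in *.
          assert (Hc : (0 <= c)%R) by apply Cmod_ge_0.
          apply Rle_trans with (kappa y * c)%R.
          - rewrite Rmult_comm. apply Rmult_le_compat_r; auto. nra.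
          - eapply Rle_trans; [apply H3|]. unfold Rdiv. rewrite <- (Rmult_1_r C0) at 2.
            apply Rmult_le_compat; auto.
            + apply Rmult_le_pos; [auto|left; apply exp_pos].
            + left; apply dpow_pos.
            + apply Rmult_le_compat_l; auto. }
        intros x Hx. split; apply B; auto; [|rewrite Rabs_Ropp]; apply Rabs_pos_eq; lra.
    - lra.
    - intros t _. unfold f, strip_weight, H. rewrite !Hpt.
      replace (p + qr * / 2)%R with (b + qr)%R by (unfold p; field).
      replace (p + qr * - / 2)%R with b by (unfold p; field). ring. }
  assert (K2 : (130 * (C0 / (1 + INR N) + A / (1 + INR N)) <= eps)%R).
  { apply (Rmult_le_reg_r (1 + INR N)); [lra|].
    replace (130 * (C0 / (1 + INR N) + A / (1 + INR N)) * (1 + INR N))%R with (130 * (C0 + A))%R by (field; lra).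
    apply (Rmult_lt_compat_r eps) in HN1; auto.
    unfold Rdiv in HN1. rewrite Rmult_assoc, Rinv_l, Rmult_1_r in HN1 by lra. nra. }
  replace (TInt f - dH) with ((SInt f N - dH) - (SInt f N - TInt f)) by ring.
  eapply Rle_trans; [apply Cmod_triangle_minus|]. lra.
Qed.

Lemma strip_T_lim :
  forall eps, (0 < eps)%R -> exists B, (1 <= B)%R /\ forall b, (B <= b)%R -> (Cmod (strip_T h b) <= eps)%R.
Proof.
  pose proof HB as (H0 & H1 & H2 & H3). intros eps Heps.
  pose proof (integrable_bound_dpow tau H2) as ID. set (M := (2 / (tau - 1))%R) in *.
  assert (HM : (0 < M)%R) by (apply Rdiv_lt_0_compat; lra).
  assert (He : (0 < eps / (2 * M * (C0 + 1)))%R).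
  { apply Rdiv_lt_0_compat; auto. apply Rmult_lt_0_compat; lra. }
  destruct (Rpower_neg_lim eta H1 _ He) as (B & HB1 & K).
  exists B. split; auto. intros b Hb. specialize (K b Hb).
  assert (Dm : dominated (dpow tau) (strip_weight h b)) by (apply dominated_strip_weight; lra).
  pose proof (exp_pos (- eta * ln b)) as P. fold (Rpower b (- eta)) in P.
  eapply Rle_trans.
  { apply (Cmod_TInt_le _ _ ID _ (C0 * Rpower b (- eta))%R).
    - apply Rmult_le_pos; lra.
    - apply Dm.
    - intros t. apply H3. lra. }
  apply Rle_trans with (2 * M * (C0 + 1) * (eps / (2 * M * (C0 + 1))))%R.
  - replace (2 * (C0 * Rpower b (- eta) * M))%R with (2 * M * (C0 * Rpower b (- eta)))%R by ring.
    rewrite (Rmult_assoc (2 * M)). apply Rmult_le_compat_l; [lra|].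
    apply Rmult_le_compat; lra.
  - right. field. lra.
Qed.

Context (chi : Z -> C) (Hchi : forall a, chi (a + Z.of_nat q)%Z = chi a).

Lemma chi_period_mult (a : Z) (j : nat) : chi (a + Z.of_nat (q * j))%Z = chi a.
Proof.
  induction j as [|j IH].
  - f_equal. lia.
  - rewrite <- IH, <- (Hchi (a + Z.of_nat (q * j))). f_equal. lia.
Qed.

(** In the class of r, the strip starting at r + q/2 + q j has centre r + q (j + 1), the next member
    of the class. The first member r would need the strip starting at r - q/2, which may leave the
    right half-plane, so its term stays explicit. *)
Lemma telescoping (J : nat) :
  csum (fun n => chi (Z.of_nat (S n)) * dh (RtoC (INR (S n)))) (q * S J) =
  csum (fun i => chi (Z.of_nat (S i)) * (dh (RtoC (INR (S i))) +
    / RtoC qr * (strip_T h (INR (S i) + qr / 2 + qr * INR J) - strip_T h (INR (S i) + qr / 2)))) q.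
Proof.
  pose proof qr_ge_1 as Hq.
  induction J as [|J IH].
  - rewrite Nat.mul_1_r. apply csum_ext. intros i Hi. simpl (INR 0).
    replace (INR (S i) + qr / 2 + qr * 0)%R with (INR (S i) + qr / 2)%R by ring. ring.
  - replace (q * S (S J))%nat with (q * S J + q)%nat by lia.
    rewrite csum_add, IH, <- csum_plus. apply csum_ext. intros i Hi.
    replace (Z.of_nat (S (q * S J + i)))%Z with (Z.of_nat (S i) + Z.of_nat (q * S J))%Z by lia.
    rewrite chi_period_mult.
    set (b := (INR (S i) + qr / 2 + qr * INR J)%R).
    assert (Eb : (INR (S i) + qr / 2 + qr * INR (S J))%R = (b + qr)%R) by (unfold b; rewrite (S_INR J); ring).
    assert (Ep : INR (S (q * S J + i)) = (b + qr / 2)%R).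
    { unfold b. rewrite !S_INR, plus_INR, mult_INR, S_INR. field. }
    rewrite Eb, Ep.
    assert (Hb : (1 <= b)%R).
    { unfold b. rewrite S_INR. pose proof (pos_INR i). pose proof (pos_INR J). nra. }
    assert (N : RtoC qr <> 0) by (intros E; apply RtoC_inj in E; lra).
    replace (dh (RtoC (b + qr / 2))) with (/ RtoC qr * (RtoC qr * dh (RtoC (b + qr / 2)))) by (field; auto).
    rewrite <- (strip_T_step b Hb). ring.
Qed.

(** Convergence is given, so it suffices to follow the partial sums made of whole blocks; there the
    far end of each telescoping sum tends to 0 by [strip_T_lim]. *)
Lemma telescoping_series (l : C) :
  is_seriesC (fun n => chi (Z.of_nat (S n)) * dh (RtoC (INR (S n)))) l ->
  l = csum (fun i => chi (Z.of_nat (S i)) * (dh (RtoC (INR (S i))) -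
    / RtoC qr * strip_T h (INR (S i) + qr / 2))) q.
Proof.
  intros HS. pose proof qr_ge_1 as Hq. rewrite is_series_csum in HS.
  set (rhs := csum _ q).
  enough (Z : rhs - l = 0).
  { rewrite <- (Cplus_0_l l), <- Z. ring. }
  destruct (finite_bound (fun i => chi (Z.of_nat (S i))) q) as (X & HX & chiB).
  apply (Cmod_le_eps_0 _ (1 + qr * X)). intros eps Heps.
  destruct (HS eps Heps) as [n0 Hn0].
  destruct (strip_T_lim eps Heps) as (B & HB1 & HT).
  destruct (nfloor_ex B) as [j [_ Hj]]; [lra|].
  set (J := Nat.max n0 (S j)).
  assert (HJ : (B <= INR J)%R).
  { apply Rle_trans with (INR (S j)); [rewrite S_INR; lra|apply le_INR; lia]. }
  assert (HnJ : (n0 <= q * S J)%nat) by (unfold J; nia).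
  specialize (Hn0 _ HnJ). rewrite telescoping in Hn0.
  set (P := csum _ q) in Hn0.
  replace (rhs - l) with ((P - l) - (P - rhs)) by ring.
  eapply Rle_trans; [apply Cmod_triangle_minus|].
  rewrite Rmult_plus_distr_r, Rmult_1_l. apply Rplus_le_compat; auto.
  unfold P, rhs. rewrite <- csum_minus.
  rewrite Rmult_assoc. apply Cmod_csum_le. intros i Hi.
  match goal with |- (Cmod ?e <= _)%R => replace e with
    (chi (Z.of_nat (S i)) * (/ RtoC qr * strip_T h (INR (S i) + qr / 2 + qr * INR J))) by ring end.
  rewrite !Cmod_mult. apply Rmult_le_compat; auto using Cmod_ge_0.
  - apply Rmult_le_pos; apply Cmod_ge_0.
  - rewrite Cmod_inv by (intros E; apply RtoC_inj in E; lra).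
    rewrite Cmod_R, Rabs_pos_eq by lra.
    assert (/ qr <= 1)%R by (rewrite <- Rinv_1; apply Rinv_le_contravar; lra).
    assert (0 < / qr)%R by (apply Rinv_0_lt_compat; lra).
    assert (HT' : (Cmod (strip_T h (INR (S i) + qr / 2 + qr * INR J)) <= eps)%R).
    { apply HT. rewrite S_INR. pose proof (pos_INR i). pose proof (pos_INR J). nra. }
    pose proof (Cmod_ge_0 (strip_T h (INR (S i) + qr / 2 + qr * INR J))). nra.
Qed.

End Telescoping.

(** * Growth in the strip *)

Definition cpow_neg (s z : C) : C := Cexp (- (s * Clog z)).

Lemma cpow_neg_plus (s t z : C) : cpow_neg (s + t) z = cpow_neg s z * cpow_neg t z.
Proof. unfold cpow_neg. rewrite <- Cexp_plus. f_equal. ring. Qed.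

Lemma cpow_neg_1 (z : C) : (0 < Re z)%R -> cpow_neg 1 z = / z.
Proof.
  intros H. unfold cpow_neg. rewrite Cmult_1_l, Cexp_opp, Cexp_Clog; auto.
Qed.

Lemma Cmult_pow_sq (z : C) (k : nat) : z ^ (2 * k) = (z * z) ^ k.
Proof. rewrite Cpow_mult_r. f_equal. simpl. ring. Qed.

Lemma cpow_neg_minus_INR (s z : C) (k : nat) : (0 < Re z)%R ->
  cpow_neg (s - RtoC (INR k)) z = cpow_neg s z * z ^ k.
Proof.
  intros H. unfold Cminus. rewrite cpow_neg_plus. f_equal. unfold cpow_neg.
  replace (- (- RtoC (INR k) * Clog z)) with (RtoC (INR k) * Clog z) by ring.
  rewrite Cexp_INR_mult, Cexp_Clog; auto.
Qed.

Lemma cderiv_cpow_neg (s z : C) : (0 < Re z)%R ->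
  cderiv (cpow_neg s) z (- (s * cpow_neg (s + 1) z)).
Proof.
  intros H. rewrite cpow_neg_plus, cpow_neg_1 by auto.
  apply (cderiv_eq _ _ (Cexp (- (s * Clog z)) * (- (s * / z)))).
  - unfold cpow_neg. ring.
  - unfold cpow_neg. apply (cderiv_comp Cexp (fun w => - (s * Clog w))); [apply cderiv_Cexp|].
    apply cderiv_opp, cderiv_scal, cderiv_Clog; auto.
Qed.

Definition hcos (s : C) (th : R) (z : C) : C := cpow_neg s z * ccos (RtoC th * z).

Definition dhcos (s : C) (th : R) (z : C) : C :=
  - (s * cpow_neg (s + 1) z * ccos (RtoC th * z) + RtoC th * (cpow_neg s z * csin (RtoC th * z))).

Lemma cderiv_hcos (s : C) (th : R) (z : C) : (0 < Re z)%R -> cderiv (hcos s th) z (dhcos s th z).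
Proof.
  intros H. apply (cderiv_eq _ _ (- (s * cpow_neg (s + 1) z) * ccos (RtoC th * z) +
    cpow_neg s z * (- csin (RtoC th * z) * (RtoC th * 1)))).
  - unfold dhcos. ring.
  - unfold hcos. apply (cderiv_mult (cpow_neg s) (fun w => ccos (RtoC th * w))); [apply cderiv_cpow_neg; auto|].
    apply (cderiv_comp ccos (fun w => RtoC th * w) z (- csin (RtoC th * z)) (RtoC th * 1));
      [apply (cderiv_ccos (RtoC th * z))|apply cderiv_scal, cderiv_id].
Qed.

(** The argument of [z] is at most PI / 2 in absolute value, so the imaginary part of [s] costs a
    constant factor only. *)
Lemma Cmod_cpow_neg_le (s z : C) : (0 < Re z)%R ->
  (Cmod (cpow_neg s z) <= exp (Rabs (Im s) * (PI / 2)) * Rpower (Cmod z) (- Re s))%R.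
Proof.
  intros H. unfold cpow_neg, Rpower. rewrite Cmod_Cexp, <- exp_plus. apply exp_le.
  rewrite re_opp, re_mult. change (Re (Clog z)) with (ln (Cmod z)).
  pose proof (Im_Clog z) as B.
  assert (Im s * Im (Clog z) <= Rabs (Im s) * (PI / 2))%R.
  { eapply Rle_trans; [apply Rle_abs|]. rewrite Rabs_mult. apply Rmult_le_compat_l; auto using Rabs_pos. }
  lra.
Qed.

Lemma Cmod_ccos_le (th : R) (z : C) : (Cmod (ccos (RtoC th * z)) <= exp (Rabs th * Rabs (Im z)))%R.
Proof.
  unfold ccos. rewrite Cmod_div by apply C2_nz. rewrite Cmod_R, (Rabs_pos_eq 2) by lra.
  pose proof (Cmod_triangle (Cexp (Ci * (RtoC th * z))) (Cexp (- (Ci * (RtoC th * z))))) as T.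
  rewrite Cmod_exp_Ci, Cmod_exp_opp_Ci, im_scal_l in T. rewrite <- Rabs_mult.
  assert (exp (th * Im z) <= exp (Rabs (th * Im z)))%R by (apply exp_le, Rle_abs).
  assert (exp (- (th * Im z)) <= exp (Rabs (th * Im z)))%R
    by (apply exp_le; rewrite <- Rabs_Ropp; apply Rle_abs).
  lra.
Qed.

Definition cos_term (k : nat) : C := RtoC ((-1) ^ k / INR (fact (2 * k))).

Definition cos_poly (n : nat) (Z : C) : C := csum (fun k => cos_term k * Z ^ (2 * k)) n.

(** Averaging the exponential remainders at iZ and -iZ cancels the terms of odd order and leaves the
    cosine terms. *)
Lemma cos_poly_rem (n : nat) (Z : C) :
  ccos Z - cos_poly n Z = (exp_rem (2 * n) (Ci * Z) + exp_rem (2 * n) (- (Ci * Z))) / 2.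
Proof.
  induction n as [|n IH].
  - unfold cos_poly, ccos; simpl. ring.
  - unfold cos_poly in *. cbn [csum].
    replace (ccos Z - (csum (fun k => cos_term k * Z ^ (2 * k)) n + cos_term n * Z ^ (2 * n)))
      with (ccos Z - csum (fun k => cos_term k * Z ^ (2 * k)) n - cos_term n * Z ^ (2 * n)) by ring.
    rewrite IH. replace (2 * S n)%nat with (S (S (2 * n))) by lia.
    set (m := (2 * n)%nat).
    change (exp_rem (S (S m)) (Ci * Z)) with
      (exp_rem m (Ci * Z) - (Ci * Z) ^ m / RtoC (INR (fact m)) - (Ci * Z) ^ S m / RtoC (INR (fact (S m)))).
    change (exp_rem (S (S m)) (- (Ci * Z))) with
      (exp_rem m (- (Ci * Z)) - (- (Ci * Z)) ^ m / RtoC (INR (fact m)) - (- (Ci * Z)) ^ S m / RtoC (INR (fact (S m)))).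
    assert (E1 : (Ci * Z) ^ m = RtoC ((-1) ^ n) * Z ^ m).
    { unfold m. rewrite Cpow_mult_l. f_equal. rewrite Cmult_pow_sq, Ci_sq.
      rewrite RtoC_pow. f_equal. unfold RtoC, Copp; simpl; f_equal; ring. }
    assert (E2 : (- (Ci * Z)) ^ m = RtoC ((-1) ^ n) * Z ^ m).
    { rewrite <- E1. unfold m. rewrite !Cmult_pow_sq. f_equal. ring. }
    rewrite !Cpow_S, E1, E2. unfold cos_term. fold m.
    unfold Rdiv. rewrite RtoC_mult, RtoC_inv by apply INR_fact_neq_0.
    field. split; [apply RtoC_fact_neq_0|apply RtoC_fact_neq_0].
Qed.

(** The bound does not depend on [n]: it furnishes the common majorant when the cosine series is
    integrated. *)
Lemma Cmod_cos_poly_le (n : nat) (Z : C) : (Cmod (cos_poly n Z) <= exp (Cmod Z))%R.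
Proof.
  assert (P : forall j, (0 <= Cmod Z ^ j / INR (fact j))%R).
  { intros j. apply Rmult_le_pos; [apply pow_le, Cmod_ge_0|]. left; apply Rinv_0_lt_compat, INR_fact_lt_0. }
  assert (E : forall k, (Cmod (cos_term k * Z ^ (2 * k)) = Cmod Z ^ (2 * k) / INR (fact (2 * k)))%R).
  { intros k. unfold cos_term. rewrite Cmod_mult, Cmod_R, Cmod_pow. unfold Rdiv.
    rewrite Rabs_mult, <- RPow_abs. replace (Rabs (-1)) with 1%R by (rewrite Rabs_left; lra). rewrite pow1.
    rewrite Rabs_pos_eq by (left; apply Rinv_0_lt_compat, INR_fact_lt_0). ring. }
  destruct n as [|n]; [unfold cos_poly; simpl; rewrite Cmod_0; left; apply exp_pos|].
  eapply Rle_trans; [|apply (exp_ge_taylor _ (2 * n)), Cmod_ge_0].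
  unfold cos_poly. induction n as [|n IH].
  - cbn [csum]. rewrite Cplus_0_l, E. simpl. lra.
  - cbn [csum] in *. eapply Rle_trans; [apply Cmod_triangle|].
    rewrite (E (S n)). replace (2 * S n)%nat with (S (S (2 * n))) by lia.
    rewrite !tech5. specialize (P (S (2 * n))). lra.
Qed.

Lemma Cmod_ccos_minus_poly_le (n : nat) (Z : C) :
  (Cmod (ccos Z - cos_poly n Z) <= (2 * Cmod Z) ^ (2 * n) / INR (fact (2 * n)) * exp (Cmod Z))%R.
Proof.
  rewrite cos_poly_rem, Cmod_div by apply C2_nz. rewrite Cmod_R, (Rabs_pos_eq 2) by lra.
  pose proof (Cmod_triangle (exp_rem (2 * n) (Ci * Z)) (exp_rem (2 * n) (- (Ci * Z)))) as T.
  pose proof (Cmod_exp_rem_le (2 * n) (Ci * Z)) as B1.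
  pose proof (Cmod_exp_rem_le (2 * n) (- (Ci * Z))) as B2.
  rewrite Cmod_opp in B2. rewrite Cmod_mult, Cmod_Ci, Rmult_1_l in B1, B2. lra.
Qed.

Lemma kappa_exp_le (y : R) : (kappa y * exp (2 * PI * Rabs y) <= 2 * PI)%R.
Proof.
  eapply Rle_trans; [apply Rmult_le_compat_r; [left; apply exp_pos|apply kappa_le]|].
  rewrite Rmult_assoc, <- exp_plus.
  replace (- (2 * PI * Rabs y) + 2 * PI * Rabs y)%R with 0%R by ring. rewrite exp_0. lra.
Qed.

Section Strip.
Context (q : nat) (hq : (1 <= q)%nat).
Notation qr := (INR q).

Lemma Cmod_strip_point (b y : R) : (1 <= b)%R ->
  (b <= Cmod (b, qr * y)%R /\ (1 + Rabs y) / 2 <= Cmod (b, qr * y)%R /\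
   Cmod (b, qr * y)%R <= b + qr * Rabs y)%R.
Proof.
  intros Hb. pose proof (qr_ge_1 q hq) as Hq. pose proof (Rabs_pos y).
  pose proof (re_le_Cmod (b, (qr * y)%R)) as K1. pose proof (im_le_Cmod (b, (qr * y)%R)) as K2.
  pose proof (Cmod_le_re_im (b, (qr * y)%R)) as K3. simpl in K1, K2, K3.
  rewrite Rabs_mult, (Rabs_pos_eq qr) in K2, K3 by lra. rewrite (Rabs_pos_eq b) in K1, K3 by lra.
  repeat split; nra.
Qed.

(** The exponent Re s is split into (Re s - 1)/2, spent with |z| >= b on decay in [b], and (1 + Re
    s)/2 > 1, spent with |z| >= (1 + |y|)/2 on integrability in [y]. The power of 2 comes from the
    last denominator. *)
Lemma Cmod_cpow_neg_strip (s : C) (b y : R) : (1 <= b)%R -> (1 < Re s)%R ->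
  (Cmod (cpow_neg s (b, qr * y)%R) <= exp (Rabs (Im s) * (PI / 2)) * (Rpower 2 ((1 + Re s) / 2) *
     Rpower b (- ((Re s - 1) / 2)) * dpow ((1 + Re s) / 2) y))%R.
Proof.
  intros Hb Hs. destruct (Cmod_strip_point b y Hb) as (K1 & K2 & _).
  eapply Rle_trans; [apply Cmod_cpow_neg_le; simpl; lra|].
  apply Rmult_le_compat_l; [left; apply exp_pos|].
  set (m := Cmod (b, (qr * y)%R)) in *. pose proof (Rabs_pos y).
  replace (- Re s)%R with (- ((Re s - 1) / 2) + - ((1 + Re s) / 2))%R by field.
  rewrite Rpower_plus.
  replace (Rpower 2 ((1 + Re s) / 2) * Rpower b (- ((Re s - 1) / 2)) * dpow ((1 + Re s) / 2) y)%R
    with (Rpower b (- ((Re s - 1) / 2)) * (Rpower 2 ((1 + Re s) / 2) * dpow ((1 + Re s) / 2) y))%R by ring.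
  apply Rmult_le_compat; try (left; apply exp_pos).
  - apply Rpower_neg_le; lra.
  - eapply Rle_trans; [apply (Rpower_neg_le ((1 + Rabs y) / 2)); lra|].
    unfold dpow. right. unfold Rdiv at 1. rewrite <- Rpower_mult_distr by lra.
    rewrite Rmult_comm. f_equal. unfold Rpower. rewrite ln_Rinv by lra. f_equal. ring.
Qed.

(** Here [kappa] supplies all the decay in [y], for which 2 is an arbitrary exponent above 1;
    positivity of Re w is spent on the decay in [b]. *)
Lemma strip_bound_cpow_neg (w : C) : (0 < Re w)%R ->
  exists C0 eta tau, strip_bound q (cpow_neg w) C0 eta tau.
Proof.
  intros Hw. destruct (kappa_moment 0) as (K & HK & B).
  exists (exp (Rabs (Im w) * (PI / 2)) * K)%R, (Re w), 2%R.
  pose proof (exp_pos (Rabs (Im w) * (PI / 2))) as EP.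
  split; [apply Rmult_le_pos; lra|]. split; [auto|]. split; [lra|].
  intros b y Hb. destruct (Cmod_strip_point b y Hb) as (K1 & _ & _).
  unfold strip_weight. rewrite Cmod_mult, Cmod_R, Rabs_pos_eq by (left; apply kappa_pos).
  specialize (B y). rewrite Rpower_O, Rmult_1_r in B by (pose proof (Rabs_pos y); lra).
  pose proof (Cmod_cpow_neg_le w (b, qr * y)%R ltac:(simpl; lra)) as B2.
  assert (B3 : (Rpower (Cmod (b, qr * y)%R) (- Re w) <= Rpower b (- Re w))%R)
    by (apply Rpower_neg_le; lra).
  pose proof (kappa_pos y). pose proof (dpow_pos 2 y).
  replace (exp (Rabs (Im w) * (PI / 2)) * K * Rpower b (- Re w) * dpow 2 y)%R with
    ((K * dpow 2 y) * (exp (Rabs (Im w) * (PI / 2)) * Rpower b (- Re w)))%R by ring.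
  apply Rmult_le_compat; auto using Cmod_ge_0; [lra|].
  eapply Rle_trans; [apply B2|]. apply Rmult_le_compat_l; lra.
Qed.

Context (s : C) (th : R) (hs : (1 < Re s)%R) (hth : (qr * Rabs th <= 2 * PI)%R).

(* [kappa] decays like [e^{-2 PI |y|}], which exactly absorbs the growth of the
   cosine when [q |th| = 2 PI]; the power [z^{-s}] provides integrability. *)
Lemma strip_growth (b y K : R) (v : C) : (1 <= b)%R -> (0 <= K)%R ->
  (Cmod v <= K * exp (Rabs th * (qr * Rabs y)))%R ->
  (Cmod (RtoC (kappa y) * (cpow_neg s (b, qr * y)%R * v))%C <=
    K * (2 * PI * exp (Rabs (Im s) * (PI / 2)) * Rpower 2 ((1 + Re s) / 2)) *
    Rpower b (- ((Re s - 1) / 2)) * dpow ((1 + Re s) / 2) y)%R.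
Proof.
  intros Hb HK Hv. pose proof (qr_ge_1 q hq) as Hq. pose proof (Rabs_pos y).
  rewrite !Cmod_mult, Cmod_R, Rabs_pos_eq by (left; apply kappa_pos).
  pose proof (Cmod_cpow_neg_strip s b y Hb hs) as B1.
  assert (B2 : (kappa y * Cmod v <= K * (2 * PI))%R).
  { apply Rle_trans with (kappa y * (K * exp (2 * PI * Rabs y)))%R.
    - apply Rmult_le_compat_l; [left; apply kappa_pos|]. eapply Rle_trans; [apply Hv|].
      apply Rmult_le_compat_l; auto. apply exp_le. nra.
    - rewrite <- Rmult_assoc, (Rmult_comm (kappa y)), Rmult_assoc.
      apply Rmult_le_compat_l; auto. apply kappa_exp_le. }
  set (A := Cmod (cpow_neg s (b, qr * y)%R)) in *.
  replace (kappa y * (A * Cmod v))%R with ((kappa y * Cmod v) * A)%R by ring.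
  eapply Rle_trans; [apply Rmult_le_compat; [|apply Cmod_ge_0|apply B2|apply B1]|right; ring].
  apply Rmult_le_pos; [left; apply kappa_pos|apply Cmod_ge_0].
Qed.

Lemma strip_bound_hcos : exists C0 eta tau, strip_bound q (hcos s th) C0 eta tau.
Proof.
  exists (1 * (2 * PI * exp (Rabs (Im s) * (PI / 2)) * Rpower 2 ((1 + Re s) / 2)))%R,
    ((Re s - 1) / 2)%R, ((1 + Re s) / 2)%R.
  pose proof PI_RGT_0. pose proof (exp_pos (Rabs (Im s) * (PI / 2))).
  pose proof (exp_pos ((1 + Re s) / 2 * ln 2)).
  split; [rewrite Rmult_1_l; apply Rmult_le_pos; [apply Rmult_le_pos; lra|unfold Rpower; lra]|].
  split; [lra|]. split; [lra|].
  intros b y Hb. unfold strip_weight, hcos.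
  apply strip_growth; auto; [lra|]. rewrite Rmult_1_l.
  eapply Rle_trans; [apply Cmod_ccos_le|]. simpl Im. rewrite Rabs_mult, (Rabs_pos_eq qr) by apply pos_INR.
  lra.
Qed.

End Strip.

(** * Taylor expansions under the integral *)

Lemma TInt_csum (d : R -> R) (M : R) (f : nat -> R -> C) (n : nat) :
  integrable_bound d M -> (forall i, dominated d (f i)) ->
  dominated d (fun t => csum (fun i => f i t) n) /\
  TInt (fun t => csum (fun i => f i t) n) = csum (fun i => TInt (f i)) n.
Proof.
  intros HD Hf. induction n as [|n [I1 I2]]; cbn [csum].
  - split.
    + split; [intros; apply contC_const|]. exists 0%R. split; [lra|].
      intros t. rewrite Cmod_0. lra.
    + apply is_TInt_unique. intros eps Heps. exists O. intros N _.
      rewrite CInt_const. replace (RtoC (INR N - - INR N) * 0 - 0) with (RtoC 0) by ring.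
      rewrite Cmod_0; lra.
  - split; [apply dominated_plus; auto|].
    rewrite (TInt_plus d M HD), I2; auto.
Qed.

Lemma continuous_exp_rem_C (n : nat) (z : C) : contCC (exp_rem n) z.
Proof.
  induction n as [|n IH]; [apply continuous_Cexp|].
  apply (contC_minus CU (exp_rem n) (fun z => z ^ n / RtoC (INR (fact n)))); auto.
  apply (contC_mult CU (fun z => z ^ n)); [|apply (contC_const CU)].
  clear IH. induction n as [|n IH]; [apply (contC_const CU)|].
  apply (contC_mult CU (fun z => z)); [apply contC_id|auto].
Qed.

Lemma Cmod_Cexp_le (z : C) : (Cmod (Cexp z) <= exp (Cmod z))%R.
Proof.
  rewrite Cmod_Cexp. apply exp_le. eapply Rle_trans; [apply Rle_abs|apply re_le_Cmod].
Qed.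

Section LogMoments.
Context (q : nat) (hq : (1 <= q)%nat) (b : R) (hb : (1 <= b)%R) (tau : R).
Notation qr := (INR q).

(** As |log z| <= ln |z| + PI / 2 on this line, the exponential of m |log z| grows like a power of 1
    + |y|, and [kappa] absorbs every power. *)
Lemma kappa_log_moment (m : R) : (0 <= m)%R -> exists K, (0 <= K)%R /\ forall y,
  (kappa y * exp (m * Cmod (Clog (b, qr * y)%R)) <= K * dpow tau y)%R.
Proof.
  intros Hm. pose proof (qr_ge_1 q hq) as Hq. pose proof PI_RGT_0.
  destruct (kappa_moment (m + tau - 2)) as (K & HK & B).
  set (A := (exp (m * (PI / 2)) * Rpower (b + qr) m)%R).
  assert (HA : (0 < A)%R) by (apply Rmult_lt_0_compat; apply exp_pos).
  exists (A * K)%R. split; [apply Rmult_le_pos; lra|].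
  intros y. destruct (Cmod_strip_point q hq b y hb) as (K1 & _ & K3).
  pose proof (Rabs_pos y) as Hy.
  assert (L : (exp (m * Cmod (Clog (b, qr * y)%R)) <= A * Rpower (1 + Rabs y) m)%R).
  { unfold A. rewrite Rmult_assoc, Rpower_mult_distr by lra.
    unfold Rpower. rewrite <- exp_plus. apply exp_le. rewrite <- Rmult_plus_distr_l.
    apply Rmult_le_compat_l; auto.
    eapply Rle_trans; [apply Cmod_le_re_im|].
    pose proof (Im_Clog (b, qr * y)%R) as I.
    change (Re (Clog (b, (qr * y)%R))) with (ln (Cmod (b, (qr * y)%R))).
    assert (P : (0 <= ln (Cmod (b, qr * y)%R))%R) by (rewrite <- ln_1; apply ln_le; lra).
    rewrite Rabs_pos_eq by auto.
    assert (ln (Cmod (b, qr * y)%R) <= ln ((b + qr) * (1 + Rabs y)))%R by (apply ln_le; nra).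
    lra. }
  specialize (B y).
  apply Rle_trans with (kappa y * (A * Rpower (1 + Rabs y) m))%R.
  - apply Rmult_le_compat_l; [left; apply kappa_pos|auto].
  - replace m with ((m + tau - 2) + - (tau - 2))%R at 1 by ring. rewrite Rpower_plus.
    replace (dpow tau y) with (dpow 2 y * Rpower (1 + Rabs y) (- (tau - 2)))%R
      by (unfold dpow; rewrite <- Rpower_plus; f_equal; ring).
    pose proof (exp_pos (- (tau - 2) * ln (1 + Rabs y))) as P. fold (Rpower (1 + Rabs y) (- (tau - 2))) in P.
    set (X := Rpower (1 + Rabs y) (- (tau - 2))) in *.
    set (Y := Rpower (1 + Rabs y) (m + tau - 2)) in *.
    replace (kappa y * (A * (Y * X)))%R with (A * ((kappa y * Y) * X))%R by ring.
    replace (A * K * (dpow 2 y * X))%R with (A * ((K * dpow 2 y) * X))%R by ring.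
    apply Rmult_le_compat_l; [lra|]. apply Rmult_le_compat_r; lra.
Qed.

(** Derivatives of z^(-w) in w insert powers of - log z. The choices 1, - l and l^2 / 2 for [F l]
    give the Taylor coefficients of the transform in w, and a third order exponential remainder
    gives its error. *)
Definition log_weight (w : C) (F : C -> C) (y : R) : C :=
  strip_weight q (fun z => cpow_neg w z * F (Clog z)) b y.

Lemma continuous_log_weight (w : C) (F : C -> C) :
  (forall u, contCC F u) -> forall t, contC (log_weight w F) t.
Proof.
  intros HF t. unfold log_weight. apply continuous_strip_weight.
  assert (P : (0 < Re (b, qr * t))%R) by (simpl; lra).
  apply (contC_mult CU).
  - eapply cderiv_continuous, cderiv_cpow_neg, P.
  - apply (contC_comp Clog F); [apply continuous_Clog, P|apply HF].
Qed.

(** The constant [K] is fixed before [F] and the bound is linear in [A]; applied to a remainder of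
    size |v|^3 it therefore stays cubic in v after integration. *)
Lemma log_weight_bound (w : C) (m : R) : (0 <= m)%R -> exists K, (0 <= K)%R /\
  forall (F : C -> C) (A : R), (0 <= A)%R ->
  (forall u, (Cmod (F u) <= A * exp (m * Cmod u))%R) ->
  forall t, (Cmod (log_weight w F t) <= A * K * dpow tau t)%R.
Proof.
  intros Hm. pose proof (Cmod_ge_0 w).
  destruct (kappa_log_moment (Cmod w + m)) as (K & HK & B); [lra|].
  exists K. split; auto. intros F A HA HF t. unfold log_weight, strip_weight.
  set (l := Clog (b, (qr * t)%R)).
  rewrite !Cmod_mult, Cmod_R, Rabs_pos_eq by (left; apply kappa_pos).
  specialize (B t). fold l in B. rewrite Rmult_plus_distr_r, exp_plus in B.
  assert (B1 : (Cmod (cpow_neg w (b, qr * t)%R) <= exp (Cmod w * Cmod l))%R).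
  { unfold cpow_neg. fold l. eapply Rle_trans; [apply Cmod_Cexp_le|].
    rewrite Cmod_opp, Cmod_mult. lra. }
  specialize (HF l). pose proof (kappa_pos t).
  apply Rle_trans with (kappa t * (exp (Cmod w * Cmod l) * (A * exp (m * Cmod l))))%R.
  - apply Rmult_le_compat_l; [lra|]. apply Rmult_le_compat; auto using Cmod_ge_0.
  - replace (kappa t * (exp (Cmod w * Cmod l) * (A * exp (m * Cmod l))))%R with
      (A * (kappa t * (exp (Cmod w * Cmod l) * exp (m * Cmod l))))%R by ring.
    rewrite Rmult_assoc. apply Rmult_le_compat_l; auto.
Qed.

Lemma dominated_log_weight (w : C) (F : C -> C) (A m : R) :
  (0 <= A)%R -> (0 <= m)%R -> (forall u, contCC F u) ->
  (forall u, (Cmod (F u) <= A * exp (m * Cmod u))%R) -> dominated (dpow tau) (log_weight w F).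
Proof.
  intros HA Hm Hc HF. split; [apply continuous_log_weight; auto|].
  destruct (log_weight_bound w m Hm) as (K & HK & B). exists (A * K)%R.
  split; [apply Rmult_le_pos; auto|]. apply B; auto.
Qed.

Lemma dominated_cpow_neg (w : C) : dominated (dpow tau) (strip_weight q (cpow_neg w) b).
Proof.
  destruct (dominated_log_weight w (fun _ => 1) 1 0) as [D1 (K & HK & D2)]; try lra.
  - intros u; apply (contC_const CU).
  - intros u. rewrite Cmod_1, Rmult_0_l, exp_0. lra.
  - split.
    + intros t. apply continuous_strip_weight. eapply cderiv_continuous, cderiv_cpow_neg. simpl; lra.
    + exists K. split; auto. intros t. specialize (D2 t). unfold log_weight, strip_weight in *.
      rewrite Cmult_1_r in D2. auto.
Qed.

End LogMoments.

(* Cubic Taylor remainder at [w]: weak enough to be checked under the integral,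
   strong enough for differentiability and for removing the singularity of
   [f (w + v) / v] when [f w = 0]. *)
Definition taylor2 (f : C -> C) (w : C) : Prop :=
  exists (a0 a1 a2 : C) (M : R), (0 <= M)%R /\ forall v, (Cmod v <= 1)%R ->
    (Cmod (f (w + v) - (a0 + a1 * v + a2 * (v * v)))%C <= M * Cmod v ^ 3)%R.

Lemma taylor2_ext (f g : C -> C) (w : C) : (forall z, f z = g z) -> taylor2 f w -> taylor2 g w.
Proof.
  intros H (a0 & a1 & a2 & M & HM & B). exists a0, a1, a2, M. split; auto.
  intros v Hv. rewrite <- H. auto.
Qed.

Lemma taylor2_plus (f g : C -> C) (w : C) :
  taylor2 f w -> taylor2 g w -> taylor2 (fun z => f z + g z) w.
Proof.
  intros (a0 & a1 & a2 & M & HM & B) (b0 & b1 & b2 & N & HN & D).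
  exists (a0 + b0), (a1 + b1), (a2 + b2), (M + N)%R. split; [lra|].
  intros v Hv. specialize (B v Hv). specialize (D v Hv).
  match goal with |- (Cmod ?e <= _)%R => replace e with
    ((f (w + v) - (a0 + a1 * v + a2 * (v * v))) + (g (w + v) - (b0 + b1 * v + b2 * (v * v)))) by ring end.
  eapply Rle_trans; [apply Cmod_triangle|]. lra.
Qed.

Lemma taylor2_scal (k : C) (f : C -> C) (w : C) : taylor2 f w -> taylor2 (fun z => k * f z) w.
Proof.
  intros (a0 & a1 & a2 & M & HM & B). pose proof (Cmod_ge_0 k).
  exists (k * a0), (k * a1), (k * a2), (Cmod k * M)%R. split; [apply Rmult_le_pos; auto|].
  intros v Hv. specialize (B v Hv).
  match goal with |- (Cmod ?e <= _)%R => replace e with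
    (k * (f (w + v) - (a0 + a1 * v + a2 * (v * v)))) by ring end.
  rewrite Cmod_mult, Rmult_assoc. apply Rmult_le_compat_l; auto.
Qed.

Lemma taylor2_mul_id (f : C -> C) (w : C) : taylor2 f w -> taylor2 (fun z => z * f z) w.
Proof.
  intros (a0 & a1 & a2 & M & HM & B). pose proof (Cmod_ge_0 w). pose proof (Cmod_ge_0 a2).
  exists (w * a0), (a0 + w * a1), (a1 + w * a2), ((Cmod w + 1) * M + Cmod a2)%R.
  split; [pose proof (Rmult_le_pos (Cmod w + 1) M); lra|].
  intros v Hv. specialize (B v Hv). pose proof (Cmod_ge_0 v).
  match goal with |- (Cmod ?e <= _)%R => replace e with
    ((w + v) * (f (w + v) - (a0 + a1 * v + a2 * (v * v))) + a2 * (v * (v * v))) by ring end.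
  eapply Rle_trans; [apply Cmod_triangle|]. rewrite !Cmod_mult, Rmult_plus_distr_r.
  apply Rplus_le_compat; [|right; ring]. rewrite Rmult_assoc.
  apply Rmult_le_compat; auto using Cmod_ge_0.
  eapply Rle_trans; [apply Cmod_triangle|]. lra.
Qed.

Lemma taylor2_csum (f : nat -> C -> C) (n : nat) (w : C) :
  (forall i, (i < n)%nat -> taylor2 (f i) w) -> taylor2 (fun z => csum (fun i => f i z) n) w.
Proof.
  induction n as [|n IH]; intros H; cbn [csum].
  - exists 0, 0, 0, 0%R. split; [lra|]. intros v _.
    replace (0 - (0 + 0 * v + 0 * (v * v))) with (RtoC 0) by ring. rewrite Cmod_0. lra.
  - apply (taylor2_plus (fun z => csum (fun i => f i z) n)); auto.
Qed.

Lemma exp_rem_3 (z : C) : Cexp z = 1 + z + z * z / 2 + exp_rem 3 z.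
Proof.
  simpl. unfold Cdiv. replace (RtoC (1 + 1)) with (RtoC 2) by (f_equal; ring).
  field.
Qed.

(** The factor |u|^3 / 3! is itself at most e^|u|, so the dependence on [u] becomes purely
    exponential, as [log_weight_bound] expects. *)
Lemma Cmod_exp_rem_3_le (u v : C) : (Cmod v <= 1)%R ->
  (Cmod (exp_rem 3 (- (v * u))) <= 8 * Cmod v ^ 3 * exp (2 * Cmod u))%R.
Proof.
  intros Hv. eapply Rle_trans; [apply Cmod_exp_rem_le|].
  rewrite Cmod_opp, Cmod_mult. pose proof (Cmod_ge_0 u) as Hu. pose proof (Cmod_ge_0 v).
  pose proof (pow_le_fact_exp 3 (Cmod u) Hu) as P.
  replace (2 * Cmod u)%R with (Cmod u + Cmod u)%R by ring. rewrite exp_plus.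
  assert (E : (exp (Cmod v * Cmod u) <= exp (Cmod u))%R) by (apply exp_le; nra).
  replace ((2 * (Cmod v * Cmod u)) ^ 3 / INR (fact 3) * exp (Cmod v * Cmod u))%R with
    (8 * Cmod v ^ 3 * ((Cmod u ^ 3 / INR (fact 3)) * exp (Cmod v * Cmod u)))%R by (field; apply INR_fact_neq_0).
  rewrite !Rmult_assoc. do 2 (apply Rmult_le_compat_l; [try apply pow_le; lra|]).
  pose proof (INR_fact_lt_0 3).
  apply Rmult_le_compat.
  - apply Rmult_le_pos; [apply pow_le; auto|left; apply Rinv_0_lt_compat; auto].
  - left; apply exp_pos.
  - apply (Rmult_le_reg_l (INR (fact 3))); auto.
    replace (INR (fact 3) * (Cmod u ^ 3 / INR (fact 3)))%R with (Cmod u ^ 3)%R by (field; lra). auto.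
  - auto.
Qed.

Lemma taylor2_Cexp (l w : C) : taylor2 (fun z => Cexp (- (z * l))) w.
Proof.
  exists (Cexp (- (w * l))), (Cexp (- (w * l)) * - l), (Cexp (- (w * l)) * (l * l / 2)),
    (Cmod (Cexp (- (w * l))) * (8 * exp (2 * Cmod l)))%R.
  split.
  - apply Rmult_le_pos; [apply Cmod_ge_0|]. pose proof (exp_pos (2 * Cmod l)). lra.
  - intros v Hv. replace (- ((w + v) * l)) with (- (w * l) + - (v * l)) by ring.
    rewrite Cexp_plus, (exp_rem_3 (- (v * l))).
    match goal with |- (Cmod ?e <= _)%R => replace e with
      (Cexp (- (w * l)) * exp_rem 3 (- (v * l))) by (field; cnz) end.
    rewrite Cmod_mult, Rmult_assoc. apply Rmult_le_compat_l; [apply Cmod_ge_0|].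
    eapply Rle_trans; [apply Cmod_exp_rem_3_le; auto|right; ring].
Qed.

(** Expand z^(-w-v) = z^(-w) e^(-v log z) to third order and integrate term by term. This works at
    every [w], because the decay of [kappa] dominates any power of z: the transform is entire in its
    exponent. *)
Lemma taylor2_strip_T (q : nat) (b : R) (w : C) : (1 <= q)%nat -> (1 <= b)%R ->
  taylor2 (fun z => strip_T q (cpow_neg z) b) w.
Proof.
  intros hq hb. set (tau := 2%R).
  pose proof (integrable_bound_dpow tau ltac:(unfold tau; lra)) as ID.
  set (M := (2 / (tau - 1))%R) in *.
  assert (HM : (0 < M)%R) by (unfold M, tau; lra).
  set (g := log_weight q b w).
  destruct (log_weight_bound q hq b hb tau w 2 ltac:(lra)) as (K & HK & B).
  assert (Dm : forall F A m, (0 <= A)%R -> (0 <= m)%R -> (forall u, contCC F u) ->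
    (forall u, (Cmod (F u) <= A * exp (m * Cmod u))%R) -> dominated (dpow tau) (g F))
    by (intros F A m H1 H2 H3 H4; apply (dominated_log_weight q hq b hb tau w F A m); auto).
  assert (C0 : forall u, contCC (fun _ => RtoC 1) u) by (intros; apply (contC_const CU)).
  assert (C1 : forall u, contCC (fun l => - l) u) by (intros; apply (contC_opp CU), contC_id).
  assert (C2 : forall u, contCC (fun l => l * l / 2) u).
  { intros u. apply (contC_mult CU (fun l => l * l)); [|apply (contC_const CU)].
    apply (contC_mult CU (fun l => l)); apply contC_id. }
  assert (D0 : dominated (dpow tau) (g (fun _ => 1))).
  { apply (Dm _ 1%R 0%R); auto; try lra. intros u. rewrite Cmod_1, Rmult_0_l, exp_0. lra. }
  assert (D1 : dominated (dpow tau) (g (fun l => - l))).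
  { apply (Dm _ 1%R 1%R); auto; try lra. intros u. rewrite Cmod_opp, !Rmult_1_l.
    pose proof (exp_ineq1_le (Cmod u)). lra. }
  assert (D2 : dominated (dpow tau) (g (fun l => l * l / 2))).
  { apply (Dm _ 1%R 1%R); auto; try lra. intros u. rewrite !Rmult_1_l.
    rewrite Cmod_div by apply C2_nz. rewrite Cmod_mult, Cmod_R, (Rabs_pos_eq 2) by lra.
    pose proof (pow_le_fact_exp 2 (Cmod u) (Cmod_ge_0 u)) as P. simpl in P. lra. }
  exists (TInt (g (fun _ => 1))), (TInt (g (fun l => - l))), (TInt (g (fun l => l * l / 2))),
    (2 * (8 * K * M))%R.
  split; [pose proof (Rmult_le_pos K M); lra|].
  intros v Hv. pose proof (Cmod_ge_0 v) as Hv0.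
  set (F3 := fun l => exp_rem 3 (- (v * l))).
  assert (C3 : forall u, contCC F3 u).
  { intros u. apply (contC_comp (fun l => - (v * l)) (exp_rem 3));
      [|apply continuous_exp_rem_C].
    apply (contC_opp CU), (contC_mult CU); [apply (contC_const CU)|apply contC_id]. }
  assert (B3 : forall u, (Cmod (F3 u) <= (8 * Cmod v ^ 3) * exp (2 * Cmod u))%R)
    by (intros; apply Cmod_exp_rem_3_le; auto).
  assert (P3 : (0 <= 8 * Cmod v ^ 3)%R) by (apply Rmult_le_pos; [lra|apply pow_le; auto]).
  assert (D3 : dominated (dpow tau) (g F3)) by (apply (Dm _ (8 * Cmod v ^ 3)%R 2%R); auto; lra).
  assert (E : strip_T q (cpow_neg (w + v)) b =
    TInt (g (fun _ => 1)) + v * TInt (g (fun l => - l)) + (v * v) * TInt (g (fun l => l * l / 2)) + TInt (g F3)).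
  { set (g0 := g (fun _ => 1)) in *. set (g1 := g (fun l => - l)) in *.
    set (g2 := g (fun l => l * l / 2)) in *.
    transitivity (TInt (fun t => ((g0 t + v * g1 t) + v * v * g2 t) + g F3 t)).
    - apply TInt_ext. intros t. unfold g0, g1, g2, g, log_weight, strip_weight, F3.
      set (l := Clog (b, (INR q * t)%R)). unfold cpow_neg. fold l.
      replace (- ((w + v) * l)) with (- (w * l) + - (v * l)) by ring.
      rewrite Cexp_plus, (exp_rem_3 (- (v * l))). field.
    - assert (E1 : dominated (dpow tau) (fun t => v * g1 t)) by (apply dominated_scal; auto).
      assert (E2 : dominated (dpow tau) (fun t => v * v * g2 t)) by (apply dominated_scal; auto).
      assert (E3 : dominated (dpow tau) (fun t => g0 t + v * g1 t)) by (apply dominated_plus; auto).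
      assert (E4 : dominated (dpow tau) (fun t => (g0 t + v * g1 t) + v * v * g2 t)) by (apply dominated_plus; auto).
      rewrite (TInt_plus _ _ ID (fun t => (g0 t + v * g1 t) + v * v * g2 t) (g F3)) by auto.
      rewrite (TInt_plus _ _ ID (fun t => g0 t + v * g1 t) (fun t => v * v * g2 t)) by auto.
      rewrite (TInt_plus _ _ ID g0 (fun t => v * g1 t)) by auto.
      rewrite (TInt_scal _ _ ID v g1), (TInt_scal _ _ ID (v * v) g2) by auto. reflexivity. }
  rewrite E.
  match goal with |- (Cmod ?e <= _)%R => replace e with (TInt (g F3)) by ring end.
  eapply Rle_trans.
  { apply (Cmod_TInt_le _ _ ID _ (8 * Cmod v ^ 3 * K)%R).
    - apply Rmult_le_pos; auto.
    - apply D3.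
    - apply B; auto. }
  right. ring.
Qed.

Lemma taylor2_cderiv (f : C -> C) (w : C) : taylor2 f w -> exists l, cderiv f w l.
Proof.
  intros (a0 & a1 & a2 & M & HM & B). exists a1.
  assert (E : a0 = f w).
  { specialize (B 0). rewrite Cmod_0 in B. specialize (B ltac:(lra)).
    replace (w + 0) with w in B by ring.
    replace (f w - (a0 + a1 * 0 + a2 * (0 * 0))) with (f w - a0) in B by ring.
    rewrite pow_ne_zero, Rmult_0_r in B by lia.
    assert (Z : f w - a0 = 0) by (apply Cmod_eq_0; pose proof (Cmod_ge_0 (f w - a0)); lra).
    rewrite <- (Cplus_0_l a0), <- Z. ring. }
  apply eps_cderiv. intros eps.
  set (L := (M + Cmod a2 + 1)%R). pose proof (Cmod_ge_0 a2) as Ha.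
  assert (He : (0 < Rmin 1 (eps / L))%R).
  { apply Rmin_glb_lt; [lra|]. apply Rdiv_lt_0_compat; [apply cond_pos|unfold L; lra]. }
  exists (mkposreal _ He). simpl. intros z Hz.
  pose proof (Rmin_l 1 (eps / L)) as L1. pose proof (Rmin_r 1 (eps / L)) as L2.
  set (v := z - w) in *. pose proof (Cmod_ge_0 v) as Hv.
  replace z with (w + v) by (unfold v; ring). specialize (B v ltac:(lra)). rewrite E in B.
  replace (f (w + v) - f w - a1 * v) with ((f (w + v) - (f w + a1 * v + a2 * (v * v))) + a2 * (v * v)) by ring.
  eapply Rle_trans; [apply Cmod_triangle|]. rewrite !Cmod_mult.
  assert (Hc : (Cmod v * L <= eps)%R).
  { apply Rle_trans with (eps / L * L)%R; [apply Rmult_le_compat_r; unfold L in *; lra|].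
    right. field. unfold L; lra. }
  unfold L in Hc.
  assert ((M * Cmod v ^ 3 <= M * Cmod v * Cmod v)%R).
  { simpl. rewrite Rmult_1_r, Rmult_assoc. apply Rmult_le_compat_l; auto. nra. }
  assert (Cmod v * (M + Cmod a2 + 1) * Cmod v <= eps * Cmod v)%R by (apply Rmult_le_compat_r; auto).
  nra.
Qed.

(** Dividing the expansion by v leaves a1 + a2 v + O (v^2), so [a1] is the value to fill in and [a2]
    the derivative there. *)
Lemma taylor2_quotient (f : C -> C) (w : C) : taylor2 f w -> f w = 0 ->
  exists g0 l, cderiv (fun z => if Ceq_dec z w then g0 else f z / (z - w)) w l.
Proof.
  intros (a0 & a1 & a2 & M & HM & B) F0. exists a1, a2.
  assert (E : a0 = 0).
  { specialize (B 0). rewrite Cmod_0 in B. specialize (B ltac:(lra)).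
    replace (w + 0) with w in B by ring. rewrite F0 in B.
    replace (0 - (a0 + a1 * 0 + a2 * (0 * 0))) with (- a0) in B by ring.
    rewrite pow_ne_zero, Rmult_0_r, Cmod_opp in B by lia.
    apply Cmod_eq_0; pose proof (Cmod_ge_0 a0); lra. }
  subst a0. apply eps_cderiv. intros eps.
  assert (He : (0 < Rmin 1 (eps / (M + 1)))%R).
  { apply Rmin_glb_lt; [lra|]. apply Rdiv_lt_0_compat; [apply cond_pos|lra]. }
  exists (mkposreal _ He). simpl. intros z Hz.
  pose proof (Rmin_l 1 (eps / (M + 1))) as L1. pose proof (Rmin_r 1 (eps / (M + 1))) as L2.
  destruct (Ceq_dec w w) as [_|]; [|congruence].
  destruct (Ceq_dec z w) as [->|N].
  - replace (a1 - a1 - a2 * (w - w)) with (RtoC 0) by ring. rewrite Cmod_0.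
    apply Rmult_le_pos; [left; apply cond_pos|apply Cmod_ge_0].
  - assert (Nv : z - w <> 0) by (apply Cminus_eq_contra; auto).
    set (v := z - w) in *.
    assert (Ez : z = w + v) by (unfold v; ring). rewrite Ez.
    specialize (B v ltac:(lra)).
    replace (f (w + v) / v - a1 - a2 * v) with ((f (w + v) - (0 + a1 * v + a2 * (v * v))) / v) by (field; auto).
    rewrite Cmod_div by auto. apply Cmod_gt_0 in Nv.
    apply (Rmult_le_reg_r (Cmod v)); auto.
    unfold Rdiv. rewrite Rmult_assoc, Rinv_l, Rmult_1_r by lra.
    assert (Hc : (Cmod v * (M + 1) <= eps)%R).
    { apply Rle_trans with (eps / (M + 1) * (M + 1))%R; [apply Rmult_le_compat_r; lra|].
      right. field. lra. }
    eapply Rle_trans; [apply B|]. simpl. nra.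
Qed.

(** Since z^(-(s-2k)) = z^(-s) z^(2k), the partial sums are the transforms of z^(-s) times the
    Taylor polynomials of the cosine. Each term alone is tamed by [kappa]; a majorant uniform in [n]
    requires [strip_growth], hence Re s > 1 and q |th| <= 2 PI. *)
Lemma strip_T_cos_series (q : nat) (b : R) (s : C) (th : R) :
  (1 <= q)%nat -> (1 <= b)%R -> (1 < Re s)%R -> (INR q * Rabs th <= 2 * PI)%R ->
  clim (csum (fun k => cos_term k * RtoC (th ^ (2 * k)) * strip_T q (cpow_neg (s - RtoC (INR (2 * k)))) b))
    (strip_T q (hcos s th) b).
Proof.
  intros hq hb hs hth. pose proof (qr_ge_1 q hq) as Hq. pose proof PI_RGT_0 as Hpi.
  set (tau := ((1 + Re s) / 2)%R).
  pose proof (integrable_bound_dpow tau ltac:(unfold tau; lra)) as ID.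
  set (term := fun k t => cos_term k * RtoC (th ^ (2 * k)) * strip_weight q (cpow_neg (s - RtoC (INR (2 * k)))) b t).
  assert (Dt : forall k, dominated (dpow tau) (term k)).
  { intros k. apply dominated_scal. apply dominated_cpow_neg; auto. }
  set (K0 := (2 * PI * exp (Rabs (Im s) * (PI / 2)) * Rpower 2 ((1 + Re s) / 2))%R).
  assert (HK0 : (0 <= K0)%R).
  { unfold K0. pose proof (exp_pos (Rabs (Im s) * (PI / 2))).
    pose proof (exp_pos ((1 + Re s) / 2 * ln 2)). unfold Rpower.
    apply Rmult_le_pos; [apply Rmult_le_pos; lra|lra]. }
  set (eta := ((Re s - 1) / 2)%R).
  assert (HR : (0 <= Rpower b (- eta))%R) by (left; apply exp_pos).
  assert (Hrw : forall n t, csum (fun k => term k t) n - strip_weight q (hcos s th) b t =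
    RtoC (kappa t) * (cpow_neg s (b, (INR q * t)%R) *
      - (ccos (RtoC th * (b, (INR q * t)%R)) - cos_poly n (RtoC th * (b, (INR q * t)%R))))).
  { intros n t. set (z := (b, (INR q * t)%R) : C).
    assert (E : csum (fun k => term k t) n = RtoC (kappa t) * (cpow_neg s z * cos_poly n (RtoC th * z))).
    { unfold cos_poly. rewrite <- !csum_scal. apply csum_ext. intros k _. unfold term, strip_weight.
      fold z. rewrite cpow_neg_minus_INR by (simpl; lra).
      rewrite Cpow_mult_l, RtoC_pow. ring. }
    rewrite E. unfold strip_weight, hcos. fold z. ring. }
  assert (Dh : dominated (dpow tau) (strip_weight q (hcos s th) b)).
  { split.
    - intros t. apply continuous_strip_weight. eapply cderiv_continuous, cderiv_hcos. simpl; lra.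
    - exists (1 * K0 * Rpower b (- eta))%R. split; [rewrite Rmult_1_l; apply Rmult_le_pos; auto|].
      intros t. unfold strip_weight, hcos. apply (strip_growth q hq s th hs hth b t 1); auto; [lra|].
      rewrite Rmult_1_l. eapply Rle_trans; [apply Cmod_ccos_le|]. simpl Im.
      rewrite Rabs_mult, (Rabs_pos_eq (INR q)) by lra. lra. }
  set (f := fun n t => csum (fun k => term k t) n - strip_weight q (hcos s th) b t).
  assert (Df : forall n, TInt (f n) = csum (fun k => TInt (term k)) n - strip_T q (hcos s th) b).
  { intros n. destruct (TInt_csum _ _ term n ID Dt) as [S1 S2]. unfold f.
    rewrite (TInt_minus _ _ ID) by auto. rewrite S2. reflexivity. }
  assert (Ht : forall k, TInt (term k) = cos_term k * RtoC (th ^ (2 * k)) * strip_T q (cpow_neg (s - RtoC (INR (2 * k)))) b).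
  { intros k. unfold term. rewrite (TInt_scal _ _ ID) by (apply dominated_cpow_neg; auto). reflexivity. }
  assert (Hlim : forall eps, (0 < eps)%R -> exists n0 : nat, forall n, (n0 <= n)%nat -> (Cmod (TInt (f n)) <= eps)%R).
  (* The polynomial and the cosine are each at most exp (|th| b) exp (|th| q |y|): the vertical part
     matches the growth allowed by [strip_growth], and the horizontal part is a constant. *)
  { set (K1 := (2 * exp (Rabs th * b))%R).
    assert (HK1 : (0 <= K1)%R) by (unfold K1; pose proof (exp_pos (Rabs th * b)); lra).
    assert (Zb : forall t, (Cmod (RtoC th * (b, INR q * t)%R) <= Rabs th * b + Rabs th * (INR q * Rabs t))%R).
    { intros t. rewrite Cmod_mult, Cmod_R. destruct (Cmod_strip_point q hq b t hb) as (_ & _ & K3).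
      rewrite <- Rmult_plus_distr_l. apply Rmult_le_compat_l; auto using Rabs_pos. }
    apply (TInt_dominated_cvg _ _ ID f (K1 * K0 * Rpower b (- eta))%R).
    - apply Rmult_le_pos; [apply Rmult_le_pos|]; auto.
    - intros n t. unfold f. apply contC_minus; [|apply Dh].
      destruct (TInt_csum _ _ term n ID Dt) as [[S1 _] _]. apply S1.
    - intros n t. unfold f. rewrite Hrw.
      apply (strip_growth q hq s th hs hth b t K1); auto.
      rewrite Cmod_opp. eapply Rle_trans; [apply Cmod_triangle_minus|].
      set (z := (b, (INR q * t)%R) : C). specialize (Zb t). fold z in Zb.
      pose proof (Cmod_cos_poly_le n (RtoC th * z)) as B1.
      pose proof (Cmod_ccos_le th z) as B2.
      assert (B3 : (exp (Cmod (RtoC th * z)) <= exp (Rabs th * b) * exp (Rabs th * (INR q * Rabs t)))%R).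
      { rewrite <- exp_plus. apply exp_le; auto. }
      assert (B4 : (exp (Rabs th * Rabs (Im z)) <= exp (Rabs th * b) * exp (Rabs th * (INR q * Rabs t)))%R).
      { rewrite <- exp_plus. apply exp_le. simpl. rewrite Rabs_mult, (Rabs_pos_eq (INR q)) by lra.
        pose proof (Rmult_le_pos (Rabs th) b (Rabs_pos th)). lra. }
      unfold K1. lra.
    - intros N eps Heps.
      set (Rd := (Rabs th * b + Rabs th * (INR q * INR N))%R).
      assert (HRd : (0 <= Rd)%R).
      { unfold Rd. pose proof (Rabs_pos th). pose proof (pos_INR N).
        assert (0 <= INR q * INR N)%R by (apply Rmult_le_pos; lra).
        pose proof (Rmult_le_pos (Rabs th) b). pose proof (Rmult_le_pos (Rabs th) (INR q * INR N)). lra. }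
      set (W := (K0 * Rpower b (- eta) * exp Rd)%R).
      assert (HW : (0 <= W)%R) by (unfold W; apply Rmult_le_pos; [apply Rmult_le_pos; auto|left; apply exp_pos]).
      assert (He : (eps / (W + 1) > 0)%R) by (apply Rdiv_lt_0_compat; lra).
      (* For |t| <= N the argument of the cosine is at most [Rd] in modulus, so the Taylor remainder
         is uniformly small there. *)
      destruct (cv_speed_pow_fact (2 * Rd) _ He) as [n0 Hn0].
      exists n0. intros n t Hn Htt. unfold f. rewrite Hrw.
      specialize (Hn0 (2 * n)%nat ltac:(lia)). unfold Rdist in Hn0. rewrite Rminus_0_r in Hn0.
      pose proof (Rle_abs ((2 * Rd) ^ (2 * n) / INR (fact (2 * n)))) as Ha.
      set (z := (b, (INR q * t)%R) : C). specialize (Zb t). fold z in Zb.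
      assert (Zr : (Cmod (RtoC th * z) <= Rd)%R).
      { eapply Rle_trans; [apply Zb|]. unfold Rd. apply Rplus_le_compat_l.
        apply Rmult_le_compat_l; [apply Rabs_pos|]. apply Rmult_le_compat_l; lra. }
      pose proof (Cmod_ge_0 (RtoC th * z)) as Z0.
      assert (B : (Cmod (- (ccos (RtoC th * z) - cos_poly n (RtoC th * z))) <= eps / (W + 1) * exp Rd)%R).
      { rewrite Cmod_opp. eapply Rle_trans; [apply Cmod_ccos_minus_poly_le|].
        apply Rmult_le_compat.
        - apply Rmult_le_pos; [apply pow_le; lra|left; apply Rinv_0_lt_compat, INR_fact_lt_0].
        - left; apply exp_pos.
        - apply Rle_trans with ((2 * Rd) ^ (2 * n) / INR (fact (2 * n)))%R; [|lra].
          apply Rmult_le_compat_r; [left; apply Rinv_0_lt_compat, INR_fact_lt_0|].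
          apply pow_incr. lra.
        - apply exp_le; auto. }
      eapply Rle_trans.
      { apply (strip_growth q hq s th hs hth b t (eps / (W + 1) * exp Rd)%R); auto.
        - apply Rmult_le_pos; [lra|left; apply exp_pos].
        - eapply Rle_trans; [apply B|]. rewrite <- (Rmult_1_r (eps / (W + 1) * exp Rd)) at 1.
          apply Rmult_le_compat_l; [apply Rmult_le_pos; [lra|left; apply exp_pos]|].
          rewrite <- exp_0. apply exp_le.
          apply Rmult_le_pos; [apply Rabs_pos|apply Rmult_le_pos; [lra|apply Rabs_pos]]. }
      fold K0 eta tau.
      assert (D1 : (dpow tau t <= 1)%R).
      { eapply Rle_trans; [apply dpow_1_le; unfold tau; lra|]. pose proof (Rabs_pos t).
        rewrite <- Rinv_1. apply Rinv_le_contravar; lra. }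
      pose proof (dpow_pos tau t).
      apply Rle_trans with (eps / (W + 1) * W * 1)%R.
      + apply Rmult_le_compat; try lra.
        * apply Rmult_le_pos; [apply Rmult_le_pos; auto|auto].
          apply Rmult_le_pos; [lra|left; apply exp_pos].
        * unfold W. right. ring.
      + apply Rle_trans with (eps / (W + 1) * (W + 1))%R; [rewrite Rmult_1_r; apply Rmult_le_compat_l; lra|].
        right. field. lra. }
  intros eps Heps. destruct (Hlim eps Heps) as [n0 Hn0]. exists n0. intros n Hn.
  specialize (Hn0 n Hn). rewrite Df in Hn0.
  rewrite (csum_ext _ (fun k => TInt (term k))); auto.
Qed.

(** * The continuation and the theorem *)

Lemma exp_rem_lim (z : C) : clim (fun n => exp_rem (2 * n) z) 0.
Proof.
  intros eps Heps. pose proof (exp_pos (Cmod z)) as EP.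
  assert (He : (eps / exp (Cmod z) > 0)%R) by (apply Rdiv_lt_0_compat; auto).
  destruct (cv_speed_pow_fact (2 * Cmod z) _ He) as [n0 H]. exists n0. intros n Hn.
  specialize (H (2 * n)%nat ltac:(lia)). unfold Rdist in H. rewrite Rminus_0_r in H.
  pose proof (Rle_abs ((2 * Cmod z) ^ (2 * n) / INR (fact (2 * n)))).
  replace (exp_rem (2 * n) z - 0) with (exp_rem (2 * n) z) by ring.
  eapply Rle_trans; [apply Cmod_exp_rem_le|].
  apply Rle_trans with (eps / exp (Cmod z) * exp (Cmod z))%R.
  - apply Rmult_le_compat_r; lra.
  - right. field. lra.
Qed.

Lemma clim_shift (u : nat -> C) (l : C) : clim (fun n => u (S n)) l -> clim u l.
Proof.
  intros H eps Heps. destruct (H eps Heps) as [n0 K]. exists (S n0). intros n Hn.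
  destruct n as [|n]; [lia|]. apply K. lia.
Qed.

Lemma cos_poly_lim (Z : C) : clim (fun n => cos_poly n Z) (ccos Z).
Proof.
  apply (clim_ext (fun n => ccos Z + - / 2 * (exp_rem (2 * n) (Ci * Z) + exp_rem (2 * n) (- (Ci * Z))))).
  - intros n. pose proof (cos_poly_rem n Z) as E.
    transitivity (ccos Z - (ccos Z - cos_poly n Z)); [rewrite E; field|ring].
  - replace (ccos Z) with (ccos Z + - / 2 * (0 + 0)) at 1 by ring.
    apply clim_plus; [apply clim_const|]. apply clim_scal.
    apply clim_plus; apply exp_rem_lim.
Qed.

(** The factor 2k is the effect of Z d/dZ on Z^(2k), which turns cos Z into - Z sin Z. There are
    [S n] terms against remainders of order [2 * n] because the term k = 0 vanishes. *)
Lemma sin_poly_rem (n : nat) (Z : C) :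
  csum (fun k => cos_term k * RtoC (INR (2 * k)) * Z ^ (2 * k)) (S n) =
  - (Z * csin Z) + Z * ((exp_rem (2 * n) (Ci * Z) - exp_rem (2 * n) (- (Ci * Z))) / (2 * Ci)).
Proof.
  induction n as [|n IH].
  - unfold csin. cbn [csum]. simpl. ring.
  - cbn [csum] in *. rewrite IH. clear IH. replace (2 * S n)%nat with (S (S (2 * n))) by lia.
    set (m := (2 * n)%nat).
    change (exp_rem (S (S m)) (Ci * Z)) with
      (exp_rem m (Ci * Z) - (Ci * Z) ^ m / RtoC (INR (fact m)) - (Ci * Z) ^ S m / RtoC (INR (fact (S m)))).
    change (exp_rem (S (S m)) (- (Ci * Z))) with
      (exp_rem m (- (Ci * Z)) - (- (Ci * Z)) ^ m / RtoC (INR (fact m)) - (- (Ci * Z)) ^ S m / RtoC (INR (fact (S m)))).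
    assert (E1 : (Ci * Z) ^ m = RtoC ((-1) ^ n) * Z ^ m).
    { unfold m. rewrite Cpow_mult_l. f_equal. rewrite Cmult_pow_sq, Ci_sq.
      rewrite RtoC_pow. f_equal. unfold RtoC, Copp; simpl; f_equal; ring. }
    assert (E2 : (- (Ci * Z)) ^ m = RtoC ((-1) ^ n) * Z ^ m).
    { rewrite <- E1. unfold m. rewrite !Cmult_pow_sq. f_equal. ring. }
    assert (E3 : cos_term (S n) * RtoC (INR (S (S m))) = - RtoC ((-1) ^ n) / RtoC (INR (fact (S m)))).
    { unfold cos_term. replace (2 * S n)%nat with (S (S m)) by (unfold m; lia).
      rewrite (fact_simpl (S m)), mult_INR. pose proof (INR_fact_neq_0 (S m)) as N1.
      assert (N2 : INR (S (S m)) <> 0%R) by (apply not_0_INR; discriminate).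
      rewrite <- RtoC_mult, <- RtoC_opp, <- RtoC_div by auto. f_equal. simpl pow. field. auto. }
    rewrite E3, !Cpow_S, E1, E2. field. repeat split; try apply RtoC_fact_neq_0; auto using Ci_nz.
Qed.

(** This is (s - Z d/dZ) applied to the cosine series; it expands the explicit first term of each
    residue class. *)
Lemma cos_sin_series (s Z : C) :
  clim (csum (fun k => cos_term k * (s - RtoC (INR (2 * k))) * Z ^ (2 * k))) (s * ccos Z + Z * csin Z).
Proof.
  apply (clim_ext (fun n => s * cos_poly n Z + - (1) * csum (fun k => cos_term k * RtoC (INR (2 * k)) * Z ^ (2 * k)) n)).
  - intros n. unfold cos_poly. rewrite <- !csum_scal, <- csum_plus. apply csum_ext. intros; ring.
  - apply clim_plus; [apply clim_scal, cos_poly_lim|].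
    replace (Z * csin Z) with (- (1) * - (Z * csin Z)) by ring. apply clim_scal.
    apply clim_shift.
    apply (clim_ext (fun n => - (Z * csin Z) + (Z / (2 * Ci)) * (exp_rem (2 * n) (Ci * Z) + - (1) * exp_rem (2 * n) (- (Ci * Z))))).
    + intros n. rewrite sin_poly_rem. field; cnz.
    + replace (- (Z * csin Z)) with (- (Z * csin Z) + (Z / (2 * Ci)) * (0 + - (1) * 0)) at 1 by ring.
      apply clim_plus; [apply clim_const|]. apply clim_scal. apply clim_plus; [apply exp_rem_lim|].
      apply clim_scal, exp_rem_lim.
Qed.

(** * Convergence of the series over integers *)

Lemma ex_series_Rpower (sigma : R) : (1 < sigma)%R ->
  ex_series (fun n : nat => Rpower (INR (S n)) (- sigma)).
Proof.
  intros Hs.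
  (* Integral comparison in telescoped form: the mean value theorem on each unit interval plays the
     role of the integral of x^(-sigma). *)
  assert (B : forall N, (sum_n (fun n : nat => Rpower (INR (S n)) (- sigma)) N <=
    1 + / (sigma - 1) * (1 - Rpower (INR (S N)) (1 - sigma)))%R).
  { induction N as [|N IH].
    - rewrite sum_O. simpl. unfold Rpower. rewrite ln_1, !Rmult_0_r, exp_0. lra.
    - rewrite sum_Sn. unfold plus; simpl (AbelianMonoid.sort _). simpl plus.
      set (a := INR (S N)) in *. assert (Ha : (0 < a)%R) by (apply lt_0_INR; lia).
      rewrite (S_INR (S N)). fold a.
      destruct (MVT_cor2 (fun x => Rpower x (1 - sigma)) (fun x => (1 - sigma) * Rpower x (1 - sigma - 1))%R a (a + 1))
        as (c & E & Hc); [lra|intros; apply derivable_pt_lim_power; lra|].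
      replace (1 - sigma - 1)%R with (- sigma)%R in E by ring.
      assert (K : (Rpower (a + 1) (- sigma) <= Rpower c (- sigma))%R) by (apply Rpower_neg_le; lra).
      assert (P : (0 < / (sigma - 1))%R) by (apply Rinv_0_lt_compat; lra).
      assert (K2 : (Rpower c (- sigma) = / (sigma - 1) * (Rpower a (1 - sigma) - Rpower (a + 1) (1 - sigma)))%R).
      { replace (Rpower a (1 - sigma) - Rpower (a + 1) (1 - sigma))%R with
          (- ((1 - sigma) * Rpower c (- sigma) * (a + 1 - a)))%R by lra. field. lra. }
      change (sum_n (fun n : nat => Rpower (INR (S n)) (- sigma)) N + Rpower (a + 1) (- sigma) <=
        1 + / (sigma - 1) * (1 - Rpower (a + 1) (1 - sigma)))%R. lra. }
  destruct (ex_finite_lim_seq_incr (sum_n (fun n : nat => Rpower (INR (S n)) (- sigma))) (1 + / (sigma - 1))) as [l Hl].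
  - intros n. rewrite sum_Sn.
    pose proof (exp_pos (- sigma * ln (INR (S (S n))))) as P. unfold plus; simpl. unfold Rpower at 3. simpl in P. lra.
  - intros n. eapply Rle_trans; [apply B|].
    pose proof (exp_pos ((1 - sigma) * ln (INR (S n)))) as P. fold (Rpower (INR (S n)) (1 - sigma)) in P.
    assert (0 < / (sigma - 1))%R by (apply Rinv_0_lt_compat; lra). nra.
  - exists l. exact Hl.
Qed.

Lemma ex_series_dominated (a : nat -> C) (X sigma : R) : (1 < sigma)%R ->
  (forall n, (Cmod (a n) <= X * Rpower (INR (S n)) (- sigma))%R) ->
  exists l : C, is_seriesC a l.
Proof.
  intros Hs H.
  apply (ex_series_le (V := C_CompleteNormedModule) a (fun n => X * Rpower (INR (S n)) (- sigma))%R).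
  - intros n. exact (H n).
  - apply (ex_series_scal (V := R_NormedModule) X), ex_series_Rpower; auto.
Qed.

Lemma ccos_RtoC (x : R) : ccos (RtoC x) = RtoC (cos x).
Proof.
  unfold ccos. replace (Ci * RtoC x) with (RtoC x * Ci) by ring.
  replace (- (RtoC x * Ci)) with (RtoC (- x) * Ci) by (rewrite RtoC_opp; ring).
  rewrite !Cexp_Ci, cos_neg, sin_neg.
  replace ((cos x, sin x) + (cos x, (- sin x)%R)) with (2 * RtoC (cos x))
    by (unfold RtoC, Cplus, Cmult; simpl; f_equal; ring).
  field.
Qed.

Lemma csin_RtoC (x : R) : csin (RtoC x) = RtoC (sin x).
Proof.
  unfold csin. replace (Ci * RtoC x) with (RtoC x * Ci) by ring.
  replace (- (RtoC x * Ci)) with (RtoC (- x) * Ci) by (rewrite RtoC_opp; ring).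
  rewrite !Cexp_Ci, cos_neg, sin_neg.
  replace ((cos x, sin x) - (cos x, (- sin x)%R)) with (2 * Ci * RtoC (sin x))
    by (unfold RtoC, Ci, Cminus, Cplus, Copp, Cmult; simpl; f_equal; ring).
  field; cnz.
Qed.

Lemma INR_S_pos (n : nat) : (0 < INR (S n))%R.
Proof. apply lt_0_INR; lia. Qed.

Lemma cpow_neg_nat (n : nat) (s : C) : cpow_neg s (RtoC (INR (S n))) = / nat_cpow (S n) s.
Proof.
  unfold cpow_neg, nat_cpow. rewrite Clog_RtoC by apply INR_S_pos. apply Cexp_opp.
Qed.

Lemma Cmod_cpow_neg_nat (n : nat) (s : C) :
  Cmod (cpow_neg s (RtoC (INR (S n)))) = Rpower (INR (S n)) (- Re s).
Proof.
  unfold cpow_neg. rewrite Clog_RtoC by apply INR_S_pos. rewrite Cmod_Cexp, re_opp, re_scal_r.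
  unfold Rpower. f_equal. ring.
Qed.

Section Continuation.
Context (q : nat) (hq : (1 <= q)%nat) (chi : Z -> C).
Context (Hchi : forall a, chi (a + Z.of_nat q)%Z = chi a).
Notation qr := (INR q).

(* [shifted_L w = w L(w + 1, chi)] *)
Definition shifted_L (w : C) : C :=
  csum (fun i => chi (Z.of_nat (S i)) * (w * cpow_neg (w + 1) (RtoC (INR (S i))) +
    / RtoC qr * strip_T q (cpow_neg w) (INR (S i) + qr / 2))) q.

Lemma abscissa_ge_1 (i : nat) : (1 <= INR (S i) + qr / 2)%R.
Proof. rewrite S_INR. pose proof (pos_INR i). pose proof (pos_INR q). lra. Qed.

Lemma taylor2_shifted_L (w : C) : taylor2 shifted_L w.
Proof.
  apply (taylor2_csum (fun i w => chi (Z.of_nat (S i)) * (w * cpow_neg (w + 1) (RtoC (INR (S i))) +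
    / RtoC qr * strip_T q (cpow_neg w) (INR (S i) + qr / 2)))).
  intros i _. apply taylor2_scal. apply taylor2_plus.
  - set (l := Clog (RtoC (INR (S i)))).
    apply (taylor2_ext (fun w => Cexp (- l) * (w * Cexp (- (w * l))))).
    + intros z. unfold cpow_neg. fold l. replace (- ((z + 1) * l)) with (- l + - (z * l)) by ring.
      rewrite Cexp_plus. ring.
    + apply taylor2_scal. apply (taylor2_mul_id (fun w => Cexp (- (w * l)))). apply taylor2_Cexp.
  - apply taylor2_scal. apply taylor2_strip_T; auto using abscissa_ge_1.
Qed.

Lemma chi_bounded : exists X, (0 <= X)%R /\ forall n : nat, (Cmod (chi (Z.of_nat n)) <= X)%R.
Proof.
  destruct (finite_bound (fun i => chi (Z.of_nat i)) q) as (X & HX & B).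
  exists X. split; auto. intros n.
  rewrite (Nat.div_mod n q) by lia.
  replace (Z.of_nat (q * (n / q) + n mod q)) with (Z.of_nat (n mod q) + Z.of_nat (q * (n / q)))%Z by lia.
  rewrite (chi_period_mult q hq chi Hchi). apply B. apply Nat.mod_upper_bound. lia.
Qed.

Lemma ex_twisted_series (z : C) (g : nat -> R) :
  (1 < Re z)%R -> (forall n, -1 <= g n <= 1)%R ->
  exists l : C, is_seriesC (fun n => chi (Z.of_nat (S n)) / nat_cpow (S n) z * RtoC (g n)) l.
Proof.
  intros Hz Hg. destruct chi_bounded as (X & HX & BX).
  apply (ex_series_dominated _ X (Re z) Hz).
  intros n. unfold Cdiv. rewrite <- cpow_neg_nat, !Cmod_mult, Cmod_cpow_neg_nat, Cmod_R.
  rewrite <- (Rmult_1_r (X * _)). apply Rmult_le_compat; [|apply Rabs_pos| |apply Rabs_le, Hg].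
  - apply Rmult_le_pos; [apply Cmod_ge_0|left; apply exp_pos].
  - apply Rmult_le_compat_r; [left; apply exp_pos|auto].
Qed.

Lemma dirichlet_series (z : C) : (1 < Re z)%R ->
  is_seriesC (fun n => chi (Z.of_nat (S n)) / nat_cpow (S n) z) (shifted_L (z - 1) / (z - 1)).
Proof.
  intros Hz. destruct chi_bounded as (X & HX & BX).
  destruct (ex_series_dominated (fun n => chi (Z.of_nat (S n)) / nat_cpow (S n) z) X (Re z) Hz) as [l Hl].
  { intros n. unfold Cdiv. rewrite <- cpow_neg_nat, Cmod_mult, Cmod_cpow_neg_nat.
    apply Rmult_le_compat_r; [left; apply exp_pos|auto]. }
  set (w := z - 1).
  assert (Hw : (0 < Re w)%R) by (unfold w, Cminus; rewrite re_plus, re_opp; simpl; lra).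
  assert (Nw : w <> 0) by (intros E; rewrite E in Hw; simpl in Hw; lra).
  destruct (strip_bound_cpow_neg q hq w Hw) as (C0 & eta & tau & SB).
  pose proof (telescoping_series q hq (cpow_neg w) (fun z => - (w * cpow_neg (w + 1) z)) C0 eta tau
    (fun z Hz => cderiv_cpow_neg w z Hz) SB chi Hchi (- w * l)) as T.
  enough (E : - w * l = - shifted_L w).
  { replace (shifted_L w / w) with l; [exact Hl|].
    transitivity (- / w * (- w * l)); [field; auto|]. rewrite E. field; auto. }
  rewrite T.
  - transitivity (- (1) * shifted_L w); [|ring]. unfold shifted_L.
    rewrite <- csum_scal. apply csum_ext. intros; ring.
  - rewrite is_series_csum in *.
    apply (clim_ext (fun n => - w * csum (fun n => chi (Z.of_nat (S n)) / nat_cpow (S n) z) n)).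
    + intros n. rewrite <- csum_scal. apply csum_ext. intros i _. rewrite cpow_neg_nat.
      replace (w + 1) with z by (unfold w; ring). unfold Cdiv. ring.
    + apply clim_scal, Hl.
Qed.

Lemma cderiv_shifted_L (z : C) : exists l, cderiv (fun z => shifted_L (z - 1)) z l.
Proof.
  destruct (taylor2_cderiv _ _ (taylor2_shifted_L (z - 1))) as [l Hl]. exists (l * (1 - 0)).
  apply (cderiv_comp shifted_L (fun z => z - 1)); auto.
  apply cderiv_minus; [apply cderiv_id|apply cderiv_const].
Qed.

Lemma locally_neq (z a : C) : z <> a -> locally (T := CU) z (fun w => w <> a).
Proof.
  intros N. assert (P : z - a <> 0) by (apply Cminus_eq_contra; auto).
  apply Cmod_gt_0 in P. exists (mkposreal _ P). intros w Hw E. subst w.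
  change (Cmod (a - z) < Cmod (z - a))%R in Hw. rewrite <- Copp_minus_distr, Cmod_opp in Hw. lra.
Qed.

(** Whether [shifted_L] vanishes at 0 decides between a removable singularity and a simple pole at
    1. In the first case [g0] is the filling value from [taylor2_quotient]; in the second the value
    at 1 is arbitrary. *)
Lemma continuation_exists : exists F, Dirichlet_continuation chi F.
Proof.
  assert (Q : exists g0, shifted_L 0 = 0 ->
    exists l, cderiv (fun z => if Ceq_dec z 1 then g0 else shifted_L (z - 1) / (z - 1)) 1 l).
  { destruct (Ceq_dec (shifted_L 0) 0) as [E|N].
    - destruct (taylor2_quotient (fun z => shifted_L (z - 1)) 1) as (g0 & l & H).
      + destruct (taylor2_shifted_L 0) as (a0 & a1 & a2 & M & HM & B).
        exists a0, a1, a2, M. split; [exact HM|]. intros v Hv.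
        replace (1 + v - 1) with (0 + v) by ring. auto.
      + replace (1 - 1) with (RtoC 0) by ring. auto.
      + exists g0. intros _. exists l. exact H.
    - exists 0. intros; contradiction. }
  destruct Q as [g0 Q].
  exists (fun z => if Ceq_dec z 1 then g0 else shifted_L (z - 1) / (z - 1)). constructor.
  - intros z Hz. destruct (Ceq_dec z 1) as [E|N].
    + rewrite E in Hz. simpl in Hz. lra.
    + apply dirichlet_series; auto.
  - intros z Nz. destruct (cderiv_shifted_L z) as [l Hl].
    assert (D : cderiv (fun z => z - 1) z (1 - 0)) by (apply cderiv_minus; [apply cderiv_id|apply cderiv_const]).
    eexists. apply is_derive_cderiv.
    apply (cderiv_ext_loc (fun z => shifted_L (z - 1) * / (z - 1))).
    + generalize (locally_neq z 1 Nz). apply filter_imp. intros w Nw.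
      destruct (Ceq_dec w 1); [contradiction|reflexivity].
    + apply cderiv_mult; [exact Hl|]. apply (cderiv_inv (fun z => z - 1)); [exact D|].
      apply Cminus_eq_contra; auto.
  - destruct (Ceq_dec (shifted_L 0) 0) as [E|N].
    + left. destruct (Q E) as [l Hl]. exists l. apply is_derive_cderiv. exact Hl.
    + right. exists (fun z => shifted_L (z - 1)). split; [|split].
      * intros z. destruct (cderiv_shifted_L z) as [l Hl]. exists l. apply is_derive_cderiv, Hl.
      * replace (1 - 1) with (RtoC 0) by ring. auto.
      * intros z Nz. destruct (Ceq_dec z 1); [contradiction|reflexivity].
Qed.

(** Both alternatives at 1 provide an entire [G] with F = G / (z - 1): the product (z - 1) F in the
    first, the numerator of the pole in the second. It agrees with the shifted [shifted_L] where the
    series converges, hence everywhere. *)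
Lemma continuation_unique (F : C -> C) : Dirichlet_continuation chi F ->
  forall z : C, z <> 1 -> F z = shifted_L (z - 1) / (z - 1).
Proof.
  intros [HS HD H1].
  assert (K : exists G : C -> C, (forall z, exists l, cderiv G z l) /\
    forall z : C, z <> 1 -> F z = G z / (z - 1)).
  { destruct H1 as [D1|P1].
    - exists (fun z => (z - 1) * F z). split.
      + intros z. assert (DF : exists l, cderiv F z l).
        { destruct (Ceq_dec z 1) as [->|N].
          - destruct D1 as [l Hl]. exists l. apply is_derive_cderiv, Hl.
          - destruct (HD z N) as [l Hl]. exists l. apply is_derive_cderiv, Hl. }
        destruct DF as [l Hl]. eexists. apply cderiv_mult; [|exact Hl].
        apply cderiv_minus; [apply cderiv_id|apply cderiv_const].
      + intros z N. field. apply Cminus_eq_contra; auto.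
    - destruct P1 as (G & HG & _ & E). exists G. split; [|exact E].
      intros z. destruct (HG z) as [l Hl]. exists l. apply is_derive_cderiv, Hl. }
  destruct K as (G & DG & EG).
  assert (V : forall z, G z - shifted_L (z - 1) = 0).
  { apply (entire_vanishing _ 1).
    - intros w. destruct (DG w) as [l Hl]. destruct (cderiv_shifted_L w) as [k Hk].
      eexists. apply cderiv_minus; eassumption.
    - intros w Hw.
      assert (N : w <> 1) by (intros E; rewrite E in Hw; simpl in Hw; lra).
      assert (N1 : w - 1 <> 0) by (apply Cminus_eq_contra; auto).
      assert (E : F w = shifted_L (w - 1) / (w - 1)).
      { apply (clim_unique (csum (fun n => chi (Z.of_nat (S n)) / nat_cpow (S n) w)));
          apply is_series_csum; [apply HS; auto|apply dirichlet_series; auto]. }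
      rewrite EG in E by auto.
      replace (G w) with (G w / (w - 1) * (w - 1)) by (field; auto).
      rewrite E. field; auto. }
  intros z N. rewrite EG by auto. f_equal.
  rewrite <- (Cplus_0_l (shifted_L (z - 1))), <- (V z). ring.
Qed.

Lemma Dirichlet_L_eq (z : C) : z <> 1 -> Dirichlet_L chi z = shifted_L (z - 1) / (z - 1).
Proof.
  apply continuation_unique. unfold Dirichlet_L. apply epsilon_spec, continuation_exists.
Qed.

Lemma residue_limit :
  filterlim (fun w : C => w * Dirichlet_L chi (1 + w)) (locally' (RtoC 0)) (locally (shifted_L 0)).
Proof.
  assert (E : forall w : C, w <> 0 -> shifted_L w = w * Dirichlet_L chi (1 + w)).
  { intros w Nw. rewrite Dirichlet_L_eq.
    - replace (1 + w - 1) with w by ring. field. exact Nw.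
    - intros E. apply Nw. replace w with (1 + w - 1) by ring. rewrite E. ring. }
  destruct (taylor2_cderiv _ _ (taylor2_shifted_L 0)) as [l Hl].
  apply cderiv_continuous in Hl. rewrite contC_eps in Hl.
  apply filterlim_locally. intros eps.
  destruct (Hl eps) as [d Hd].
  (* The filters of the statement use the product structure of [C], whose balls are squares: a
     square of half-side d / 2 lies in the disc of radius d, as sqrt 2 < 2. *)
  assert (Hd2 : (0 < d / 2)%R) by (destruct d; simpl; lra).
  exists (mkposreal _ Hd2). intros w Hw Nw.
  apply C_NormedModule_mixin_compat1.
  rewrite <- (E w Nw). apply Hd. change (Cmod (w - 0) < d)%R.
  pose proof (C_NormedModule_mixin_compat2 _ _ _ Hw) as K.
  change (Cmod (w - 0) < sqrt 2 * (d / 2))%R in K.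
  assert (sqrt 2 < 2)%R.
  { rewrite <- (sqrt_pow2 2) at 2 by lra. apply sqrt_lt_1; lra. }
  destruct d as [d d0]; simpl in *. nra.
Qed.

(** After telescoping, the left-hand side is a finite sum over residue classes of an explicit
    derivative and a transform. Each is expanded in powers of [th] separately, and the finite sum
    over classes is exchanged only with partial sums in k, so no double series occurs. *)
Lemma fourier_series_eq (s : C) (th : R) (A B : C) :
  (1 < Re s)%R -> (qr * Rabs th <= 2 * PI)%R ->
  is_seriesC (fun n => chi (Z.of_nat (S n)) / nat_cpow (S n) (s + 1) * RtoC (cos (th * INR (S n)))) A ->
  is_seriesC (fun n => chi (Z.of_nat (S n)) / nat_cpow (S n) s * RtoC (sin (th * INR (S n)))) B ->
  is_seriesC (fun k => cos_term k * shifted_L (s - RtoC (INR (2 * k))) * RtoC (th ^ (2 * k)))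
    (s * A + RtoC th * B).
Proof.
  intros Hs Hth SA SB. rewrite is_series_csum in *.
  destruct (strip_bound_hcos q hq s th Hs Hth) as (C0 & eta & tau & SBd).
  pose proof (telescoping_series q hq (hcos s th) (dhcos s th) C0 eta tau
    (fun z Hz => cderiv_hcos s th z Hz) SBd chi Hchi (- (1) * (s * A + RtoC th * B))) as T.
  assert (E : s * A + RtoC th * B = csum (fun i => chi (Z.of_nat (S i)) *
    (- dhcos s th (RtoC (INR (S i))) + / RtoC qr * strip_T q (hcos s th) (INR (S i) + qr / 2))) q).
  { transitivity (- (1) * (- (1) * (s * A + RtoC th * B))); [ring|]. rewrite T.
    - rewrite <- csum_scal. apply csum_ext. intros; ring.
    - rewrite is_series_csum. eapply clim_ext; [|apply clim_scal, clim_plus; apply clim_scal; [exact SA|exact SB]].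
      intros n. cbv beta. rewrite <- !csum_scal, <- csum_plus, <- csum_scal. apply csum_ext. intros i _.
      unfold dhcos. rewrite !cpow_neg_nat, <- RtoC_mult, ccos_RtoC, csin_RtoC. unfold Cdiv. ring. }
  rewrite E.
  set (w := fun k => s - RtoC (INR (2 * k))).
  set (u := fun i k => cos_term k * RtoC (th ^ (2 * k)) * (w k * cpow_neg (w k + 1) (RtoC (INR (S i))))).
  set (v := fun i k => cos_term k * RtoC (th ^ (2 * k)) * strip_T q (cpow_neg (w k)) (INR (S i) + qr / 2)).
  apply (clim_ext (fun n => csum (fun i => chi (Z.of_nat (S i)) * (csum (u i) n + / RtoC qr * csum (v i) n)) q)).
  - intros n. unfold shifted_L.
    transitivity (csum (fun i => csum (fun k => chi (Z.of_nat (S i)) * (u i k + / RtoC qr * v i k)) n) q).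
    + apply csum_ext. intros i _. rewrite csum_scal, csum_plus, csum_scal. reflexivity.
    + rewrite csum_exchange. apply csum_ext. intros k _.
      match goal with |- _ = ?a * ?S * ?T => replace (a * S * T) with (a * T * S) by ring end.
      rewrite <- csum_scal. apply csum_ext. intros i _. unfold u, v, w. ring.
  - apply (clim_csum (fun i n => chi (Z.of_nat (S i)) * (csum (u i) n + / RtoC qr * csum (v i) n))).
    intros i _. apply clim_scal, clim_plus.
    (* First members of the classes: z^(-s-1) factors out and [cos_sin_series] at th z remains. *)
    + unfold u. set (z := RtoC (INR (S i))).
      assert (Pz : (0 < Re z)%R) by (simpl; apply (INR_S_pos i)).
      assert (Nz : z <> 0) by (intros E0; rewrite E0 in Pz; simpl in Pz; lra).
      apply (clim_ext (fun n => cpow_neg (s + 1) z * csum (fun k => cos_term k * w k * (RtoC th * z) ^ (2 * k)) n)).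
      * intros n. rewrite <- csum_scal. apply csum_ext. intros k _.
        replace (w k + 1) with (s + 1 - RtoC (INR (2 * k))) by (unfold w; ring).
        rewrite cpow_neg_minus_INR by auto. rewrite Cpow_mult_l, RtoC_pow. ring.
      * replace (- dhcos s th z) with (cpow_neg (s + 1) z * (s * ccos (RtoC th * z) + (RtoC th * z) * csin (RtoC th * z))).
        -- apply clim_scal, cos_sin_series.
        -- unfold dhcos. rewrite (cpow_neg_plus s 1), cpow_neg_1 by auto. field; auto.
    + apply clim_scal. apply strip_T_cos_series; auto using abscissa_ge_1.
Qed.

End Continuation.

Theorem theorem3p25 (q : nat) (chi : Z -> C) (c : R) (s : C) (x : R)
    (hq : (1 <= q)%nat) (hchi : Dirichlet_character q chi)
    (hc : (0 < c)%R) (hs : (1 < Re s)%R)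
    (hx : (Rabs x <= 2 * c / INR q)%R) :
  exists A B r : C,
    is_series
      (fun n : nat =>
         chi (Z.of_nat (S n)) / nat_cpow (S n) (s + 1)
         * RtoC (cos (INR (S n) * PI * x / c)) : C_NormedModule) A
    /\ is_series
      (fun n : nat =>
         chi (Z.of_nat (S n)) / nat_cpow (S n) s
         * RtoC (sin (INR (S n) * PI * x / c)) : C_NormedModule) B
    /\ filterlim (fun w : C => w * Dirichlet_L chi (1 + w))
         (locally' (RtoC 0)) (locally r)
    /\ is_series
      (fun k : nat =>
         RtoC ((-1) ^ k / INR (fact (2 * k)))
         * (if Ceq_dec s (RtoC (INR (2 * k))) then r
            else (s - RtoC (INR (2 * k)))
                 * Dirichlet_L chi (s + 1 - RtoC (INR (2 * k))))
         * RtoC ((PI * x / c) ^ (2 * k)) : C_NormedModule)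
      (s * A + RtoC (PI * x / c) * B).
Proof.
  pose proof (chi_periodic _ _ hchi) as Hper.
  set (th := (PI * x / c)%R).
  assert (Eth : forall n, (INR (S n) * PI * x / c = th * INR (S n))%R)
    by (intros; unfold th; field; lra).
  assert (Hth : (INR q * Rabs th <= 2 * PI)%R).
  (* The hypothesis on [x] is exactly the growth condition of the strip, equality included. *)
  { pose proof (qr_ge_1 q hq) as Hq. pose proof PI_RGT_0. unfold th, Rdiv.
    rewrite !Rabs_mult, (Rabs_pos_eq PI), (Rabs_pos_eq (/ c)) by (try (left; apply Rinv_0_lt_compat); lra).
    apply Rle_trans with (INR q * (PI * (2 * c / INR q) * / c))%R.
    - apply Rmult_le_compat_l; [lra|]. apply Rmult_le_compat_r; [left; apply Rinv_0_lt_compat; lra|].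
      apply Rmult_le_compat_l; [lra|exact hx].
    - right. field. lra. }
  destruct (ex_twisted_series q hq chi Hper (s + 1) (fun n => cos (th * INR (S n)))) as [A HA];
    [rewrite re_plus; simpl; lra|intros; apply COS_bound|].
  destruct (ex_twisted_series q hq chi Hper s (fun n => sin (th * INR (S n))) hs) as [B HB];
    [intros; apply SIN_bound|].
  (* The limit of w L (1 + w) at 0 is this value whether or not L has a pole at 1. *)
  exists A, B, (shifted_L q chi 0). split; [|split; [|split]].
  - apply (is_series_ext (K := C_AbsRing) (V := C_NormedModule)) with (2 := HA).
    intros n. rewrite Eth. reflexivity.
  - apply (is_series_ext (K := C_AbsRing) (V := C_NormedModule)) with (2 := HB).
    intros n. rewrite Eth. reflexivity.
  - apply residue_limit; auto.
  - apply (is_series_ext (K := C_AbsRing) (V := C_NormedModule))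
      with (2 := fourier_series_eq q hq chi Hper s th A B hs Hth HA HB).
    (* It remains to identify [shifted_L (s - 2k)]: at s = 2k it is the limit just chosen, and
       elsewhere the factor s - 2k cancels the denominator in [Dirichlet_L_eq]. *)
    intros k. unfold cos_term. f_equal. f_equal.
    destruct (Ceq_dec s (RtoC (INR (2 * k)))) as [E|N].
    + rewrite E. f_equal. cring.
    + assert (N0 : s - RtoC (INR (2 * k)) <> 0) by (apply Cminus_eq_contra; auto).
      rewrite (Dirichlet_L_eq q hq chi Hper).
      * replace (s + 1 - RtoC (INR (2 * k)) - 1) with (s - RtoC (INR (2 * k))) by ring.
        cfield; auto.
      * intros E. apply N0. replace (s - RtoC (INR (2 * k))) with (s + 1 - RtoC (INR (2 * k)) - 1) by ring.
        rewrite E. ring.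
Qed.
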